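(* Let $\{F_i\}_{i\in\mathcal{I}}$ be a differential factorization inverse system over a differential field $F$ with the simultaneous factorization property, let $K=C_F$, and let $G$ be a linear algebraic group over $K$. Let $(\{S_i\}_{i\in\mathcal{I}},\{\Theta_{kl_k},\Theta_{kr_k}\}_{k\in\mathcal{I}_e})$ define a patching problem of differential $G_F$-torsors, and let $(S,\{\Phi_i\}_{i\in\mathcal{I}_v})$ be its solution (unique up to differential isomorphism), with $S=\varprojlim_{i\in\mathcal{I}} S_i$. Suppose that: (1) $G$ is generated by closed $K$-subgroups $H_i$, $i\in\mathcal{I}_v$ (that is, $G$ is the smallest closed subgroup of $G$ containing all the $H_i$); (2) for each $i\in\mathcal{I}_v$ there is a Picard-Vessiot ring $R_i/F_i$ with differential Galois group $(H_i)_{K_i}$, where $K_i=C_{F_i}$, such that $S_i=\mathrm{Ind}_{H_i}^{G}(R_i)$; (3) $S_k=F_k[G]$ for all $k\in\mathcal{I}_e$; (4) for each $i\succ k$ there is an embedding of differential $F_i$-algebras $R_i\hookrightarrow F_k$, and the map $\Theta_{ki}\colon F_k\otimes_{F_i}S_i\to S_k=F_k[G]$ is the isomorphism of differential $G_{F_k}$-torsors associated to that embedding, i.e. $\Theta_{ki}(\sum_j a_j\otimes r_j\otimes f_j)=\sum_j a_j r_j f_j$ for $a_j\in F_k$, $r_j\in R_i\subseteq F_k$, $f_j\in F_i[G]\subseteq F_k[G]$ with $\sum_j a_j\otimes r_j\otimes f_j\in F_k\otimes_{F_i}(R_i\otimes_{F_i}F_i[G])^{H_i}=F_k\otimes_{F_i}S_i$.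 Then $S/F$ is a Picard-Vessiot ring with differential Galois group $G$.
   Context: Factorization inverse systems. A factorization inverse system over a field $F$ is a finite inverse system of fields $\{F_i\}_{i\in\mathcal{I}}$ whose inverse limit (in the category of rings) is $F$, whose index set is a disjoint union $\mathcal{I}=\mathcal{I}_v\cup\mathcal{I}_e$ such that for each $k\in\mathcal{I}_e$ there are exactly two elements $i,j\in\mathcal{I}_v$ for which the system contains maps $F_i,F_j\to F_k$, and such that there are no other maps in the system. Write $i\succ k$ if there is a map $F_i\to F_k$. For every $k\in\mathcal{I}_e$ one fixes a labeling $l_k,r_k\in\mathcal{I}_v$ of the two elements $\succ k$. The system has the simultaneous factorization property if for every $n\geq 1$ and any collection of matrices $A_k\in\mathrm{GL}_n(F_k)$, $k\in\mathcal{I}_e$, there exist $A_i\in\mathrm{GL}_n(F_i)$ for $i\in\mathcal{I}_v$ such that $A_k=A_{r_k}^{-1}A_{l_k}$ for all $k\in\mathcal{I}_e$. It is a differential factorization inverse system if all $F_i$ are differential fields of characteristic zero and all inclusions $F_{l_k},F_{r_k}\hookrightarrow F_k$ are differential homomorphisms; then $F$ inherits the structure of a differential field. Differential torsors. A linear algebraic group over $K$ is an affine group scheme of finite type over $K$. For a differential field extension $L/F$, $L[G]:=L\otimes_K K[G]$ is a differential ring in which the elements of $K[G]$ are constant. A $G_L$-torsor is a non-empty affine scheme $X$ of finite type over $L$ with a right $G_L$-action such that for every $L$-algebra $R$ and all $x,y\in X(R)$ there is a unique $g\in G(R)$ with $y=x.g$. A differential $G_L$-torsor is a $G_L$-torsor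 $X$ with an extension of the derivation from $L$ to $L[X]$ such that the co-action $L[X]\to L[X]\otimes_L L[G]$ is a differential homomorphism. $L[G]$ itself is regarded as a differential torsor via right multiplication. Patching problems. A patching problem of differential $G_F$-torsors consists of differential $G_{F_i}$-torsors $\mathrm{Spec}(S_i)$ for $i\in\mathcal{I}$ together with, for all $i\succ k$, isomorphisms $\Theta_{ki}\colon F_k\otimes_{F_i}S_i\to S_k$ of differential $F_k$-algebras respecting the $G$-actions. A solution is a differential $G_F$-torsor $\mathrm{Spec}(S)$ with isomorphisms $\Phi_i\colon F_i\otimes_F S\to S_i$, $i\in\mathcal{I}_v$, of (coordinate rings of) differential $G_{F_i}$-torsors, such that for each $k\in\mathcal{I}_e$ the maps $\Theta_{kl_k}\circ(\mathrm{id}_{F_k}\otimes\Phi_{l_k})$ and $\Theta_{kr_k}\circ(\mathrm{id}_{F_k}\otimes\Phi_{r_k})\colon F_k\otimes_F S\to S_k$ coincide. Under the simultaneous factorization property a solution exists and is unique up to differential isomorphism, given by $S=\varprojlim S_i$ with $\Phi_i$ induced by $S\to S_i$ and action and derivation given by restriction. Picard-Vessiot rings. Let $L$ be a differential field of characteristic zero. A Picard-Vessiot ring over $L$ is a differential ring extension $R/L$ of the form $R=L[Z,\det(Z)^{-1}]$ with $Z\in\mathrm{GL}_n(R)$, $\partial(Z)Z^{-1}\in L^{n\times n}$, such that $R$ has no non-trivial differential ideals and $C_R=C_L$. Its differential Galois group is the group scheme $\underline{\mathrm{Aut}}^{\partial}(R/L)$ over $C_L$, sending a $C_L$-algebra $A$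 to the group of differential $L\otimes_{C_L}A$-automorphisms of $R\otimes_{C_L}A$ ($A$ constant). If it is identified with $H_{C_L}$, then $\mathrm{Spec}(R)$ is a differential $H_L$-torsor. Induction. For a closed subgroup $H\subseteq G$ and a differential $H_L$-torsor $\mathrm{Spec}(R)$, $\mathrm{Ind}_H^G(R):=(R\otimes_L L[G])^{H}$, the invariants for the right action $(y,g).h=(y.h,h^{-1}g)$ of $H_L$ on $\mathrm{Spec}(R)\times G_L$; its spectrum is a differential $G_L$-torsor, with $G$ acting by right multiplication on the second factor and derivation restricted from $R\otimes_L L[G]$. *)

(* Defs.v *)
From HB Require Import structures.
From mathcomp Require Import all_boot all_order all_algebra.
From mathcomp Require Import generic_quotient.
From mathcomp Require Import boolp.

Set Implicit Arguments.
Unset Strict Implicit.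
Unset Printing Implicit Defensive.

Import GRing.Theory.
Local Open Scope ring_scope.
Local Open Scope quotient_scope.

(* Rings are commutative, and the zero ring is allowed (comPzRingType).       *)

(* A (x)_L B, for ring morphisms f : L -> A and g : L -> B, is the set of     *)
(* formal sums a_1 (x) b_1 + ... + a_n (x) b_n, represented by sequences of   *)
(* pairs, two of them being identified when all L-balanced biadditive maps    *)
(* take the same value on them.                                               *)
Section Tensor.

Variables (L A B : comPzRingType).
Variables (f : {rmorphism L -> A}) (g : {rmorphism L -> B}).

Record balanced (V : zmodType) (phi : A -> B -> V) : Prop := Balanced {
  balancedDl : forall a a' b, phi (a + a') b = phi a b + phi a' b;
  balancedDr : forall a b b', phi a (b + b') = phi a b + phi a b';
  balancedZ : forall c a b, phi (a * f c) b = phi a (g c * b) }.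

Definition sum_eval (V : zmodType) (phi : A -> B -> V) (s : seq (A * B)) : V :=
  \sum_(p <- s) phi p.1 p.2.

Definition tensor_eqv (s t : seq (A * B)) : bool :=
  `[< forall (V : zmodType) (phi : A -> B -> V),
        balanced phi -> sum_eval phi s = sum_eval phi t >].

Lemma tensor_eqv_refl : reflexive tensor_eqv.
Proof. by move=> s; apply/asboolP. Qed.

Lemma tensor_eqv_sym : symmetric tensor_eqv.
Proof. by move=> s t; apply/asboolP/asboolP => h V phi ?; rewrite h. Qed.

Lemma tensor_eqv_trans : transitive tensor_eqv.
Proof.
by move=> s t u /asboolP h /asboolP h'; apply/asboolP => V phi ?; rewrite h ?h'.
Qed.

Definition tensor_eqv_equiv :=
  EquivRel tensor_eqv tensor_eqv_refl tensor_eqv_sym tensor_eqv_trans.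
Canonical tensor_eqv_equiv.

Definition tensor := {eq_quot tensor_eqv}.
HB.instance Definition _ := Choice.copy tensor {eq_quot tensor_eqv}.

Definition tpi (s : seq (A * B)) : tensor := \pi_({eq_quot tensor_eqv}) s.
Definition trepr (x : tensor) : seq (A * B) :=
  repr (x : {eq_quot tensor_eqv}).

(* The additive map A (x)_L B -> V induced by phi, meaningful when phi is     *)
(* balanced: see tevalP and tevalD.                                           *)
Definition teval (V : zmodType) (phi : A -> B -> V) (x : tensor) : V :=
  sum_eval phi (trepr x).

Lemma teval_tpi (V : zmodType) (phi : A -> B -> V) s :
  balanced phi -> teval phi (tpi s) = sum_eval phi s.
Proof.
move=> bphi.
have : tpi (trepr (tpi s)) = tpi s by rewrite /tpi /trepr reprK.
by move/eqmodP/asboolP => h; apply: h.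
Qed.

Lemma tensor_ext (x y : tensor) :
  (forall (V : zmodType) (phi : A -> B -> V),
     balanced phi -> teval phi x = teval phi y) -> x = y.
Proof.
move=> h; have kx z : tpi (trepr z) = z by rewrite /tpi /trepr reprK.
by rewrite -(kx x) -(kx y); apply/eqmodP/asboolP.
Qed.

Section Balanced.
Variables (V : zmodType) (phi : A -> B -> V).
Hypothesis bphi : balanced phi.

Lemma balanced0l b : phi 0 b = 0.
Proof. by apply: (addrI (phi 0 b)); rewrite -balancedDl // !addr0. Qed.

Lemma balanced0r a : phi a 0 = 0.
Proof. by apply: (addrI (phi a 0)); rewrite -balancedDr // !addr0. Qed.

Lemma balancedNl a b : phi (- a) b = - phi a b.
Proof. by apply: (addrI (phi a b)); rewrite -balancedDl // !subrr balanced0l. Qed.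

Lemma balanced_shift a b : balanced (fun a' b' => phi (a * a') (b * b')).
Proof.
split=> [a1 a2 b1|a1 b1 b2|c a1 b1].
- by rewrite mulrDr balancedDl.
- by rewrite mulrDr balancedDr.
- by rewrite mulrA balancedZ // mulrCA.
Qed.

End Balanced.

Definition tpure (a : A) (b : B) : tensor := tpi [:: (a, b)].
Definition tzero : tensor := tpi [::].
Definition tadd (x y : tensor) : tensor := tpi (trepr x ++ trepr y).
Definition topp (x : tensor) : tensor :=
  tpi [seq (- p.1, p.2) | p <- trepr x].
Definition tmul (x y : tensor) : tensor :=
  tpi [seq (p.1 * q.1, p.2 * q.2) | p <- trepr x, q <- trepr y].

Section TevalOps.
Variables (V : zmodType) (phi : A -> B -> V).
Hypothesis bphi : balanced phi.

Lemma tevalP a b : teval phi (tpure a b) = phi a b.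
Proof. by rewrite teval_tpi // /sum_eval big_seq1. Qed.

Lemma teval_tzero : teval phi tzero = 0.
Proof. by rewrite teval_tpi // /sum_eval big_nil. Qed.

Lemma teval_tadd x y : teval phi (tadd x y) = teval phi x + teval phi y.
Proof. by rewrite teval_tpi // /sum_eval big_cat. Qed.

Lemma teval_topp x : teval phi (topp x) = - teval phi x.
Proof.
rewrite teval_tpi // /sum_eval big_map -sumrN.
by apply: eq_bigr => p _; rewrite balancedNl.
Qed.

Lemma teval_tmul x y : teval phi (tmul x y) =
  teval (fun a b => teval (fun a' b' => phi (a * a') (b * b')) y) x.
Proof.
by rewrite teval_tpi // /sum_eval big_allpairs_dep.
Qed.

Lemma balanced_outer y :
  balanced (fun a b => teval (fun a' b' => phi (a * a') (b * b')) y).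
Proof.
split=> [a1 a2 b1|a1 b1 b2|c a1 b1]; rewrite /teval /sum_eval -?big_split.
- by apply: eq_bigr => p _; rewrite mulrDl balancedDl.
- by apply: eq_bigr => p _; rewrite mulrDl balancedDr.
- by apply: eq_bigr => p _; rewrite mulrAC balancedZ // mulrA.
Qed.

End TevalOps.

Lemma taddA : associative tadd.
Proof. by move=> x y z; apply: tensor_ext => V phi h; rewrite !teval_tadd ?addrA. Qed.

Lemma taddC : commutative tadd.
Proof. by move=> x y; apply: tensor_ext => V phi h; rewrite !teval_tadd // addrC. Qed.

Lemma tadd0 : left_id tzero tadd.
Proof.
by move=> x; apply: tensor_ext => V phi h; rewrite teval_tadd // teval_tzero // add0r.
Qed.

Lemma taddN : left_inverse tzero topp tadd.
Proof.
move=> x; apply: tensor_ext => V phi h.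
by rewrite teval_tadd // teval_topp // teval_tzero // addNr.
Qed.

HB.instance Definition _ := GRing.isZmodule.Build tensor taddA taddC tadd0 taddN.

Lemma eq_teval (V : zmodType) (phi psi : A -> B -> V) x :
  (forall a b, phi a b = psi a b) -> teval phi x = teval psi x.
Proof. by move=> e; apply: eq_bigr => p _; rewrite e. Qed.

Lemma tmulA : associative tmul.
Proof.
move=> x y z; apply: tensor_ext => V phi h.
rewrite !teval_tmul //; last exact: balanced_outer.
apply: eq_teval => a b; rewrite teval_tmul; last exact: balanced_shift.
by apply: eq_teval => a' b'; apply: eq_teval => a'' b''; rewrite !mulrA.
Qed.

Lemma tmulC : commutative tmul.
Proof.
move=> x y; apply: tensor_ext => V phi h; rewrite !teval_tmul //.
rewrite /teval /sum_eval exchange_big /=.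
by apply: eq_bigr => p _; apply: eq_bigr => q _; rewrite mulrC [q.2 * _]mulrC.
Qed.

Lemma tmul1 : left_id (tpure 1 1) tmul.
Proof.
move=> x; apply: tensor_ext => V phi h.
rewrite teval_tmul // tevalP; last exact: balanced_outer.
by apply: eq_teval => a b; rewrite !mul1r.
Qed.

Lemma tmulDl : left_distributive tmul tadd.
Proof.
move=> x y z; apply: tensor_ext => V phi h.
rewrite teval_tadd // !teval_tmul // teval_tadd //; exact: balanced_outer.
Qed.

HB.instance Definition _ :=
  GRing.Zmodule_isComPzRing.Build tensor tmulA tmulC tmul1 tmulDl.

Lemma tevalD (V : zmodType) (phi : A -> B -> V) :
  balanced phi -> {morph teval phi : x y / x + y}.
Proof. by move=> h x y; rewrite teval_tadd. Qed.

Lemma balanced_tpure : balanced tpure.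
Proof.
split=> [a1 a2 b|a b1 b2|c a b]; apply: tensor_ext => V phi h.
- by rewrite teval_tadd // !tevalP // balancedDl.
- by rewrite teval_tadd // !tevalP // balancedDr.
- by rewrite !tevalP // balancedZ.
Qed.

Lemma tpureM a b a' b' : tpure a b * tpure a' b' = tpure (a * a') (b * b').
Proof.
apply: tensor_ext => V phi h; rewrite teval_tmul // tevalP //.
  by rewrite !tevalP //; apply: balanced_shift.
exact: balanced_outer.
Qed.

Lemma tensor_sum (x : tensor) : x = \sum_(p <- trepr x) tpure p.1 p.2.
Proof.
apply: tensor_ext => V phi h.
have -> s : teval phi (\sum_(p <- s) tpure p.1 p.2) = sum_eval phi s.
  elim: s => [|p s IHs]; first by rewrite big_nil teval_tzero // /sum_eval big_nil.
  by rewrite big_cons teval_tadd // tevalP // IHs /sum_eval big_cons.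
by [].
Qed.

Lemma tensor_ind (P : tensor -> Prop) :
  (forall a b, P (tpure a b)) -> (forall x y, P x -> P y -> P (x + y)) ->
  forall x, P x.
Proof.
move=> Pp PD x; rewrite (tensor_sum x); apply: big_ind => //.
by rewrite -(balanced0l balanced_tpure 0); apply: Pp.
Qed.

Definition tinl (a : A) : tensor := tpure a 1.
Definition tinr (b : B) : tensor := tpure 1 b.

Lemma tinl_zmod : zmod_morphism tinl.
Proof.
move=> a b; rewrite /tinl (balancedDl balanced_tpure).
by rewrite (balancedNl balanced_tpure).
Qed.

Lemma tinl_monoid : monoid_morphism tinl.
Proof. by split=> // a b; rewrite /tinl tpureM mulr1. Qed.

HB.instance Definition _ := GRing.isZmodMorphism.Build A tensor tinl tinl_zmod.
HB.instance Definition _ := GRing.isMonoidMorphism.Build A tensor tinl tinl_monoid.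

Lemma tinr_zmod : zmod_morphism tinr.
Proof.
move=> a b; apply/eqP; rewrite eq_sym subr_eq eq_sym.
by rewrite /tinr -(balancedDr balanced_tpure) subrK.
Qed.

Lemma tinr_monoid : monoid_morphism tinr.
Proof. by split=> // a b; rewrite /tinr tpureM mulr1. Qed.

HB.instance Definition _ := GRing.isZmodMorphism.Build B tensor tinr tinr_zmod.
HB.instance Definition _ := GRing.isMonoidMorphism.Build B tensor tinr tinr_monoid.

Lemma tinlr a b : tinl a * tinr b = tpure a b.
Proof. by rewrite tpureM mulr1 mul1r. Qed.

Lemma tinl_tinr c : tinl (f c) = tinr (g c).
Proof.
by rewrite /tinl /tinr -[f c]mul1r (balancedZ balanced_tpure) mulr1.
Qed.

(* The ring morphism induced by u and v, meaningful when u and v are ring     *)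
(* morphisms with u \o f = v \o g.                                            *)
Definition tlift (T : comPzRingType) (u : A -> T) (v : B -> T) : tensor -> T :=
  teval (fun a b => u a * v b).

(* The derivation induced by dA and dB, meaningful when dA and dB are         *)
(* derivations that restrict to the same derivation on L.                     *)
Definition tder (dA : A -> A) (dB : B -> B) : tensor -> tensor :=
  teval (fun a b => tpure (dA a) b + tpure a (dB b)).

End Tensor.

Section TensorMorphisms.

Variables (L A B T : comPzRingType).
Variables (f : {rmorphism L -> A}) (g : {rmorphism L -> B}).
Variables (u : {rmorphism A -> T}) (v : {rmorphism B -> T}).
Hypothesis uv : forall c, u (f c) = v (g c).

Lemma tlift_balanced : balanced f g (fun a b => u a * v b).
Proof.
split=> [a a' b|a b b'|c a b].
- by rewrite rmorphD mulrDl.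
- by rewrite rmorphD mulrDr.
- by rewrite !rmorphM uv mulrA.
Qed.

Lemma tliftE a b : tlift (f := f) (g := g) u v (tpure f g a b) = u a * v b.
Proof. exact: tevalP tlift_balanced _ _. Qed.

Lemma tlift_zmod : zmod_morphism (tlift (f := f) (g := g) u v).
Proof.
move=> x y; have h := tevalD tlift_balanced.
by apply/eqP; rewrite eq_sym subr_eq -h subrK.
Qed.

Lemma tlift_monoid : monoid_morphism (tlift (f := f) (g := g) u v).
Proof.
have h : {morph tlift (f := f) (g := g) u v : x y / x + y}.
  exact: tevalD tlift_balanced.
split=> [|x y].
  by rewrite tliftE !rmorph1 mulr1.
elim/tensor_ind: x y => [a b|x x' IHx IHx'] y; last first.
  by rewrite mulrDl !h mulrDl IHx IHx'.
elim/tensor_ind: y => [a' b'|y y' IHy IHy']; last first.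
  by rewrite mulrDr !h mulrDr IHy IHy'.
by rewrite tpureM !tliftE !rmorphM mulrACA.
Qed.

End TensorMorphisms.

Definition tmap (L A B A' B' : comPzRingType)
    (f : {rmorphism L -> A}) (g : {rmorphism L -> B})
    (L' : comPzRingType)
    (f' : {rmorphism L' -> A'}) (g' : {rmorphism L' -> B'})
    (u : A -> A') (v : B -> B') : tensor f g -> tensor f' g' :=
  tlift (fun a => tinl f' g' (u a)) (fun b => tinr f' g' (v b)).

Definition derivation (R : pzRingType) (d : R -> R) : Prop :=
  (forall x y, d (x + y) = d x + d y) /\
  (forall x y, d (x * y) = d x * y + x * d y).

Lemma derivation1 (R : pzRingType) (d : R -> R) : derivation d -> d 1 = 0.
Proof.
move=> [_ dM]; have := dM 1 1; rewrite !mulr1 mul1r => /eqP.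
by rewrite eq_sym -subr_eq0 addrK => /eqP.
Qed.

Lemma derivation0 (R : pzRingType) (d : R -> R) : derivation d -> d 0 = 0.
Proof. by move=> [dD _]; apply: (addrI (d 0)); rewrite -dD !addr0. Qed.

Section TensorDerivation.

Variables (L A B : comPzRingType).
Variables (f : {rmorphism L -> A}) (g : {rmorphism L -> B}).
Variables (dL : L -> L) (dA : A -> A) (dB : B -> B).
Hypotheses (derA : derivation dA) (derB : derivation dB).
Hypotheses (dAf : forall c, dA (f c) = f (dL c)).
Hypotheses (dBg : forall c, dB (g c) = g (dL c)).

Lemma tder_balanced :
  balanced f g (fun a b => tpure f g (dA a) b + tpure f g a (dB b)).
Proof.
have [dAD dAM] := derA; have [dBD dBM] := derB; have bp := balanced_tpure f g.
split=> [a a' b|a b b'|c a b].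
- by rewrite dAD !(balancedDl bp) addrACA.
- by rewrite dBD !(balancedDr bp) addrACA.
- rewrite dAM dBM (balancedDl bp) (balancedDr bp) dAf dBg !(balancedZ bp).
  by rewrite -addrA.
Qed.

Lemma tderE a b :
  tder (f := f) (g := g) dA dB (tpure f g a b) =
  tpure f g (dA a) b + tpure f g a (dB b).
Proof. exact: tevalP tder_balanced _ _. Qed.

Lemma tder_derivation : derivation (tder (f := f) (g := g) dA dB).
Proof.
have [dAD dAM] := derA; have [dBD dBM] := derB; have bp := balanced_tpure f g.
have h : {morph tder (f := f) (g := g) dA dB : x y / x + y}.
  exact: tevalD tder_balanced.
split=> // x y.
elim/tensor_ind: x y => [a b|x x' IHx IHx'] y; last first.
  by rewrite mulrDl !h IHx IHx' !mulrDl addrACA.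
elim/tensor_ind: y => [a' b'|y y' IHy IHy']; last first.
  by rewrite mulrDr !h IHy IHy' !mulrDr addrACA.
rewrite tpureM !tderE mulrDl mulrDr !tpureM dAM dBM.
by rewrite (balancedDl bp) (balancedDr bp) addrACA.
Qed.

Lemma tder_tinl a : tder (f := f) (g := g) dA dB (tinl f g a) = tinl f g (dA a).
Proof.
by rewrite tderE derivation1 // (balanced0r (balanced_tpure f g)) addr0.
Qed.

Lemma tder_tinr b : tder (f := f) (g := g) dA dB (tinr f g b) = tinr f g (dB b).
Proof.
by rewrite tderE derivation1 // (balanced0l (balanced_tpure f g)) add0r.
Qed.

End TensorDerivation.

Arguments tlift {L A B f g T} u v x.
Arguments tder {L A B f g} dA dB x.
Arguments tmap {L A B A' B' f g L' f' g'} u v x.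

Lemma derivation_cst0 (R : pzRingType) : derivation (fun _ : R => 0).
Proof. by split=> x y; rewrite ?mul0r ?mulr0 addr0. Qed.

(* Differential fields have characteristic zero throughout.                   *)
Record diffField := DiffField {
  dfield :> fieldType;
  fder : dfield -> dfield;
  fder_derivation : derivation fder;
  dfield_pchar0 : [pchar dfield] =i pred0 }.

Arguments fder {d} x.

Record diffHom (L M : diffField) := DiffHom {
  dhom :> {rmorphism L -> M};
  dhomP : forall x, dhom (fder x) = fder (dhom x) }.

Definition is_const (L : diffField) : {pred L} := [pred x | fder x == 0].
Arguments is_const : clear implicits.

Lemma is_const_divring (L : diffField) : divring_closed (is_const L).
Proof.
have der := fder_derivation L; have [dD dM] := der.
have dN (x : L) : fder (- x) = - fder x.
  by apply: (addrI (fder x)); rewrite -dD !subrr derivation0.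
split=> [|x y|x y]; rewrite !inE; first by rewrite derivation1.
  by move=> /eqP dx /eqP dy; rewrite dD dN dx dy subrr.
move=> /eqP dx /eqP dy; have [->|y0] := eqVneq y 0.
  by rewrite invr0 mulr0 derivation0.
have /eqP : fder (y * y^-1) = 0 by rewrite mulfV // derivation1.
rewrite dM dy mul0r add0r mulf_eq0 (negPf y0) /= => /eqP dV.
by rewrite dM dx dV mul0r mulr0 addr0.
Qed.

HB.instance Definition _ (L : diffField) :=
  GRing.isDivringClosed.Build L (is_const L) (is_const_divring L).

Record const (L : diffField) := Const {
  const_val : L;
  const_valP : const_val \in is_const L }.

HB.instance Definition _ (L : diffField) := [isSub for @const_val L].
HB.instance Definition _ (L : diffField) := [Choice of const L by <:].
HB.instance Definition _ (L : diffField) :=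
  [SubChoice_isSubIntegralDomain of const L by <:].
HB.instance Definition _ (L : diffField) :=
  [SubIntegralDomain_isSubField of const L by <:].

Definition const_inj (L : diffField) : {rmorphism const L -> L} :=
  (val : const L -> L).

Lemma const_injP (L : diffField) (c : const L) : fder (const_inj L c) = 0.
Proof. exact/eqP/const_valP. Qed.

Section ConstMap.
Variables (L M : diffField) (phi : diffHom L M).

Lemma const_map_subproof (c : const L) : phi (const_inj L c) \in is_const M.
Proof. by rewrite inE -dhomP const_injP rmorph0. Qed.

Definition const_map (c : const L) : const M := Const (const_map_subproof c).

Lemma const_map_zmod : zmod_morphism const_map.
Proof. by move=> x y; apply: val_inj; rewrite /= !rmorphB. Qed.

Lemma const_map_monoid : monoid_morphism const_map.
Proof. by split=> [|x y]; apply: val_inj; rewrite /= ?rmorph1 ?rmorphM. Qed.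

HB.instance Definition _ :=
  GRing.isZmodMorphism.Build (const L) (const M) const_map const_map_zmod.
HB.instance Definition _ :=
  GRing.isMonoidMorphism.Build (const L) (const M) const_map const_map_monoid.

End ConstMap.

(* An L-algebra is a commutative ring with an explicit structure morphism, so *)
(* that towers and changes of base need no aliases.                           *)
Record alg (L : comPzRingType) := Alg {
  acar :> comPzRingType;
  astr : {rmorphism L -> acar} }.

Arguments astr {L} a.

Definition restr (L M : comPzRingType) (f : {rmorphism L -> M}) (A : alg M) :
  alg L := Alg (astr A \o f).

Definition alghom (L : comPzRingType) (A B : alg L) (h : A -> B) : Prop :=
  [/\ zmod_morphism h, monoid_morphism h & forall c, h (astr A c) = astr B c].

Definition gen_by (L : comPzRingType) (A : alg L) (X : A -> Prop) (x : A) :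
    Prop :=
  forall P : A -> Prop,
    (forall c, P (astr A c)) -> (forall a, X a -> P a) ->
    (forall a b, P a -> P b -> P (a + b)) ->
    (forall a b, P a -> P b -> P (a * b)) -> P x.

Definition finite_type (L : comPzRingType) (A : alg L) : Prop :=
  exists s : seq A, forall x, gen_by (fun a => a \in s) x.

Record diffAlg (L : diffField) := DiffAlg {
  dalg :> alg L;
  ader : dalg -> dalg;
  ader_derivation : derivation ader;
  ader_str : forall c, ader (astr dalg c) = astr dalg (fder c) }.

Arguments ader {L} d x.

Definition dalghom (L : diffField) (A B : diffAlg L) (h : A -> B) : Prop :=
  alghom h /\ forall x, h (ader A x) = ader B (h x).

Section DiffAlgConstructions.

Variable L : diffField.

Definition field_dalg (M : diffField) (phi : diffHom L M) : diffAlg L :=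
  @DiffAlg L (Alg phi) fder (fder_derivation M)
    (fun c => esym (dhomP phi c)).

Section Tensor.
Variables A B : diffAlg L.

Definition tens : alg L := Alg (tinl (astr A) (astr B) \o astr A).

Lemma dtens_derivation : derivation (tder (ader A) (ader B) : tens -> tens).
Proof.
by apply: tder_derivation; [exact: ader_derivation..|exact: ader_str|exact: ader_str].
Qed.

Lemma dtens_str c :
  tder (ader A) (ader B) (astr tens c) = astr tens (fder c).
Proof.
rewrite [LHS](tder_tinl (ader_derivation A) (ader_derivation B)
  (ader_str A) (ader_str B)).
by rewrite ader_str.
Qed.

Definition dtens : diffAlg L := DiffAlg dtens_derivation dtens_str.
End Tensor.

Section BaseChange.
Variables (M : diffField) (phi : diffHom L M) (A : diffAlg L).

(* M (x)_L A *)
Definition bc : alg M := Alg (tinl phi (astr A)).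

Lemma dbc_derivation : derivation (tder fder (ader A) : bc -> bc).
Proof.
apply: tder_derivation; first exact: fder_derivation.
- exact: ader_derivation.
- by move=> c; rewrite -dhomP.
- exact: ader_str.
Qed.

Lemma dbc_str c : tder fder (ader A) (astr bc c) = astr bc (fder c).
Proof.
by rewrite [LHS](tder_tinl (fder_derivation M) (ader_derivation A)
  (fun c => esym (dhomP phi c)) (ader_str A)).
Qed.

Definition dbc : diffAlg M := DiffAlg dbc_derivation dbc_str.
End BaseChange.

Section ConstantExtension.
Variables (R : diffAlg L) (A : alg (const L)).

(* R (x)_{C_L} A, the elements of A being constant *)
Definition ext : alg L :=
  Alg (tinl (astr R \o const_inj L) (astr A) \o astr R).

Let ext_compat c : ader R ((astr R \o const_inj L) c) =
  (astr R \o const_inj L) ((fun _ => 0) c).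
Proof. by rewrite /= ader_str const_injP !rmorph0. Qed.

Let ext_compat0 c : (fun _ : A => 0) (astr A c) = astr A ((fun _ => 0) c).
Proof. by rewrite rmorph0. Qed.

Lemma dext_derivation : derivation (tder (ader R) (fun _ => 0) : ext -> ext).
Proof.
exact: tder_derivation (ader_derivation R) (derivation_cst0 A) ext_compat ext_compat0.
Qed.

Lemma dext_str c :
  tder (ader R) (fun _ => 0) (astr ext c) = astr ext (fder c).
Proof.
rewrite [LHS](tder_tinl (ader_derivation R) (derivation_cst0 A)
  ext_compat ext_compat0).
by rewrite ader_str.
Qed.

Definition dext : diffAlg L := DiffAlg dext_derivation dext_str.
End ConstantExtension.

End DiffAlgConstructions.

(* For an affine scheme Spec A over K, the points over a K-algebra T are the  *)
(* K-algebra morphisms A -> T; pmul comul x y is the product of the points x  *)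
(* and y for the law with co-multiplication comul.                            *)
Definition pmul (K : comPzRingType) (A : alg K)
    (comul : A -> tensor (astr A) (astr A)) (T : comPzRingType)
    (x y : A -> T) : A -> T :=
  fun f => tlift x y (comul f).

Record algGroup (K : fieldType) := AlgGroup {
  coord :> alg K;
  comul : coord -> tensor (astr coord) (astr coord);
  counit : coord -> K;
  antipode : coord -> coord;
  comulP : @alghom K coord (Alg (tinl (astr coord) (astr coord) \o astr coord))
             comul;
  counitP : @alghom K coord (Alg idfun) counit;
  antipodeP : alghom antipode;
  gmulA : forall (T : alg K) (x y z : coord -> T),
    alghom x -> alghom y -> alghom z ->
    pmul comul x (pmul comul y z) =1 pmul comul (pmul comul x y) z;
  gmul1g : forall (T : alg K) (x : coord -> T), alghom x ->
    pmul comul (astr T \o counit) x =1 x;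
  gmulg1 : forall (T : alg K) (x : coord -> T), alghom x ->
    pmul comul x (astr T \o counit) =1 x;
  gmulVg : forall (T : alg K) (x : coord -> T), alghom x ->
    pmul comul (x \o antipode) x =1 astr T \o counit;
  gmulgV : forall (T : alg K) (x : coord -> T), alghom x ->
    pmul comul x (x \o antipode) =1 astr T \o counit;
  coord_finite : finite_type coord }.

Arguments comul {K} a.
Arguments counit {K} a.
Arguments antipode {K} a.

Definition gmul (K : fieldType) (G : algGroup K) (T : comPzRingType)
  (x y : G -> T) : G -> T := pmul (comul G) x y.
Definition gone (K : fieldType) (G : algGroup K) (T : alg K) : G -> T :=
  astr T \o counit G.
Definition ginv (K : fieldType) (G : algGroup K) (T : comPzRingType)
  (x : G -> T) : G -> T := x \o antipode G.

Record closedSubgroup (K : fieldType) (G : algGroup K) := ClosedSubgroup {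
  sgroup :> algGroup K;
  sgmap : G -> sgroup;
  sgmap_alghom : alghom sgmap;
  sgmap_surj : forall y, exists x, sgmap x = y;
  sgmap_comul : forall x,
    comul sgroup (sgmap x) = tmap sgmap sgmap (comul G x) }.

Arguments sgmap {K G} c x.

(* Both subgroups are closed in G, so inclusion is that of defining ideals.   *)
Definition subgroup_le (K : fieldType) (G : algGroup K)
    (H H' : closedSubgroup G) : Prop :=
  forall x, sgmap H' x = 0 -> sgmap H x = 0.

Definition generated_by (K : fieldType) (G : algGroup K) (I : Type)
    (H : I -> closedSubgroup G) : Prop :=
  forall H' : closedSubgroup G, (forall i, subgroup_le (H i) H') ->
    forall x, sgmap H' x = 0 -> x = 0.

(* From here on, K is a field of constants of L, via kappa.                   *)
Section OverField.

Variables (K : fieldType) (L : diffField) (kappa : {rmorphism K -> const L}).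

Definition kstr : {rmorphism K -> L} := const_inj L \o kappa.

Lemma kstrP c : fder (kstr c) = 0.
Proof. exact: const_injP. Qed.

Section GroupAlgebra.
Variable G : algGroup K.

Definition coordL_alg : alg L := Alg (tinl kstr (astr G)).

Let coordL_compat c : fder (kstr c) = kstr ((fun _ => 0) c).
Proof. by rewrite kstrP rmorph0. Qed.

Let coordL_compat0 c : (fun _ : G => 0) (astr G c) = astr G ((fun _ => 0) c).
Proof. by rewrite rmorph0. Qed.

Lemma coordL_derivation :
  derivation (tder fder (fun _ => 0) : coordL_alg -> coordL_alg).
Proof.
exact: tder_derivation (fder_derivation L) (derivation_cst0 G)
  coordL_compat coordL_compat0.
Qed.

Lemma coordL_str c :
  tder fder (fun _ => 0) (astr coordL_alg c) = astr coordL_alg (fder c).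
Proof.
exact: tder_tinl (fder_derivation L) (derivation_cst0 G)
  coordL_compat coordL_compat0 c.
Qed.

(* L[G] = L (x)_K K[G] *)
Definition coordL : diffAlg L := DiffAlg coordL_derivation coordL_str.

(* T-points of G, for an L-algebra T, as morphisms on K[G] and on L[G] *)
Definition gpoint (T : alg L) (x : G -> T) : Prop :=
  @alghom K G (restr kstr T) x.
Definition ptL (T : alg L) (x : G -> T) : coordL -> T := tlift (astr T) x.

(* A differential L-algebra with a map to be used as a co-action of G_L; the  *)
(* axioms are in diff_torsor.                                                 *)
Record gAlg := GAlg {
  galg :> diffAlg L;
  coact : galg -> dtens galg coordL }.

(* x.g, for x in (Spec S)(T) and g in G(T) *)
Definition act (S : gAlg) (T : alg L) (x : S -> T) (g : G -> T) : S -> T :=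
  fun s => tlift x (ptL g) (coact s).

Definition torsor (S : gAlg) : Prop :=
  [/\ alghom (@coact S),
      forall (T : alg L) (x : S -> T), alghom x ->
        act x (@gone K G (restr kstr T)) =1 x
    & forall (T : alg L) (x : S -> T) (g h : G -> T),
        alghom x -> gpoint g -> gpoint h ->
        act x (gmul g h) =1 act (act x g) h] /\
  [/\ (1 : S) <> 0,
      finite_type S
    & forall (T : alg L) (x y : S -> T), alghom x -> alghom y ->
        exists g : G -> T, [/\ gpoint g, act x g =1 y
          & forall g' : G -> T, gpoint g' -> act x g' =1 y -> g' =1 g]].

Definition diff_torsor (S : gAlg) : Prop :=
  torsor S /\ forall s, coact (ader S s) = ader (dtens S coordL) (coact s).

Definition equivariant (S S' : gAlg) (h : S -> S') : Prop :=
  forall (T : alg L) (x : S' -> T) (g : G -> T), alghom x -> gpoint g ->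
    act (x \o h) g =1 act x g \o h.

Definition torsor_iso (S S' : gAlg) (h : S -> S') : Prop :=
  [/\ dalghom h, bijective h & equivariant h].

(* L[G] with the co-action l (x) f |-> sum (l (x) f_1) (x) (1 (x) f_2), which *)
(* is right multiplication on points.                                         *)
Definition regular_torsor : gAlg :=
  @GAlg coordL
    (tlift (fun l => tinl (astr coordL) (astr coordL) (tinl kstr (astr G) l))
       (fun f => tmap (tinr kstr (astr G)) (tinr kstr (astr G)) (comul G f))).

End GroupAlgebra.

Section PicardVessiot.
Variable R : diffAlg L.

Definition is_dideal (I : R -> Prop) : Prop :=
  [/\ I 0, forall x y, I x -> I y -> I (x + y),
      forall a x, I x -> I (a * x) & forall x, I x -> I (ader R x)].

Definition diff_simple : Prop :=
  (1 : R) <> 0 /\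
  forall I, is_dideal I -> (forall x, I x -> x = 0) \/ (forall x, I x).

(* W is the inverse of Z *)
Definition picard_vessiot : Prop :=
  [/\ exists (n : nat) (Z W : 'M[R]_n),
        [/\ Z *m W = 1%:M, W *m Z = 1%:M,
            exists A : 'M[L]_n, map_mx (ader R) Z *m W = map_mx (astr R) A
          & forall x, gen_by (fun a => (exists i j, a = Z i j) \/ a = \det W) x],
      diff_simple
    & forall x : R, ader R x = 0 -> exists c : const L, x = astr R (const_inj L c)].

(* differential L (x)_{C_L} A-automorphisms of R (x)_{C_L} A *)
Definition ext_aut (A : alg (const L)) (alpha : dext R A -> dext R A) : Prop :=
  [/\ zmod_morphism alpha, monoid_morphism alpha, bijective alpha,
      forall x, alpha (ader (dext R A) x) = ader (dext R A) (alpha x)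
    & forall y : tensor (const_inj L) (astr A),
        alpha (tmap (astr R) idfun y) = tmap (astr R) idfun y].

Variable H : algGroup K.

(* theta is an isomorphism of group functors from H_{C_L} to Aut^d(R/L).      *)
Definition galois_iso
    (theta : forall A : alg (const L), (H -> A) -> dext R A -> dext R A) :
    Prop :=
  let pt (A : alg (const L)) (h : H -> A) := @alghom K H (restr kappa A) h in
  (forall A : alg (const L),
    [/\ forall h, pt A h -> ext_aut (theta A h),
        forall h h', pt A h -> pt A h' ->
          theta A (gmul h h') =1 theta A h \o theta A h',
        forall h h', pt A h -> pt A h' -> theta A h =1 theta A h' -> h =1 h'
      & forall alpha, ext_aut alpha -> exists2 h, pt A h & theta A h =1 alpha]) /\
  (forall (A B : alg (const L)) (u : A -> B) (h : H -> A), alghom u -> pt A h ->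
    forall x : dext R A,
      theta B (u \o h) (tmap idfun u x) = tmap idfun u (theta A h x)).

End PicardVessiot.

(* theta identifies the Galois group of R with H_{C_L}, and the action of H_L *)
(* on Spec R is the resulting one: an A-point h of H moves the tautological   *)
(* point of Spec R over R (x)_{C_L} A to the restriction of theta A h to R.   *)
Definition galois_torsor (H : algGroup K) (R : gAlg H) : Prop :=
  exists2 theta, @galois_iso R H theta &
    forall (A : alg (const L)) (h : H -> A), @alghom K H (restr kappa A) h ->
      forall r : R,
        theta A h (tinl (astr R \o const_inj L) (astr A) r) =
        @act H R (dext R A) (tinl _ _) (tinr (astr R \o const_inj L) (astr A) \o h) r.

Section Induction.
Variables (G : algGroup K) (H : closedSubgroup G).
Variable R : gAlg H.

(* the T-point (y, g) of Spec R x G_L *)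
Definition pairpt (T : alg L) (y : R -> T) (g : G -> T) :
  dtens R (coordL G) -> T := tlift y (ptL g).

(* f (y.h, h^-1 g) = f (y, g) on all T-points *)
Definition ind_invariant (f : dtens R (coordL G)) : Prop :=
  forall (T : alg L) (y : R -> T) (g : G -> T) (h : H -> T),
    alghom y -> gpoint g -> gpoint h ->
    pairpt (act y h) (gmul (ginv h \o sgmap H) g) f = pairpt y g f.

(* sigma identifies S, as a differential algebra with an action of G, with    *)
(* the ring Ind_H^G R of invariants in R (x)_L L[G].                          *)
Definition is_induced (S : gAlg G) (sigma : S -> dtens R (coordL G)) : Prop :=
  [/\ dalghom sigma, injective sigma,
      forall f, ind_invariant f <-> exists s, sigma s = f
    & forall (T : alg L) (y : R -> T) (g g' : G -> T),
        alghom y -> gpoint g -> gpoint g' ->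
        act (pairpt y g \o sigma) g' =1 pairpt y (gmul g g') \o sigma].

End Induction.

End OverField.

Section GroupBaseChange.

Variables (K : fieldType) (L M : diffField) (phi : diffHom L M).
Variables (kappaL : {rmorphism K -> const L}) (kappaM : {rmorphism K -> const M}).
Variable G : algGroup K.

(* L[G] -> M[G] *)
Definition coordL_map : coordL kappaL G -> coordL kappaM G :=
  tmap (phi : L -> M) idfun.

(* M (x)_L S with the action of G_M obtained by base change: the co-action is *)
(* m (x) s |-> sum (m (x) s_0) (x) s_1 if that of S is s |-> sum s_0 (x) s_1. *)
Definition bcG (S : gAlg kappaL G) : gAlg kappaM G :=
  @GAlg K M kappaM G (dbc phi S)
    (tlift (fun m => tinl (astr (dbc phi S)) (astr (coordL kappaM G))
                       (tinl phi (astr S) m))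
       (fun s => tmap (tinr phi (astr S)) coordL_map (coact s))).

End GroupBaseChange.

(* The two vertices above an edge k are inc k true (for l_k) and inc k false  *)
(* (for r_k).                                                                 *)
Record diffFactSystem := DiffFactSystem {
  Iv : finType;
  Ie : finType;
  inc : Ie -> bool -> Iv;
  inc_neq : forall k, inc k true != inc k false;
  Fv : Iv -> diffField;
  Fe : Ie -> diffField;
  res : forall k b, diffHom (Fv (inc k b)) (Fe k) }.

Arguments inc {d} k b.
Arguments Fv {d} i.
Arguments Fe {d} k.
Arguments res {d} k b.

(* F is the inverse limit of the system, as a ring and hence as a             *)
(* differential field.                                                        *)
Record limitCone (X : diffFactSystem) (F : diffField) := LimitCone {
  toV : forall i : Iv X, diffHom F (Fv i);
  toE : forall k : Ie X, diffHom F (Fe k);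
  coneP : forall k b x, res k b (toV (inc k b) x) = toE k x;
  limitP : forall (xv : forall i : Iv X, Fv i) (xe : forall k : Ie X, Fe k),
    (forall k b, res k b (xv (inc k b)) = xe k) ->
    exists! x : F, (forall i, toV i x = xv i) /\ (forall k, toE k x = xe k) }.

Arguments toV {X F} l i.
Arguments toE {X F} l k.

Definition simultaneous_factorization (X : diffFactSystem) : Prop :=
  forall (n : nat) (A : forall k : Ie X, 'M[Fe k]_n),
    (1 <= n)%N -> (forall k, A k \in unitmx) ->
    exists B : forall i : Iv X, 'M[Fv i]_n,
      (forall i, B i \in unitmx) /\
      forall k, A k = invmx (map_mx (res k false) (B (inc k false))) *m
                      map_mx (res k true) (B (inc k true)).

Section Patching.

Variables (X : diffFactSystem) (F : diffField) (lim : limitCone X F).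
Variable G : algGroup (const F).

Definition kappaF : {rmorphism const F -> const F} := idfun.
Definition kappaV (i : Iv X) : {rmorphism const F -> const (Fv i)} :=
  const_map (toV lim i).
Definition kappaE (k : Ie X) : {rmorphism const F -> const (Fe k)} :=
  const_map (toE lim k).

Variables (Sv : forall i, gAlg (kappaV i) G).
Variables (Se : forall k, gAlg (kappaE k) G).
Variable Theta :
  forall k b, bcG (res k b) (kappaE k) (Sv (inc k b)) -> Se k.

Definition patching_problem : Prop :=
  [/\ forall i, diff_torsor (Sv i), forall k, diff_torsor (Se k)
    & forall k b, torsor_iso (@Theta k b)].

Variable S : gAlg kappaF G.
Variable Phi : forall i, bcG (toV lim i) (kappaV i) S -> Sv i.

(* s |-> Phi_i (1 (x) s) *)
Definition toSv (i : Iv X) (s : S) : Sv i :=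
  @Phi i (tinr (toV lim i) (astr S) s).

(* id (x) Phi_i : F_k (x)_F S -> F_k (x)_{F_i} S_i, for i = inc k b, where    *)
(* F_k (x)_F S is identified with F_k (x)_{F_i} (F_i (x)_F S).                *)
Definition id_tensor_Phi (k : Ie X) (b : bool) :
    dbc (toE lim k) S -> bcG (res k b) (kappaE k) (Sv (inc k b)) :=
  tlift (tinl (res k b) (astr (Sv (inc k b))))
        (fun s => tinr (res k b) (astr (Sv (inc k b))) (toSv (inc k b) s)).

Definition patching_solution : Prop :=
  [/\ diff_torsor S, forall i, torsor_iso (@Phi i)
    & forall k, @Theta k true \o @id_tensor_Phi k true =1
                @Theta k false \o @id_tensor_Phi k false].

(* S is the inverse limit of the rings S_i along the maps                     *)
(* S_i -> S_k, s |-> Theta_ki (1 (x) s).                                      *)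
Definition solution_is_limit : Prop :=
  forall (xv : forall i, Sv i) (xe : forall k, Se k),
    (forall k b,
       @Theta k b (tinr (res k b) (astr (Sv (inc k b))) (xv (inc k b))) = xe k) ->
    exists! s : S, forall i, toSv i s = xv i.

Section EmbeddingTorsor.
Variables (k : Ie X) (b : bool) (H : closedSubgroup G).
Let i := @inc X k b.
Variable R : gAlg (kappaV i) H.
Variable e : R -> Fe k.
Variable sigma : Sv i -> dtens R (coordL (kappaV i) G).

(* a (x) r (x) f |-> a r f on F_k (x)_{F_i} (R_i (x)_{F_i} F_i[G])^H, through *)
(* the identification sigma of S_i with the ring of invariants                *)
Definition embedding_map :
    bcG (res k b) (kappaE k) (Sv i) -> regular_torsor (kappaE k) G :=
  tlift (astr (regular_torsor (kappaE k) G))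
    (fun s => tlift (fun r => astr (regular_torsor (kappaE k) G) (e r))
                    (@coordL_map _ _ _ (res k b) (kappaV i) (kappaE k) G)
                    (sigma s)).

End EmbeddingTorsor.

End Patching.

(* Main.v *)
(* The solution S embeds in a product of Picard-Vessiot rings: evaluating      *)
(* S_i = Ind(R_i) at the unit of G gives differential points y_i : S -> R_i   *)
(* that agree over each F_k, and the torsor S becomes R_i (x) K[G] over R_i.  *)
(* Let I be a differential ideal of S other than S. As R_i is simple with     *)
(* constants K_i, the ideal of R_i (x) K[G] generated by I is defined over    *)
(* constants; quotients of coordinates that are constant in every R_i glue to *)
(* a constant of F, so all these ideals come from one ideal J of K[G]. The    *)
(* action of H_i on Spec R_i shows that H_i lies in the stabilizer of J, a    *)
(* closed subgroup, which is therefore G. A proper G-stable ideal of K[G] is  *)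
(* zero, hence J = 0 and I = 0, so S is simple. A constant of S is sent by    *)
(* the y_i to compatible constants, so it lies in F.                          *)
(* In a simple torsor without new constants, the coordinates of the co-action *)
(* on a differentially stable finite-dimensional subspace form a fundamental  *)
(* matrix, and any differential automorphism moves the generic point by a     *)
(* constant point of G.                                                       *)

Require Import Defs.
From HB Require Import structures.
From mathcomp Require Import all_boot all_order all_algebra.
From mathcomp Require Import generic_quotient boolp classical_sets ring.

Set Implicit Arguments.
Unset Strict Implicit.
Unset Printing Implicit Defensive.

Import GRing.Theory.
Local Open Scope ring_scope.
Local Open Scope quotient_scope.

(** * Tensor products and ring morphisms *)

(** The solution S is controlled by its points in the rings R_i. Evaluating S_i = Ind(R_i) at the
    unit of G gives differential points y_i : S -> R_i ([ind_pt] after [from_base]), and since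
    Theta_ki is multiplication through R_i -> F_k, they agree over every F_k ([embedding_unit]). As
    the limit F of the F_i is a field, the y_i vanish on the same elements ([limit_connect]), and
    ratios that are constant in every R_i glue to constants of F ([limit_glue]).

    Let I be a proper differential ideal of S. Over R_i the torsor is trivial, R_i (x)_F S = R_i
    (x)_K K[G], and I generates a differential ideal there. A minimal-support argument
    ([coT_descent]) shows that all these ideals come from a single ideal J of K[G] ([rho_spanned]).
    Each H_i acts on Spec R_i through G, so it stabilises J ([stab_step], [H_stab]). The stabiliser
    of J is a closed subgroup ([stabilizer]), hence it is G, and a proper G-stable ideal is zero
    ([stable_ideal_trivial]). So S is simple ([torsor_simple]), and its constants are those of F
    ([torsor_const]).

    The rest holds for any simple differential torsor without new constants. The coefficients of the
    co-action form a fundamental matrix ([torsor_fundamental_matrix]). An automorphism of S (x) A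
    moves the tautological point by a constant point of G ([differential_points]), that is, by a
    point of G over A ([ext_const]), which identifies the Galois group with G ([torsor_galois]). *)

Definition ringhom (A B : comPzRingType) (h : A -> B) : Prop :=
  zmod_morphism h /\ monoid_morphism h.

Section RingHom.
Variables (A B : comPzRingType).

(** Points and co-actions are bare functions; packing them lends them the library lemmas on
    morphisms. *)
Definition bundle (h : A -> B) (hh : ringhom h) : {rmorphism A -> B} :=
  HB.pack h (GRing.isZmodMorphism.Build A B h hh.1)
    (GRing.isMonoidMorphism.Build A B h hh.2).

Lemma rmorph_ringhom (h : {rmorphism A -> B}) : ringhom h.
Proof. by split; [exact: raddfB | split; [exact: rmorph1 | exact: rmorphM]]. Qed.

Variables (h : A -> B) (hh : ringhom h).

Lemma rhom0 : h 0 = 0. Proof. exact: (rmorph0 (bundle hh)). Qed.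
Lemma rhom1 : h 1 = 1. Proof. exact: (rmorph1 (bundle hh)). Qed.
Lemma rhomD x y : h (x + y) = h x + h y. Proof. exact: (rmorphD (bundle hh)). Qed.
Lemma rhomB x y : h (x - y) = h x - h y. Proof. exact: (rmorphB (bundle hh)). Qed.
Lemma rhomM x y : h (x * y) = h x * h y. Proof. exact: (rmorphM (bundle hh)). Qed.
Lemma rhom_sum I r (P : pred I) (E : I -> A) :
  h (\sum_(i <- r | P i) E i) = \sum_(i <- r | P i) h (E i).
Proof. exact: (rmorph_sum (bundle hh)). Qed.

End RingHom.

Lemma ringhom_comp (A B C : comPzRingType) (h : A -> B) (g : B -> C) :
  ringhom h -> ringhom g -> ringhom (g \o h).
Proof. by move=> hh hg; exact: (rmorph_ringhom (bundle hg \o bundle hh)). Qed.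

Lemma ringhom_id (A : comPzRingType) : ringhom (@id A).
Proof. exact: (rmorph_ringhom (@idfun A)). Qed.

Lemma ringhomP (A B : comPzRingType) (h : A -> B) :
  (forall x y, h (x + y) = h x + h y) -> h 1 = 1 ->
  (forall x y, h (x * y) = h x * h y) -> ringhom h.
Proof.
move=> hD h1 hM; split; last by split.
by move=> x y; apply/eqP; rewrite eq_sym subr_eq -hD subrK.
Qed.

Lemma eq_ringhom (A B : comPzRingType) (h h' : A -> B) :
  h =1 h' -> ringhom h -> ringhom h'.
Proof. by move=> /funext <-. Qed.

Lemma alghom_ringhom (L : comPzRingType) (A B : alg L) (h : A -> B) :
  alghom h -> ringhom h.
Proof. by case. Qed.

Section TensorHom.
Variables (L A B : comPzRingType).
Variables (f : {rmorphism L -> A}) (g : {rmorphism L -> B}).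
Notation AB := (tensor f g).

Lemma tinl_ringhom : ringhom (tinl f g).
Proof. exact: (rmorph_ringhom (tinl f g)). Qed.
Lemma tinr_ringhom : ringhom (tinr f g).
Proof. exact: (rmorph_ringhom (tinr f g)). Qed.

Section Lift.
Variable T : comPzRingType.
Variables (u : A -> T) (v : B -> T).
Hypotheses (hu : ringhom u) (hv : ringhom v) (uv : forall c, u (f c) = v (g c)).

Lemma tlift_ringhom : ringhom (tlift (f := f) (g := g) u v).
Proof.
split; first exact: (@tlift_zmod _ _ _ _ f g (bundle hu) (bundle hv)).
exact: (@tlift_monoid _ _ _ _ f g (bundle hu) (bundle hv)).
Qed.

Lemma tlift_pure a b : tlift u v (tpure f g a b) = u a * v b.
Proof. exact: (@tliftE _ _ _ _ f g (bundle hu) (bundle hv)). Qed.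

Lemma tlift_tinl a : tlift u v (tinl f g a) = u a.
Proof. by rewrite tlift_pure (rhom1 hv) mulr1. Qed.

Lemma tlift_tinr b : tlift u v (tinr f g b) = v b.
Proof. by rewrite tlift_pure (rhom1 hu) mul1r. Qed.

End Lift.

Lemma tensor_hom_ext (T : comPzRingType) (h h' : AB -> T) :
  ringhom h -> ringhom h' ->
  (forall a, h (tinl f g a) = h' (tinl f g a)) ->
  (forall b, h (tinr f g b) = h' (tinr f g b)) -> h =1 h'.
Proof.
move=> rh rh' el er; apply: tensor_ind => [a b|x y IHx IHy].
  by rewrite -tinlr (rhomM rh) (rhomM rh') el er.
by rewrite (rhomD rh) (rhomD rh') IHx IHy.
Qed.

Lemma tensor_hom_lift (T : comPzRingType) (h : AB -> T) : ringhom h ->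
  h =1 tlift (f := f) (g := g) (h \o tinl f g) (h \o tinr f g).
Proof.
move=> rh.
have hl := ringhom_comp tinl_ringhom rh; have hr := ringhom_comp tinr_ringhom rh.
have e c : (h \o tinl f g) (f c) = (h \o tinr f g) (g c) by rewrite /= tinl_tinr.
apply: tensor_hom_ext => //; first exact: tlift_ringhom.
- by move=> a; rewrite tlift_tinl.
- by move=> a; rewrite tlift_tinr.
Qed.

End TensorHom.

Lemma tmap_ringhom (L A B A' B' L' : comPzRingType)
    (f : {rmorphism L -> A}) (g : {rmorphism L -> B})
    (f' : {rmorphism L' -> A'}) (g' : {rmorphism L' -> B'})
    (u : A -> A') (v : B -> B') : ringhom u -> ringhom v ->
  (forall c, tinl f' g' (u (f c)) = tinr f' g' (v (g c))) ->
  [/\ ringhom (tmap (f := f) (g := g) (f' := f') (g' := g') u v),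
      forall a, tmap (f := f) (g := g) (f' := f') (g' := g') u v (tinl f g a)
                = tinl f' g' (u a)
    & forall b, tmap (f := f) (g := g) (f' := f') (g' := g') u v (tinr f g b)
                = tinr f' g' (v b)].
Proof.
move=> hu hv e.
have hu' := ringhom_comp hu (tinl_ringhom f' g').
have hv' := ringhom_comp hv (tinr_ringhom f' g').
split; first exact: (tlift_ringhom hu' hv').
- exact: (tlift_tinl hu' hv').
- exact: (tlift_tinr hu' hv').
Qed.

(** Both sides are derivations along [h], so comparing them on the two factors, which generate the
    tensor product, is enough. *)
Lemma tensor_der_ext (L A B : comPzRingType)
    (f : {rmorphism L -> A}) (g : {rmorphism L -> B}) (T : comPzRingType)
    (h : tensor f g -> T) (D : tensor f g -> tensor f g) (D' : T -> T) :
  ringhom h -> derivation D -> derivation D' ->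
  (forall a, h (D (tinl f g a)) = D' (h (tinl f g a))) ->
  (forall b, h (D (tinr f g b)) = D' (h (tinr f g b))) ->
  forall x, h (D x) = D' (h x).
Proof.
move=> rh [DD DM] [D'D D'M] el er; apply: tensor_ind => [a b|x y IHx IHy].
  rewrite -tinlr (rhomM rh) DM (rhomD rh) !(rhomM rh) el er.
  by rewrite D'M.
by rewrite DD !(rhomD rh) D'D IHx IHy.
Qed.


Lemma big_uniq_sub (T : eqType) (V : zmodType) (s s' : seq T) (E : T -> V) :
  uniq s -> uniq s' -> {subset s <= s'} -> (forall t, t \notin s -> E t = 0) ->
  \sum_(t <- s') E t = \sum_(t <- s) E t.
Proof.
move=> us us' ss E0; rewrite (bigID (mem s)) /= addrC big1 ?add0r; last first.
  by move=> t /E0.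
rewrite -big_filter; apply: perm_big; apply: uniq_perm => //.
  exact: filter_uniq.
by move=> t; rewrite mem_filter /= andb_idr // => /ss.
Qed.

(** * Bases modulo a subspace *)

Section RelativeBasis.
Variables (K : fieldType) (V : alg K) (J : V -> Prop).

Definition subspace : Prop :=
  [/\ J 0, forall u v, J u -> J v -> J (u + v)
    & forall c v, J v -> J (astr V c * v)].

(* [co t] is the coordinate at [t] with respect to a basis of V modulo J that *)
(* consists of some of the elements of V; it is 0 when [t] is not among them. *)
Record coordinates := Coordinates {
  co :> V -> V -> K;
  coD : forall t u v, co t (u + v) = co t u + co t v;
  coZ : forall t c v, co t (astr V c * v) = c * co t v;
  coJ : forall t v, J v -> co t v = 0;
  co_supp : forall v, exists s : seq V, [/\ uniq s,
    forall t, t \notin s -> co t v = 0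
    & J (v - \sum_(t <- s) astr V (co t v) * t)] }.

Hypothesis sJ : subspace.

Let J0 : J 0. Proof. by case: sJ. Qed.
Let JD u v : J u -> J v -> J (u + v). Proof. by case: sJ => _ h _; apply: h. Qed.
Let JZ c v : J v -> J (astr V c * v). Proof. by case: sJ => _ _ h; apply: h. Qed.
Let JN v : J v -> J (- v).
Proof. by move=> /(JZ (-1)); rewrite rmorphN1 mulN1r. Qed.
Let JB u v : J u -> J v -> J (u - v).
Proof. by move=> hu /JN; apply: JD. Qed.

Let comb (c : V -> K) (s : seq V) : V := \sum_(t <- s) astr V (c t) * t.

Let indep (D : set V) : Prop := forall s c, uniq s -> (forall t, t \in s -> D t) ->
  J (comb c s) -> forall t, t \in s -> c t = 0.

(** By Zorn some set is maximal among those independent modulo J: a relation involves finitely many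
    elements, so it lives in one member of a chain. A vector outside the span could be added, hence
    the maximal set spans. *)
Let maximal_indep : exists D, indep D /\ forall v, exists s c,
  [/\ uniq s, forall t, t \in s -> D t, forall t, t \notin s -> c t = 0
     & J (v - comb c s)].
Proof.
have [|D [iD mD]] := @Zorn_bigcup V indep.
  move=> F FP totF s c us sF; case: s => [//|t0 s] in us sF *.
  have [X FX sX] : exists2 X, F X & forall t, t \in t0 :: s -> X t.
    elim: (s) sF => [|t1 s1 IH] sF.
      have [X FX Xt] := sF t0 (mem_head _ _); exists X => // t.
      by rewrite inE => /eqP ->.
    have [|X FX sX] := IH.
      move=> t; rewrite inE => /orP[/eqP -> |ts]; apply: sF; first exact: mem_head.
      by rewrite !inE ts !orbT.
    have [Y FY Yt] : exists2 Y, F Y & Y t1.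
      by have [|Y FY Yt] := sF t1 _; [rewrite !inE eqxx orbT | exists Y].
    have [XY|YX] := totF X Y FX FY.
      exists Y => // t; rewrite !inE => /or3P[/eqP ->|/eqP -> //|ts]; apply: XY;
        apply: sX; [exact: mem_head | by rewrite inE ts orbT].
    exists X => // t; rewrite !inE => /or3P[/eqP ->|/eqP ->|ts].
    - by apply: sX; exact: mem_head.
    - exact: YX.
    - by apply: sX; rewrite inE ts orbT.
  exact: (FP X FX).
exists D; split=> // v; apply: contrapT => nv.
have nDv : ~ D v.
  move=> Dv; apply: nv; exists [:: v], (fun t => (t == v)%:R); split=> //.
  - by move=> t; rewrite inE => /eqP ->.
  - by move=> t; rewrite inE => /negPf ->.
  - by rewrite /comb big_seq1 eqxx rmorph1 mul1r subrr.
apply: (mD (fun t => D t \/ t = v)).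
  split; first by move=> t Dt; left.
  by move=> /(_ v) h; apply: nDv; apply: h; right.
move=> s c us sD Js.
have [vs|nvs] := boolP (v \in s); last first.
  apply: iD => // t ts; have [//|tv] := sD t ts.
  by move: nvs; rewrite -tv ts.
have Drem t : t \in rem v s -> D t.
  rewrite mem_rem_uniq // inE => /andP[tv /sD[//|/eqP]].
  by rewrite (negPf tv).
have e : comb c s = astr V (c v) * v + comb c (rem v s) by rewrite /comb (big_rem v).
have [cv0 t ts|cv0] := eqVneq (c v) 0.
  have [-> //|tv] := eqVneq t v.
  apply: (iD (rem v s) c (rem_uniq v us) Drem).
    by rewrite e cv0 rmorph0 mul0r add0r in Js.
  by rewrite mem_rem_uniq // inE tv.
(* The relation has a nonzero coefficient at [v]; solving it for [v] puts [v] in the span modulo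
   J. *)
case: nv; pose c' t := if t \in rem v s then - (c v)^-1 * c t else 0.
exists (rem v s), c'; split=> //; first exact: rem_uniq.
  by move=> t /negPf ht; rewrite /c' ht.
have -> : v - comb c' (rem v s) = astr V (c v)^-1 * comb c s.
  rewrite e mulrDr mulrA -rmorphM mulVf // rmorph1 mul1r; congr (_ + _).
  rewrite /comb -sumrN mulr_sumr [LHS]big_seq [RHS]big_seq; apply: eq_bigr => t ht.
  by rewrite /c' ht mulNr rmorphN mulNr opprK rmorphM mulrA.
exact: JZ.
Qed.

(** Independence makes the coefficients chosen for a vector the only admissible ones ([co_unique]);
    linearity and vanishing on J follow by exhibiting one admissible family. *)
Lemma coordinates_exist : inhabited coordinates.
Proof.
have [D [iD sp]] := maximal_indep.
have /choice[sv /choice[cv hv]] := sp.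
have comb_sub (c : V -> K) s s' : uniq s -> uniq s' -> {subset s <= s'} ->
    (forall t, t \notin s -> c t = 0) -> comb c s' = comb c s.
  move=> us us' ss c0; apply: big_uniq_sub => // t /c0 ->.
  by rewrite rmorph0 mul0r.
have co_unique v s c t : uniq s -> (forall t, t \in s -> D t) ->
    (forall t, t \notin s -> c t = 0) -> J (v - comb c s) -> cv v t = c t.
  move=> us sD c0 Js; have [us' sD' c0' Js'] := hv v.
  pose s2 := undup (s ++ sv v).
  have us2 : uniq s2 by exact: undup_uniq.
  have sub1 : {subset s <= s2} by move=> x xs; rewrite mem_undup mem_cat xs.
  have sub2 : {subset sv v <= s2} by move=> x xs; rewrite mem_undup mem_cat xs orbT.
  have [ts|nts] := boolP (t \in s2); last first.
    by rewrite c0 ?c0' //; apply: contra nts => ts; [exact: sub2 | exact: sub1].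
  apply/eqP; rewrite -subr_eq0; apply/eqP.
  apply: (iD s2 (fun t => cv v t - c t)) => //.
    by move=> x; rewrite mem_undup mem_cat => /orP[/sD|/sD'].
  have -> : comb (fun t => cv v t - c t) s2 = comb (cv v) s2 - comb c s2.
    rewrite /comb -sumrB; apply: eq_bigr => x _.
    by rewrite rmorphB mulrBl.
  rewrite (comb_sub (cv v) (sv v)) // (comb_sub c s) //.
  by have := JB Js Js'; rewrite opprB addrC addrA subrK.
constructor; apply: (@Coordinates (fun t v => cv v t)).
- move=> t u v; have [us sD c0 Js] := hv u; have [us' sD' c0' Js'] := hv v.
  pose s2 := undup (sv u ++ sv v).
  have us2 : uniq s2 by exact: undup_uniq.
  have sub1 : {subset sv u <= s2} by move=> x xs; rewrite mem_undup mem_cat xs.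
  have sub2 : {subset sv v <= s2} by move=> x xs; rewrite mem_undup mem_cat xs orbT.
  apply: (co_unique _ s2 (fun t => cv u t + cv v t)) => //.
  + by move=> x; rewrite mem_undup mem_cat => /orP[/sD|/sD'].
  + by move=> x; rewrite mem_undup mem_cat negb_or => /andP[/c0 -> /c0' ->]; rewrite addr0.
  have -> : comb (fun t => cv u t + cv v t) s2 = comb (cv u) s2 + comb (cv v) s2.
    rewrite /comb -big_split; apply: eq_bigr => x _.
    by rewrite rmorphD mulrDl.
  rewrite (comb_sub (cv v) (sv v)) // (comb_sub (cv u) (sv u)) //.
  by rewrite opprD addrACA; apply: JD.
- move=> t c v; have [us sD c0 Js] := hv v.
  apply: (co_unique _ (sv v) (fun t => c * cv v t)) => //.
    by move=> x /c0 ->; rewrite mulr0.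
  have -> : comb (fun t => c * cv v t) (sv v) = astr V c * comb (cv v) (sv v).
    by rewrite /comb mulr_sumr; apply: eq_bigr => x _; rewrite rmorphM mulrA.
  by rewrite -mulrBr; apply: JZ.
- move=> t v Jv; apply: (co_unique v [::] (fun=> 0)) => //.
  by rewrite /comb big_nil subr0.
- by move=> v; have [us sD c0 Js] := hv v; exists (sv v).
Qed.

End RelativeBasis.

(** * Coordinates *)

Section TensorPure.
Variables (L A B : comPzRingType).
Variables (f : {rmorphism L -> A}) (g : {rmorphism L -> B}).

Lemma tpureDl a a' b : tpure f g (a + a') b = tpure f g a b + tpure f g a' b.
Proof. exact: balancedDl (balanced_tpure f g) _ _ _. Qed.
Lemma tpureDr a b b' : tpure f g a (b + b') = tpure f g a b + tpure f g a b'.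
Proof. exact: balancedDr (balanced_tpure f g) _ _ _. Qed.
Lemma tpure0l b : tpure f g 0 b = 0.
Proof. exact: (balanced0l (balanced_tpure f g)). Qed.
Lemma tpure0r a : tpure f g a 0 = 0.
Proof. exact: (balanced0r (balanced_tpure f g)). Qed.
Lemma tpureNr a b : tpure f g a (- b) = - tpure f g a b.
Proof. by apply: (addrI (tpure f g a b)); rewrite -tpureDr !subrr tpure0r. Qed.
Lemma tpureZ c a b : tpure f g (a * f c) b = tpure f g a (g c * b).
Proof. exact: balancedZ (balanced_tpure f g) _ _ _. Qed.
Lemma tpure_sumr I (r : seq I) (E : I -> B) a :
  tpure f g a (\sum_(i <- r) E i) = \sum_(i <- r) tpure f g a (E i).
Proof.
elim: r => [|i r IH]; first by rewrite !big_nil tpure0r.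
by rewrite !big_cons tpureDr IH.
Qed.

Lemma tinl_pure a a' b : tinl f g a * tpure f g a' b = tpure f g (a * a') b.
Proof. by rewrite tpureM mul1r. Qed.
End TensorPure.

Section Coordinates.
Variables (K : fieldType) (V : alg K) (J : V -> Prop) (C : coordinates J).

Lemma co0 t : C t 0 = 0.
Proof. by have := coD C t 0 0; rewrite addr0 => /eqP; rewrite -subr_eq subrr => /eqP. Qed.

Lemma co_inj v : (forall t, C t v = 0) -> J v.
Proof.
move=> h; have [s [_ _ ]] := co_supp C v.
by rewrite big1 ?subr0 // => t _; rewrite h rmorph0 mul0r.
Qed.

Variables (A : comPzRingType) (f : {rmorphism K -> A}).
Notation AV := (tensor f (astr V)).

(** The A-linear extension of the coordinate at [t] to A (x)_K V. *)
Definition coT (t : V) (x : AV) : A := teval (fun a v => a * f (C t v)) x.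

Lemma coT_balanced t : balanced f (astr V) (fun a v => a * f (C t v)).
Proof.
split=> [a a' b|a b b'|c a b]; first exact: mulrDl.
  by rewrite coD rmorphD mulrDr.
by rewrite coZ rmorphM mulrA.
Qed.

Lemma coT_pure t a v : coT t (tpure f (astr V) a v) = a * f (C t v).
Proof. exact: (tevalP (coT_balanced t)). Qed.

Lemma coTD t x y : coT t (x + y) = coT t x + coT t y.
Proof. exact: (tevalD (coT_balanced t)). Qed.

Lemma coT0 t : coT t 0 = 0.
Proof. by rewrite -(tpure0l f (astr V) 0) coT_pure mul0r. Qed.

Lemma coTN t x : coT t (- x) = - coT t x.
Proof. by apply/eqP; rewrite -addr_eq0 -coTD addNr coT0. Qed.

Lemma coTB t x y : coT t (x - y) = coT t x - coT t y.
Proof. by rewrite coTD coTN. Qed.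

Lemma coT_sum t I (r : seq I) (E : I -> AV) :
  coT t (\sum_(i <- r) E i) = \sum_(i <- r) coT t (E i).
Proof.
elim: r => [|i r IH]; first by rewrite !big_nil coT0.
by rewrite !big_cons coTD IH.
Qed.

Lemma coTZ t a x : coT t (tinl f (astr V) a * x) = a * coT t x.
Proof.
elim/tensor_ind: x => [a' v|x y IHx IHy].
  by rewrite tinl_pure !coT_pure mulrA.
by rewrite mulrDr !coTD IHx IHy mulrDr.
Qed.

Lemma coT_tinr t v : coT t (tinr f (astr V) v) = f (C t v).
Proof. by rewrite coT_pure mul1r. Qed.

(** V is constant and the coordinates of its elements lie in K, which [d] kills; so differentiation
    acts coordinate by coordinate. *)
Lemma coT_der t (d : A -> A) x : derivation d -> (forall c, d (f c) = 0) ->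
  coT t (tder d (fun=> 0) x) = d (coT t x).
Proof.
move=> dd df; have [dD dM] := dd.
have dA c : d (f c) = f ((fun=> 0) c) by rewrite df rmorph0.
have dV c : (fun=> 0) (astr V c) = astr V ((fun=> 0) c) by rewrite rmorph0.
have [tD tM] := tder_derivation dd (derivation_cst0 V) dA dV.
elim/tensor_ind: x => [a v|x y IHx IHy].
  rewrite (tderE dd (derivation_cst0 V) dA dV).
  by rewrite coTD !coT_pure co0 rmorph0 mulr0 addr0 dM df mulr0 addr0.
by rewrite tD !coTD IHx IHy dD.
Qed.

(** The image of A (x) J in A (x) V, encoded by its induction principle. *)
Definition spanned (x : AV) : Prop := forall P : AV -> Prop,
  P 0 -> (forall u v, P u -> P v -> P (u + v)) ->
  (forall a v, J v -> P (tpure f (astr V) a v)) -> P x.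

Lemma spanned_pure a v : J v -> spanned (tpure f (astr V) a v).
Proof. by move=> Jv P _ _; apply. Qed.

Lemma spanned0 : spanned 0.
Proof. by move=> P. Qed.

Lemma spannedD x y : spanned x -> spanned y -> spanned (x + y).
Proof. by move=> hx hy P P0 PD Pp; apply: (PD); [apply: hx | apply: hy]. Qed.

Lemma spannedM x y : (forall u v, J v -> J (u * v)) -> spanned y -> spanned (x * y).
Proof.
move=> JM h; apply: (h (fun y => spanned (x * y))) => [|u v hu hv|a v Jv].
- by rewrite mulr0; exact: spanned0.
- by rewrite mulrDr; exact: spannedD.
elim/tensor_ind: x => [b u|u u' IH IH']; last by rewrite mulrDl; exact: spannedD.
by rewrite tpureM; apply: spanned_pure; apply: JM.
Qed.

Lemma coT_spanned x t : spanned x -> coT t x = 0.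
Proof.
move=> h; apply: (h (fun x => coT t x = 0)) => [|u v hu hv|a v Jv].
- exact: coT0.
- by rewrite coTD hu hv addr0.
- by rewrite coT_pure coJ // rmorph0 mulr0.
Qed.

Lemma coT_supp x : exists s, [/\ uniq s, forall t, t \notin s -> coT t x = 0
  & spanned (x - \sum_(t <- s) tpure f (astr V) (coT t x) t)].
Proof.
have sumE y s s' : uniq s -> uniq s' -> {subset s <= s'} ->
    (forall t, t \notin s -> coT t y = 0) ->
    \sum_(t <- s') tpure f (astr V) (coT t y) t =
    \sum_(t <- s) tpure f (astr V) (coT t y) t.
  by move=> us us' ss h; apply: big_uniq_sub => // t /h ->; rewrite tpure0l.
elim/tensor_ind: x => [a v|x y [s [us s0 sx]] [s' [us' s0' sy]]].
  have [s [us s0 sv]] := co_supp C v; exists s; split=> //.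
    by move=> t /s0; rewrite coT_pure => ->; rewrite rmorph0 mulr0.
  have -> : tpure f (astr V) a v
      - \sum_(t <- s) tpure f (astr V) (coT t (tpure f (astr V) a v)) t
      = tpure f (astr V) a (v - \sum_(t <- s) astr V (C t v) * t).
    rewrite tpureDr tpureNr tpure_sumr; congr (_ - _); apply: eq_bigr => t _.
    by rewrite coT_pure tpureZ.
  exact: spanned_pure.
pose s2 := undup (s ++ s').
have us2 : uniq s2 by exact: undup_uniq.
have sub1 : {subset s <= s2} by move=> z zs; rewrite mem_undup mem_cat zs.
have sub2 : {subset s' <= s2} by move=> z zs; rewrite mem_undup mem_cat zs orbT.
exists s2; split=> //.
  by move=> t; rewrite mem_undup mem_cat negb_or coTD => /andP[/s0 -> /s0' ->]; rewrite addr0.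
under eq_bigr do rewrite coTD tpureDl.
rewrite big_split /= (sumE x s) // (sumE y s') //.
by rewrite opprD addrACA; apply: spannedD.
Qed.

(** [coT_supp] recovers [x] from its coordinates up to the image of A (x) J. Membership thus becomes
    a family of equations in A, which can be tested after an injective extension of A. *)
Lemma spannedP x : spanned x <-> forall t, coT t x = 0.
Proof.
split=> [h t|h]; first exact: coT_spanned.
have [s [_ _]] := coT_supp x.
by rewrite big1 ?subr0 // => t _; rewrite h tpure0l.
Qed.

End Coordinates.

Section CoordinateMaps.
Variables (K : fieldType) (V : alg K) (J : V -> Prop) (C : coordinates J).
Variables (A A' : comPzRingType) (f : {rmorphism K -> A}) (f' : {rmorphism K -> A'}).
Variables (u : A -> A') (hu : ringhom u) (uf : forall c, u (f c) = f' c).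

Lemma tmap_idr : [/\ ringhom (tmap (f := f) (g := astr V) (f' := f') (g' := astr V) u id),
   forall a, tmap (f := f) (g := astr V) (f' := f') (g' := astr V) u id (tinl f (astr V) a)
      = tinl f' (astr V) (u a)
  & forall b, tmap (f := f) (g := astr V) (f' := f') (g' := astr V) u id (tinr f (astr V) b)
      = tinr f' (astr V) b].
Proof.
apply: tmap_ringhom => // c.
by rewrite uf tinl_tinr.
Qed.

Lemma coT_tmap t x :
  coT C t (tmap (f := f) (g := astr V) (f' := f') (g' := astr V) u id x) = u (coT C t x).
Proof.
have [rh rl rr] := tmap_idr.
elim/tensor_ind: x => [a v|x y IHx IHy].
  rewrite -tinlr (rhomM rh) rl rr !tinlr !coT_pure.
  by rewrite (rhomM hu) uf.
by rewrite (rhomD rh) !coTD IHx IHy (rhomD hu).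
Qed.

End CoordinateMaps.

(** With J = 0 the relative coordinates are those of an ordinary basis. *)
Definition null (V : zmodType) (v : V) : Prop := v = 0.

Lemma null_subspace (K : fieldType) (V : alg K) : subspace (@null V).
Proof.
split=> [//|u v -> ->|c v ->]; first by rewrite /null addr0.
by rewrite /null mulr0.
Qed.

Lemma basis_exist (K : fieldType) (V : alg K) : inhabited (coordinates (@null V)).
Proof. exact/coordinates_exist/null_subspace. Qed.

Section Faithful.
Variables (K : fieldType) (V : alg K) (A : comPzRingType) (f : {rmorphism K -> A}).

Lemma coT_inj (C : coordinates (@null V)) (x : tensor f (astr V)) :
  (forall t, coT C t x = 0) -> x = 0.
Proof.
move=> /spannedP h; apply: (h (fun x => x = 0)) => // [u v -> ->|a v ->]; first by rewrite addr0.
by rewrite tpure0r.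
Qed.

Lemma coT_decomp (C : coordinates (@null V)) (x : tensor f (astr V)) :
  exists s, [/\ uniq s, forall t, t \notin s -> coT C t x = 0
    & x = \sum_(t <- s) tpure f (astr V) (coT C t x) t].
Proof.
have [s [us s0 h]] := coT_supp C x; exists s; split=> //.
apply/eqP; rewrite -subr_eq0; apply/eqP.
apply: (h (fun x => x = 0)) => // [u v -> ->|a v ->].
  by rewrite addr0.
by rewrite tpure0r.
Qed.

(** A nonzero coordinate of [x] would be a unit of K that dies in A, forcing 1 = 0 there. *)
Lemma tinr_inj (x : V) : (1 : A) <> 0 -> tinr f (astr V) x = 0 -> x = 0.
Proof.
move=> A1 x0; have [C] := basis_exist V.
apply: (co_inj (C := C)) => t; have := coT_tinr C f t x.
rewrite x0 coT0 => /esym/eqP; have [-> //|c0] := eqVneq (C t x) 0.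
move=> /eqP fc0; case: A1; rewrite -(rmorph1 f) -(mulVf c0) rmorphM fc0.
exact: mulr0.
Qed.

End Faithful.

(** * Points of torsors *)

Section Points.
Variables (K : fieldType) (L : diffField) (kappa : {rmorphism K -> const L}).
Variables (G : algGroup K) (S : gAlg kappa G).

Lemma gpointP (T : alg L) (g : G -> T) :
  ringhom g -> (forall c, g (astr G c) = astr T (kstr kappa c)) ->
  gpoint kappa g.
Proof. by move=> [gz gm] gc. Qed.

Section Point.
Variables (T : alg L) (g : G -> T) (hg : gpoint kappa g).

Lemma gpoint_ringhom : ringhom g. Proof. exact: alghom_ringhom hg. Qed.

Let hc c : astr T (kstr kappa c) = g (astr G c).
Proof. by case: hg. Qed.

Lemma ptL_ringhom : ringhom (ptL (kappa := kappa) g).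
Proof. exact: (tlift_ringhom (rmorph_ringhom (astr T)) gpoint_ringhom hc). Qed.

Lemma ptL_tinl c : ptL (kappa := kappa) g (tinl (kstr kappa) (astr G) c) = astr T c.
Proof. exact: (tlift_tinl (rmorph_ringhom (astr T)) gpoint_ringhom hc). Qed.

Lemma ptL_tinr f : ptL (kappa := kappa) g (tinr (kstr kappa) (astr G) f) = g f.
Proof. exact: (tlift_tinr (rmorph_ringhom (astr T)) gpoint_ringhom hc). Qed.

Variables (x : S -> T) (hx : alghom x).

Let hxc c : x (astr S c) = ptL (kappa := kappa) g (astr (coordL kappa G) c).
Proof. by rewrite ptL_tinl; case: hx. Qed.

Lemma pt_ringhom :
  ringhom (tlift (f := astr S) (g := astr (coordL kappa G)) x (ptL (kappa := kappa) g)).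
Proof. exact: (tlift_ringhom (alghom_ringhom hx) ptL_ringhom hxc). Qed.

Lemma pt_tinl s : tlift x (ptL (kappa := kappa) g)
  (tinl (astr S) (astr (coordL kappa G)) s) = x s.
Proof. exact: (tlift_tinl (alghom_ringhom hx) ptL_ringhom hxc). Qed.

Lemma pt_tinr l : tlift x (ptL (kappa := kappa) g)
  (tinr (astr S) (astr (coordL kappa G)) l) = ptL (kappa := kappa) g l.
Proof. exact: (tlift_tinr (alghom_ringhom hx) ptL_ringhom hxc). Qed.

Lemma act_alghom : alghom (@coact _ _ _ _ S) -> alghom (act x g).
Proof.
move=> hr; have rr := alghom_ringhom hr; have [_ _ rc] := hr.
have [hz hm] := ringhom_comp rr pt_ringhom.
split=> // c; rewrite /act rc pt_tinl.
by case: hx.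
Qed.

(** The co-action is differential and K[G] is constant in L[G]; so a constant [g] extends to a
    differential map on L[G], and x.g is a composite of differential maps. *)
Lemma act_der (D : T -> T) : (forall s, coact (ader S s) = ader (dtens S (coordL kappa G)) (coact s)) ->
  derivation D -> (forall c, D (astr T c) = astr T (fder c)) ->
  (forall s, x (ader S s) = D (x s)) -> (forall f, D (g f) = 0) ->
  forall s, act x g (ader S s) = D (act x g s).
Proof.
move=> rd dD Dc xd gd s; rewrite /act rd.
apply: (tensor_der_ext pt_ringhom) => //; first exact: dtens_derivation.
  move=> a; rewrite [X in tlift _ _ X](tder_tinl (ader_derivation S)
    (ader_derivation _) (ader_str S) (ader_str (coordL kappa G))).
  by rewrite !pt_tinl.
move=> l; rewrite [X in tlift _ _ X](tder_tinr (ader_derivation S)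
    (ader_derivation _) (ader_str S) (ader_str (coordL kappa G))).
rewrite !pt_tinr.
have dKc c : fder (kstr kappa c) = kstr kappa ((fun=> 0) c) by rewrite kstrP rmorph0.
have dGc c : (fun _ : G => 0) (astr G c) = astr G ((fun=> 0) c) by rewrite rmorph0.
apply: (tensor_der_ext ptL_ringhom) => //; first exact: coordL_derivation.
  move=> a; rewrite [X in ptL _ X](tder_tinl (fder_derivation L) (derivation_cst0 G) dKc dGc).
  by rewrite !ptL_tinl Dc.
move=> f; rewrite [X in ptL _ X](tder_tinr (fder_derivation L) (derivation_cst0 G) dKc dGc).
by rewrite !ptL_tinr gd (rhom0 gpoint_ringhom).
Qed.

End Point.

Lemma gpoint_comp (T T' : alg L) (g : G -> T) (u : T -> T') :
  gpoint kappa g -> alghom u -> gpoint kappa (T := T') (u \o g).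
Proof.
move=> hg hu; have [_ _ gc] := hg; have [_ _ uc] := hu.
apply: gpointP.
  exact: ringhom_comp (gpoint_ringhom hg) (alghom_ringhom hu).
by move=> c; rewrite /= gc uc.
Qed.

Lemma alghom_comp (A B C : alg L) (h : A -> B) (h' : B -> C) :
  alghom h -> alghom h' -> alghom (h' \o h).
Proof.
move=> hh hh'; have [hz hm] := ringhom_comp (alghom_ringhom hh) (alghom_ringhom hh').
by split=> // c; have [_ _ /= ->] := hh; have [_ _ ->] := hh'.
Qed.

Lemma act_comp (T T' : alg L) (x : S -> T) (g : G -> T) (u : T -> T') s :
  alghom x -> gpoint kappa g -> alghom u ->
  act (u \o x) (u \o g) s = u (act x g s).
Proof.
move=> hx hg hu; have hg' := gpoint_comp hg hu; have hx' := alghom_comp hx hu.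
symmetry; apply: (tensor_hom_ext (h := u \o _) _ (pt_ringhom hg' hx')).
- exact: ringhom_comp (pt_ringhom hg hx) (alghom_ringhom hu).
- by move=> a /=; rewrite (pt_tinl hg hx) (pt_tinl hg' hx').
move=> l /=; rewrite (pt_tinr hg hx) (pt_tinr hg' hx').
apply: (tensor_hom_ext (h := u \o _) _ (ptL_ringhom hg')).
- exact: ringhom_comp (ptL_ringhom hg) (alghom_ringhom hu).
- by move=> a /=; rewrite (ptL_tinl hg) (ptL_tinl hg'); case: hu.
- by move=> a /=; rewrite (ptL_tinr hg) (ptL_tinr hg').
Qed.

Lemma eq_act (T : alg L) (x x' : S -> T) (g g' : G -> T) :
  x =1 x' -> g =1 g' -> act x g =1 act x' g'.
Proof. by move=> /funext -> /funext ->. Qed.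

(** A (x)_K K[G], used in place of A (x)_L L[G] because over the field K it has coordinates with
    values in A. *)
Definition stens (A : alg L) : alg L :=
  Alg (tinl (astr A \o kstr kappa) (astr G) \o astr A).
Definition sinl (A : alg L) : A -> stens A := tinl (astr A \o kstr kappa) (astr G).
Definition sinr (A : alg L) : G -> stens A := tinr (astr A \o kstr kappa) (astr G).

Lemma sinl_alghom A : alghom (@sinl A).
Proof. by have [hz hm] := tinl_ringhom (astr A \o kstr kappa) (astr G). Qed.

Lemma sinr_gpoint A : gpoint kappa (@sinr A).
Proof.
apply: gpointP; first exact: (tinr_ringhom (astr A \o kstr kappa) (astr G)).
by move=> c; rewrite /sinr -tinl_tinr.
Qed.

(** The co-action read in S (x)_K K[G], as the universal point of S moved by the universal point of
    G; [spair_rho] recovers every x.g from it. *)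
Definition rho : S -> stens S := act (@sinl S) (@sinr S).

Definition spair (A T : alg L) (x : A -> T) (g : G -> T) : stens A -> T := tlift x g.

Section Spair.
Variables (A T : alg L) (x : A -> T) (g : G -> T).
Hypotheses (hx : alghom x) (hg : gpoint kappa g).
Let e c : x ((astr A \o kstr kappa) c) = g (astr G c).
Proof. by have [_ _ xc] := hx; have [_ _ gc] := hg; rewrite /= xc gc. Qed.

Lemma spair_sinl a : spair x g (sinl a) = x a.
Proof. exact: (tlift_tinl (alghom_ringhom hx) (gpoint_ringhom hg) e). Qed.

Lemma spair_sinr a : spair x g (@sinr A a) = g a.
Proof. exact: (tlift_tinr (alghom_ringhom hx) (gpoint_ringhom hg) e). Qed.

Lemma spair_ringhom : ringhom (spair x g).
Proof. exact: (tlift_ringhom (alghom_ringhom hx) (gpoint_ringhom hg) e). Qed.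

Lemma spair_alghom : alghom (spair x g).
Proof.
have [hz hm] := spair_ringhom; split=> // c.
by rewrite [LHS]spair_sinl; case: hx.
Qed.
End Spair.

Lemma spair_rho (T : alg L) (x : S -> T) (g : G -> T) s :
  alghom x -> gpoint kappa g -> spair x g (rho s) = act x g s.
Proof.
move=> hx hg; rewrite /rho -act_comp.
- by apply: eq_act => a /=; rewrite ?spair_sinl ?spair_sinr.
- exact: sinl_alghom.
- exact: sinr_gpoint.
- exact: spair_alghom.
Qed.

End Points.

(** * Simple differential rings *)

Section Simple.
Variables (L : diffField) (R : diffAlg L).
Hypothesis simple : diff_simple R.
Notation d := (ader R).

Let dD x y : d (x + y) = d x + d y. Proof. by have [] := ader_derivation R. Qed.
Let dM x y : d (x * y) = d x * y + x * d y. Proof. by have [] := ader_derivation R. Qed.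
Let d0 : d 0 = 0. Proof. exact: derivation0 (ader_derivation R). Qed.

Lemma natr_mul_eq0 (n : nat) (x : R) : n.+1%:R * x = 0 -> x = 0.
Proof.
move=> nx0; have n0 : (n.+1%:R : L) != 0.
  by have /pcharf0P -> := @dfield_pchar0 L.
have : astr R (n.+1%:R^-1) * (n.+1%:R * x) = 0 by rewrite nx0 mulr0.
by rewrite mulrA -(rmorph_nat (astr R)) -rmorphM mulVf // rmorph1 mul1r.
Qed.

Lemma derX n (x : R) : d (x ^+ n.+1) = n.+1%:R * x ^+ n * d x.
Proof.
elim: n => [|n IH]; first by rewrite !mul1r.
by rewrite exprS dM IH !exprS; ring.
Qed.

(** Induction on [j] gives x^m (dx)^(2j) = 0 whenever m + j = n: differentiate x^(m+1) (dx)^(2j),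
    multiply by dx, drop the multiple of x^(m+1) (dx)^(2j), and cancel m+1 in characteristic zero.
    At m = 0 a power of dx alone remains. *)
Let nilpotent_der n (x : R) : x ^+ n = 0 -> d x ^+ n.*2 = 0.
Proof.
move=> xn; suff h m j : (m + j = n)%N -> x ^+ m * d x ^+ j.*2 = 0.
  by have := h 0 n erefl; rewrite mul1r.
elim: j m => [|j IH] m; first by rewrite addn0 mulr1 => ->.
rewrite addnS -addSn => /IH h; apply: (@natr_mul_eq0 m).
have := congr1 (fun y => d y * d x) h; rewrite d0 mul0r dM derX mulrDl.
case: j {IH} h => [|j] h.
  have -> : d (d x ^+ 0) = 0 by exact: derivation1 (ader_derivation R).
  by rewrite doubleS !exprS => <-; ring.
rewrite derX => e1; rewrite -[RHS]e1.
have -> : x ^+ m.+1 * (j.+1.*2.-1.+1%:R * d x ^+ j.+1.*2.-1 * d (d x)) * d x =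
    j.+1.*2%:R * d (d x) * (x ^+ m.+1 * d x ^+ j.+1.*2).
  by rewrite doubleS /= !exprS; ring.
by rewrite h mulr0 addr0 !doubleS !exprS; ring.
Qed.

(** The nilradical is a differential ideal by [nilpotent_der], and it does not contain 1. *)
Lemma simple_reduced (x : R) n : x ^+ n = 0 -> x = 0.
Proof.
move=> xn; pose N (y : R) := exists n, y ^+ n = 0.
have [R1 /(_ N)] := simple; case=> [|h|h].
- split; first by exists 1%N; rewrite expr1.
  + move=> a b [p ap] [q bq]; exists (p + q)%N.
    rewrite exprDn big1 // => i _.
    have [iq|qi] := leqP q i; first by rewrite -(subnKC iq) exprD bq mul0r mulr0 mul0rn.
    have pi : (p <= p + q - i)%N by rewrite leq_subRL -?addnBA ?[(i + p)%N]addnC ?leq_add2l // ltnW ?ltn_addl.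
    by rewrite -(subnKC pi) exprD ap !mul0r mul0rn.
  + by move=> a y [p yp]; exists p; rewrite exprMn yp mulr0.
  + by move=> y [p /nilpotent_der yp]; exists p.*2.
- by apply: h; exists n.
- by have [p] := h 1; rewrite expr1n.
Qed.

(** The elements killed by a power of [x] form a differential ideal; if it is the whole ring, [x] is
    nilpotent, hence zero. *)
Lemma simple_domain (x y : R) : x * y = 0 -> x = 0 \/ y = 0.
Proof.
move=> xy; have [x0|x0] := pselect (x = 0); first by left.
right; pose N (z : R) := exists n, x ^+ n * z = 0.
have [R1 /(_ N)] := simple; case=> [|h|h].
- split; first by exists 0%N; rewrite mulr0.
  + move=> a b [p ap] [q bq]; exists (p + q)%N.
    have -> : x ^+ (p + q) * (a + b) = x ^+ q * (x ^+ p * a) + x ^+ p * (x ^+ q * b).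
      by rewrite exprD; ring.
    by rewrite ap bq !mulr0 addr0.
  + by move=> a z [p zp]; exists p; rewrite mulrCA zp mulr0.
  + move=> z [p zp]; exists p.+1; have := congr1 d zp.
    rewrite dM d0 => h.
    have -> : x ^+ p.+1 * d z = x * (d (x ^+ p) * z + x ^+ p * d z) - x * d (x ^+ p) * z.
      by rewrite exprS; ring.
    rewrite h mulr0 sub0r; case: p zp {h} => [|p] zp.
      have -> : d (x ^+ 0) = 0 by exact: derivation1 (ader_derivation R).
      by rewrite mulr0 mul0r oppr0.
    rewrite derX; have -> : x * (p.+1%:R * x ^+ p * d x) * z =
      p.+1%:R * d x * (x ^+ p.+1 * z) by rewrite exprS; ring.
    by rewrite zp mulr0 oppr0.
- by apply: h; exists 1%N; rewrite expr1.
- have [p] := h 1; rewrite mulr1 => /simple_reduced //.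
Qed.

Hypothesis const_R : forall x : R, d x = 0 -> exists c : const L, x = astr R (const_inj L c).

(* The differential ideal of denominators of w / u contains u. *)
Lemma const_fraction (u w : R) : u <> 0 -> u * d w = d u * w ->
  exists c : const L, w = astr R (const_inj L c) * u.
Proof.
move=> u0 e; pose N (z : R) := exists z', z * w = z' * u.
have cancel_u a : u * a = 0 -> a = 0 by move=> /simple_domain[].
have key z z' : z * w = z' * u -> d z * w = d z' * u.
  move=> h; have := congr1 d h; rewrite !dM => h'; apply/eqP; rewrite -subr_eq0; apply/eqP.
  apply: cancel_u; have : u * (d z * w + z * d w) = u * (d z' * u + z' * d u) by rewrite h'.
  move=> h2; have -> : u * (d z * w - d z' * u) = u * (d z * w + z * d w)
      - u * (d z' * u + z' * d u) - z * (u * d w) + (z' * u) * d u by ring.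
  by rewrite h2 subrr sub0r e -h; ring.
have [R1 /(_ N)] := simple; case=> [|h|h].
- split; first by exists 0; rewrite !mul0r.
  + by move=> a b [a' ha] [b' hb]; exists (a' + b'); rewrite !mulrDl ha hb.
  + by move=> a z [z' hz]; exists (a * z'); rewrite -!mulrA hz.
  + by move=> z [z' hz]; exists (d z'); apply: key.
- by case: u0; apply: h; exists w; rewrite mulrC.
- have [z' hz] := h 1; rewrite mul1r in hz; have := key 1 z'; rewrite mul1r => /(_ hz).
  rewrite derivation1 ?mul0r; last exact: ader_derivation.
  move/esym; rewrite mulrC => /cancel_u /const_R[c ec].
  by exists c; rewrite -ec.
Qed.

End Simple.

(** * Quotients of group schemes *)

Section QuotientRing.
Variable A : comPzRingType.

Record ideal := Ideal {
  in_ideal :> A -> Prop;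
  ideal0 : in_ideal 0;
  idealD : forall x y, in_ideal x -> in_ideal y -> in_ideal (x + y);
  idealM : forall x y, in_ideal y -> in_ideal (x * y) }.

Variable a : ideal.

Definition ideal_eqv (x y : A) : bool := `[< a (x - y) >].

Lemma ideal_eqv_refl : reflexive ideal_eqv.
Proof. by move=> x; apply/asboolP; rewrite subrr; exact: ideal0. Qed.

Lemma ideal_eqv_sym : symmetric ideal_eqv.
Proof.
have h x y : ideal_eqv x y -> ideal_eqv y x.
  by move=> /asboolP h; apply/asboolP; rewrite -opprB -mulN1r; apply: idealM.
by move=> x y; apply/idP/idP; exact: h.
Qed.

Lemma ideal_eqv_trans : transitive ideal_eqv.
Proof.
move=> y x z /asboolP h /asboolP h'; apply/asboolP.
by have := idealD h h'; rewrite addrA subrK.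
Qed.

Definition ideal_eqv_equiv :=
  EquivRel ideal_eqv ideal_eqv_refl ideal_eqv_sym ideal_eqv_trans.
Canonical ideal_eqv_equiv.

Definition quot := {eq_quot ideal_eqv}.
HB.instance Definition _ := Choice.copy quot {eq_quot ideal_eqv}.

Definition qpi (x : A) : quot := \pi_({eq_quot ideal_eqv}) x.
Definition qrepr (q : quot) : A := repr (q : {eq_quot ideal_eqv}).

Lemma qreprK q : qpi (qrepr q) = q.
Proof. by rewrite /qpi /qrepr reprK. Qed.

Lemma qpiP x y : qpi x = qpi y <-> a (x - y).
Proof.
split=> [/eqmodP/asboolP //|h].
by apply/eqmodP/asboolP.
Qed.

Lemma qpi_repr x : a (qrepr (qpi x) - x).
Proof. by apply/qpiP; rewrite qreprK. Qed.

Definition qadd p q := qpi (qrepr p + qrepr q).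
Definition qopp p := qpi (- qrepr p).
Definition qmul p q := qpi (qrepr p * qrepr q).

Lemma qaddE x y : qadd (qpi x) (qpi y) = qpi (x + y).
Proof. by apply/qpiP; rewrite opprD addrACA; apply: idealD; exact: qpi_repr. Qed.

Lemma qoppE x : qopp (qpi x) = qpi (- x).
Proof. by apply/qpiP; rewrite -opprD -mulN1r; apply: idealM; exact: qpi_repr. Qed.

Lemma qmulE x y : qmul (qpi x) (qpi y) = qpi (x * y).
Proof.
apply/qpiP; set x' := qrepr _; set y' := qrepr _.
have -> : x' * y' - x * y = x' * (y' - y) + y * (x' - x) by ring.
by apply: idealD; apply: idealM; exact: qpi_repr.
Qed.

Lemma qpi_ind (P : quot -> Prop) : (forall x, P (qpi x)) -> forall q, P q.
Proof. by move=> h q; rewrite -(qreprK q). Qed.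

Lemma qaddA : associative qadd.
Proof. by elim/qpi_ind=> x; elim/qpi_ind=> y; elim/qpi_ind=> z; rewrite !qaddE addrA. Qed.
Lemma qaddC : commutative qadd.
Proof. by elim/qpi_ind=> x; elim/qpi_ind=> y; rewrite !qaddE addrC. Qed.
Lemma qadd0 : left_id (qpi 0) qadd.
Proof. by elim/qpi_ind=> x; rewrite qaddE add0r. Qed.
Lemma qaddN : left_inverse (qpi 0) qopp qadd.
Proof. by elim/qpi_ind=> x; rewrite qoppE qaddE addNr. Qed.

HB.instance Definition _ := GRing.isZmodule.Build quot qaddA qaddC qadd0 qaddN.

Lemma qmulA : associative qmul.
Proof. by elim/qpi_ind=> x; elim/qpi_ind=> y; elim/qpi_ind=> z; rewrite !qmulE mulrA. Qed.
Lemma qmulC : commutative qmul.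
Proof. by elim/qpi_ind=> x; elim/qpi_ind=> y; rewrite !qmulE mulrC. Qed.
Lemma qmul1 : left_id (qpi 1) qmul.
Proof. by elim/qpi_ind=> x; rewrite qmulE mul1r. Qed.
Lemma qmulDl : left_distributive qmul qadd.
Proof.
by elim/qpi_ind=> x; elim/qpi_ind=> y; elim/qpi_ind=> z; rewrite !(qaddE, qmulE) mulrDl.
Qed.

HB.instance Definition _ := GRing.Zmodule_isComPzRing.Build quot qmulA qmulC qmul1 qmulDl.

Lemma qpi_ringhom : ringhom qpi.
Proof.
apply: ringhomP => [x y||x y] //; first by rewrite -qaddE.
by rewrite -qmulE.
Qed.

Lemma qpi_eq0 x : qpi x = 0 <-> a x.
Proof. by rewrite -(rhom0 qpi_ringhom) qpiP subr0. Qed.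

Lemma qlift_pi (B : Type) (h : A -> B) : (forall x y, a (x - y) -> h x = h y) ->
  forall x, h (qrepr (qpi x)) = h x.
Proof. by move=> e x; apply: e; exact: qpi_repr. Qed.

Lemma qlift_ringhom (B : comPzRingType) (h : A -> B) : ringhom h ->
  (forall x, a x -> h x = 0) ->
  ringhom (h \o qrepr) /\ forall x, h (qrepr (qpi x)) = h x.
Proof.
move=> hh ha; have e x : h (qrepr (qpi x)) = h x.
  apply: qlift_pi => u v /ha; rewrite (rhomB hh) => /eqP.
  by rewrite subr_eq0 => /eqP.
split=> //; apply: ringhomP => [p q||p q] /=.
- by elim/qpi_ind: p => x; elim/qpi_ind: q => z; rewrite -(rhomD qpi_ringhom) !e (rhomD hh).
- by rewrite -(rhom1 qpi_ringhom) e (rhom1 hh).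
- by elim/qpi_ind: p => x; elim/qpi_ind: q => z; rewrite -(rhomM qpi_ringhom) !e (rhomM hh).
Qed.

End QuotientRing.

(** * Points of group schemes and of closed subgroups *)

Section GroupPoints.
Variables (K : fieldType) (G : algGroup K).
Variable T : alg K.
Implicit Types x y z : G -> T.

Let e x y c : alghom x -> alghom y -> x (astr G c) = y (astr G c).
Proof. by move=> [_ _ ->] [_ _ ->]. Qed.

Lemma pt_lift_ringhom x y : alghom x -> alghom y ->
  ringhom (tlift (f := astr G) (g := astr G) x y).
Proof.
by move=> hx hy; apply: tlift_ringhom; [exact: alghom_ringhom..|move=> c; exact: e].
Qed.

Lemma gmul_alghom x y : alghom x -> alghom y -> alghom (gmul x y).
Proof.
move=> hx hy; have hl := pt_lift_ringhom hx hy; have [cz cm cc] := comulP G.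
have [hz hm] := ringhom_comp (conj cz cm : ringhom (comul G)) hl.
split=> // c; rewrite /gmul /pmul cc.
rewrite [LHS]tlift_tinl; [by case: hx|exact: alghom_ringhom..|by move=> ?; exact: e].
Qed.

Lemma ginv_alghom x : alghom x -> alghom (ginv x).
Proof.
move=> hx; have ha := antipodeP G; have [_ _ ac] := ha.
have [hz hm] := ringhom_comp (alghom_ringhom ha) (alghom_ringhom hx).
by split=> // c; rewrite /ginv /= ac; case: hx.
Qed.

Lemma gone_alghom : alghom (@gone K G T).
Proof.
have ha := counitP G; have [_ _ ac] := ha.
have [hz hm] := ringhom_comp (alghom_ringhom ha) (rmorph_ringhom (astr T)).
by split=> // c; rewrite /gone /= ac.
Qed.

Lemma gmulgA x y z : alghom x -> alghom y -> alghom z ->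
  gmul x (gmul y z) = gmul (gmul x y) z.
Proof. by move=> hx hy hz; apply/funext; exact: gmulA. Qed.

Lemma gmul1x x : alghom x -> gmul (@gone K G T) x = x.
Proof. by move=> hx; apply/funext; exact: gmul1g. Qed.

Lemma gmulx1 x : alghom x -> gmul x (@gone K G T) = x.
Proof. by move=> hx; apply/funext; exact: gmulg1. Qed.

Lemma gmulVx x : alghom x -> gmul (ginv x) x = @gone K G T.
Proof. by move=> hx; apply/funext; exact: gmulVg. Qed.

Lemma gmulxV x : alghom x -> gmul x (ginv x) = @gone K G T.
Proof. by move=> hx; apply/funext; exact: gmulgV. Qed.

Lemma ginv_unique x y : alghom x -> alghom y -> gmul x y = @gone K G T -> y = ginv x.
Proof.
move=> hx hy xy; have hv := ginv_alghom hx.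
by rewrite -[LHS]gmul1x // -(gmulVx hx) -gmulgA // xy gmulx1.
Qed.

Lemma ginvK x : alghom x -> ginv (ginv x) = x.
Proof.
move=> hx; have hv := ginv_alghom hx.
by symmetry; apply: ginv_unique => //; exact: gmulVx.
Qed.

Lemma ginv1 : ginv (@gone K G T) = @gone K G T.
Proof.
by symmetry; apply: ginv_unique; rewrite ?gmulx1 //; exact: gone_alghom.
Qed.

Lemma ginvM x y : alghom x -> alghom y -> ginv (gmul x y) = gmul (ginv y) (ginv x).
Proof.
move=> hx hy; have hxv := ginv_alghom hx; have hyv := ginv_alghom hy.
symmetry; apply: ginv_unique; [exact: gmul_alghom..|].
rewrite -gmulgA //; last exact: gmul_alghom.
by rewrite [gmul y _]gmulgA // gmulxV // gmul1x // gmulxV.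
Qed.

End GroupPoints.

Section GroupPointsComp.
Variables (K : fieldType) (G : algGroup K).
Variables (T T' : alg K) (u : T -> T').
Hypothesis hu : alghom u.

Lemma pt_comp_alghom (A : alg K) (x : A -> T) : alghom x -> alghom (u \o x).
Proof.
move=> hx; have [hz hm] := ringhom_comp (alghom_ringhom hx) (alghom_ringhom hu).
by split=> // c; have [_ _ /= ->] := hx; case: hu.
Qed.

Lemma gmul_comp (x y : G -> T) : alghom x -> alghom y ->
  gmul (u \o x) (u \o y) = u \o gmul x y.
Proof.
move=> hx hy; apply/funext => f; rewrite /gmul /pmul /=.
have hxu := pt_comp_alghom hx; have hyu := pt_comp_alghom hy.
have e (T1 : alg K) (x1 y1 : G -> T1) : alghom x1 -> alghom y1 ->
    forall c, x1 (astr G c) = y1 (astr G c) by move=> [_ _ h] [_ _ h'] c; rewrite h h'.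
symmetry; apply: (tensor_hom_ext (h := u \o _) _ (pt_lift_ringhom hxu hyu)).
- exact: ringhom_comp (pt_lift_ringhom hx hy) (alghom_ringhom hu).
- move=> a /=; rewrite !tlift_tinl //; try exact: alghom_ringhom; exact: e.
- move=> a /=; rewrite !tlift_tinr //; try exact: alghom_ringhom; exact: e.
Qed.

Lemma gone_comp : u \o @gone K G T = @gone K G T'.
Proof. by apply/funext => f; rewrite /gone /=; case: hu. Qed.

End GroupPointsComp.

Lemma finite_type_surj (L : comPzRingType) (A B : alg L) (h : A -> B) :
  alghom h -> (forall b, exists a, h a = b) -> finite_type A -> finite_type B.
Proof.
move=> hh sh [s hs]; have [_ _ hc] := hh; have rh := alghom_ringhom hh.
exists (map h s) => b P Pc Ps PD PM; have [a <-] := sh b.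
apply: (hs a (fun a => P (h a))) => [c|a' ha|a1 a2 h1 h2|a1 a2 h1 h2].
- by rewrite hc.
- by apply: Ps; apply: map_f.
- by rewrite (rhomD rh); apply: PD.
- by rewrite (rhomM rh); apply: PM.
Qed.

Section SubgroupPoints.
Variables (K : fieldType) (G : algGroup K) (H : closedSubgroup G).

Lemma gmul_sgmap (T : alg K) (x z : H -> T) : alghom x -> alghom z ->
  gmul (x \o sgmap H) (z \o sgmap H) = gmul x z \o sgmap H.
Proof.
move=> hx hz; apply/funext => f; rewrite /gmul /pmul /= sgmap_comul.
have hm := sgmap_alghom H.
have hxm : @alghom K G T (x \o sgmap H) by exact: (pt_comp_alghom hx hm).
have hzm : @alghom K G T (z \o sgmap H) by exact: (pt_comp_alghom hz hm).
have [_ _ mc] := hm.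
have e c : tinl (astr H) (astr H) (sgmap H (astr G c)) = tinr (astr H) (astr H) (sgmap H (astr G c)).
  by rewrite mc tinl_tinr.
have [rh rl rr] := tmap_ringhom (alghom_ringhom hm) (alghom_ringhom hm) e.
have ez (T1 : alg K) (H1 : algGroup K) (x1 z1 : H1 -> T1) c :
  alghom x1 -> alghom z1 -> x1 (astr H1 c) = z1 (astr H1 c).
  by move=> [_ _ ->] [_ _ ->].
apply: (tensor_hom_ext (pt_lift_ringhom hxm hzm) (ringhom_comp rh (pt_lift_ringhom hx hz))).
- move=> a /=; rewrite rl !tlift_tinl //; try exact: alghom_ringhom; by move=> c; exact: ez.
- move=> a /=; rewrite rr !tlift_tinr //; try exact: alghom_ringhom; by move=> c; exact: ez.
Qed.

(** The restricted unit is idempotent in the group of T-points of G, so it is the unit. *)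
Lemma gone_sgmap (T : alg K) : @gone K H T \o sgmap H = @gone K G T.
Proof.
set e := _ \o _; have h1 := gone_alghom H T.
have he : @alghom K G T e by exact: (pt_comp_alghom h1 (sgmap_alghom H)).
have ee : gmul e e = e by rewrite /e gmul_sgmap // gmul1x.
by rewrite -[LHS]gmul1x // -(gmulVx he) -gmulgA ?ee //; exact: ginv_alghom.
Qed.

Lemma ginv_sgmap : ginv (@sgmap _ _ H) = antipode H \o sgmap H.
Proof.
have hi : @alghom K H H id by have [hz hm] := ringhom_id H.
have hm := sgmap_alghom H.
symmetry; apply: (@ginv_unique K G H); [exact: hm|exact: pt_comp_alghom (antipodeP H) _ _ hm|].
rewrite -[X in gmul X](_ : id \o sgmap H = _) // (gmul_sgmap hi (antipodeP H)).
by rewrite -[antipode H]/(ginv id) (gmulxV hi) gone_sgmap.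
Qed.

End SubgroupPoints.

(** * Closed subgroups cut out by ideals *)

Section QuotientSubgroup.
Variables (K : fieldType) (G : algGroup K) (a : ideal G).

Definition kills (T : alg K) (x : G -> T) : Prop := forall f, a f -> x f = 0.

Hypothesis kills_one : kills (@gone K G (Alg (@idfun K))).
Hypothesis kills_mul : forall (T : alg K) (x y : G -> T), alghom x -> alghom y ->
  kills x -> kills y -> kills (gmul x y).
Hypothesis kills_inv : forall (T : alg K) (x : G -> T), alghom x ->
  kills x -> kills (ginv x).

Let pi := @qpi G a.
Let Q : alg K := Alg (bundle (qpi_ringhom a) \o astr G).

Let pi_alghom : @alghom K G Q pi.
Proof. by have [hz hm] := qpi_ringhom a. Qed.

Let pi_kills : kills (T := Q) pi.
Proof. by move=> f /(qpi_eq0 a). Qed.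

Let QQ : alg K := Alg (tinl (astr Q) (astr Q) \o astr Q).
Let l : Q -> QQ := tinl (astr Q) (astr Q).
Let r : Q -> QQ := tinr (astr Q) (astr Q).
Let hl : alghom l. Proof. by have [hz hm] := tinl_ringhom (astr Q) (astr Q). Qed.
Let hr : alghom r.
Proof.
have [hz hm] := tinr_ringhom (astr Q) (astr Q).
by split=> // c; rewrite /r -tinl_tinr.
Qed.

(** The product of the two universal points of the subscheme. It kills the ideal by [kills_mul],
    which lets it factor through the quotient; counit and antipode descend likewise. *)
Let Qcomul : Q -> QQ := (gmul (l \o pi) (r \o pi) : G -> QQ) \o @qrepr G a.
Let Qcounit : Q -> K := counit G \o @qrepr G a.
Let Qantipode : Q -> Q := (pi \o antipode G) \o @qrepr G a.

Let lift_alghom (T : alg K) (h : G -> T) : alghom h -> kills h ->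
  @alghom K Q T (h \o @qrepr G a) /\ forall x, h (qrepr (pi x)) = h x.
Proof.
move=> hh hk; have [[hz hm] he] := qlift_ringhom (alghom_ringhom hh) hk.
by split=> //; split=> // c; rewrite [LHS]he; case: hh.
Qed.

Let comul_kills : kills (gmul (l \o pi) (r \o pi) : G -> QQ).
Proof.
apply: kills_mul; [exact: pt_comp_alghom..| |] => f /pi_kills /= ->.
  exact: (rmorph0 (tinl (astr Q) (astr Q))).
exact: (rmorph0 (tinr (astr Q) (astr Q))).
Qed.

Let QcomulP : alghom Qcomul.
Proof. by have [] := lift_alghom (gmul_alghom (pt_comp_alghom hl pi_alghom) (pt_comp_alghom hr pi_alghom)) comul_kills. Qed.

Let QcomulE f : Qcomul (pi f) = gmul (l \o pi) (r \o pi) f.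
Proof. by have [_ h] := lift_alghom (gmul_alghom (pt_comp_alghom hl pi_alghom) (pt_comp_alghom hr pi_alghom)) comul_kills; exact: h. Qed.

Let QcounitP : @alghom K Q (Alg idfun) Qcounit.
Proof. by have [] := lift_alghom (counitP G) kills_one. Qed.

Let QcounitE f : Qcounit (pi f) = counit G f.
Proof. by have [_ h] := lift_alghom (counitP G) kills_one; exact: h. Qed.

Let QantipodeP : alghom Qantipode.
Proof. by have [] := lift_alghom (ginv_alghom pi_alghom) (kills_inv pi_alghom pi_kills). Qed.

Let QantipodeE f : Qantipode (pi f) = pi (antipode G f).
Proof. by have [_ h] := lift_alghom (ginv_alghom pi_alghom) (kills_inv pi_alghom pi_kills); exact: h. Qed.

Let pmulE (T : alg K) (x y : Q -> T) : alghom x -> alghom y ->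
  (pmul Qcomul x y \o pi) = gmul (x \o pi) (y \o pi).
Proof.
move=> hx hy; apply/funext => f; rewrite /pmul /= QcomulE.
have e c : x (astr Q c) = y (astr Q c) by have [_ _ ->] := hx; have [_ _ ->] := hy.
have rx := alghom_ringhom hx; have ry := alghom_ringhom hy.
have rl := tlift_ringhom rx ry e.
have al : alghom (tlift (f := astr Q) (g := astr Q) x y : QQ -> T).
  have [hz hm] := rl; split=> // c; rewrite [LHS](tlift_tinl rx ry e).
  by case: hx.
have := congr1 (fun h => h f) (gmul_comp al (pt_comp_alghom hl pi_alghom) (pt_comp_alghom hr pi_alghom)).
move=> /= <-; congr (gmul _ _ f); apply/funext => q /=.
  exact: (tlift_tinl rx ry e).
exact: (tlift_tinr rx ry e).
Qed.

Let pi_surj (T : Type) (x y : Q -> T) : x \o pi = y \o pi -> x =1 y.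
Proof.
by move=> e q; rewrite -(qreprK q); exact: (congr1 (fun h => h (qrepr q)) e).
Qed.

Let pmul_alghom (T : alg K) (x y : Q -> T) : alghom x -> alghom y -> alghom (pmul Qcomul x y).
Proof.
move=> hx hy.
have e c : x (astr Q c) = y (astr Q c) by have [_ _ ->] := hx; have [_ _ ->] := hy.
have rx := alghom_ringhom hx; have ry := alghom_ringhom hy.
have rl := tlift_ringhom rx ry e.
have [hz hm] := ringhom_comp (alghom_ringhom QcomulP) rl.
split=> // c; have [_ _ qc] := QcomulP; rewrite /pmul qc.
by rewrite [LHS](tlift_tinl rx ry e); case: hx.
Qed.

Let one_alghom (T : alg K) : alghom (astr T \o Qcounit : Q -> T).
Proof.
have [hz hm] := ringhom_comp (alghom_ringhom QcounitP) (rmorph_ringhom (astr T)).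
by split=> // c; have [_ _ /= ->] := QcounitP.
Qed.

Let one_pi (T : alg K) : (astr T \o Qcounit) \o pi = @gone K G T.
Proof. by apply/funext => f; rewrite /= QcounitE. Qed.

Let inv_pi (T : alg K) (x : Q -> T) : (x \o Qantipode) \o pi = ginv (x \o pi).
Proof. by apply/funext => f; rewrite /= QantipodeE. Qed.

Let QmulA (T : alg K) (x y z : Q -> T) : alghom x -> alghom y -> alghom z ->
  pmul Qcomul x (pmul Qcomul y z) =1 pmul Qcomul (pmul Qcomul x y) z.
Proof.
move=> hx hy hz; apply: pi_surj; have hp := pt_comp_alghom _ pi_alghom.
rewrite !pmulE //; try exact: pmul_alghom.
by rewrite gmulgA //; exact: pt_comp_alghom.
Qed.

Let Qmul1g (T : alg K) (x : Q -> T) : alghom x -> pmul Qcomul (astr T \o Qcounit) x =1 x.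
Proof.
move=> hx; apply: pi_surj; rewrite pmulE // one_pi gmul1x //.
exact: pt_comp_alghom.
Qed.

Let Qmulg1 (T : alg K) (x : Q -> T) : alghom x -> pmul Qcomul x (astr T \o Qcounit) =1 x.
Proof.
move=> hx; apply: pi_surj; rewrite pmulE // one_pi gmulx1 //.
exact: pt_comp_alghom.
Qed.

Let inv_alghom (T : alg K) (x : Q -> T) : alghom x -> alghom (x \o Qantipode).
Proof. by move=> hx; exact: pt_comp_alghom. Qed.

Let QmulVg (T : alg K) (x : Q -> T) : alghom x ->
  pmul Qcomul (x \o Qantipode) x =1 astr T \o Qcounit.
Proof.
move=> hx; apply: pi_surj; rewrite pmulE //; last exact: inv_alghom.
by rewrite one_pi inv_pi gmulVx //; exact: pt_comp_alghom.
Qed.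

Let QmulgV (T : alg K) (x : Q -> T) : alghom x ->
  pmul Qcomul x (x \o Qantipode) =1 astr T \o Qcounit.
Proof.
move=> hx; apply: pi_surj; rewrite pmulE //; last exact: inv_alghom.
by rewrite one_pi inv_pi gmulxV //; exact: pt_comp_alghom.
Qed.

Let pi_onto (q : Q) : exists f, pi f = q.
Proof. by exists (qrepr q); exact: qreprK. Qed.

Let Qfinite : finite_type Q.
Proof. exact: finite_type_surj pi_alghom pi_onto (coord_finite G). Qed.

Let Qgroup : algGroup K :=
  @AlgGroup K Q Qcomul Qcounit Qantipode QcomulP QcounitP QantipodeP
    QmulA Qmul1g Qmulg1 QmulVg QmulgV Qfinite.

(** The points that kill [a] are closed under the group operations, so the structure maps of G
    descend to the quotient; the group laws are inherited because a point of the quotient is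
    determined by its composite with [pi] ([pi_surj]). *)
Lemma quotient_subgroup : exists H : closedSubgroup G, forall f, sgmap H f = 0 <-> a f.
Proof.
have hc f : Qcomul (pi f) = tmap pi pi (comul G f) by rewrite QcomulE.
exists (@ClosedSubgroup K G Qgroup pi pi_alghom pi_onto hc) => f /=.
exact: qpi_eq0.
Qed.

End QuotientSubgroup.

(** * Stabilizers of ideals *)

Section Stabilizer.
Variables (K : fieldType) (G : algGroup K) (J : G -> Prop) (C : coordinates J).
Hypothesis J_M : forall u v, J v -> J (u * v).

Definition Gtens (T : alg K) : alg K := Alg (tinl (astr T) (astr G) \o astr T).
Definition gl (T : alg K) : T -> Gtens T := tinl (astr T) (astr G).
Definition gr (T : alg K) : G -> Gtens T := tinr (astr T) (astr G).

Lemma gl_alghom T : alghom (@gl T).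
Proof. by have [hz hm] := tinl_ringhom (astr T) (astr G). Qed.

Lemma gr_alghom T : alghom (@gr T).
Proof.
have [hz hm] := tinr_ringhom (astr T) (astr G).
by split=> // c; rewrite /gr -tinl_tinr.
Qed.

Lemma id_alghom (A : alg K) : alghom (@id A).
Proof. by have [hz hm] := ringhom_id A. Qed.

(* f |-> f (x g), for a T-point x of G *)
Definition trans (T : alg K) (x : G -> T) : G -> Gtens T := gmul (@gl T \o x) (@gr T).

(** Only an inclusion of the translate of J in T (x) J; [stab_ideal] therefore tests a point
    together with its inverse. *)
Definition stab (T : alg K) (x : G -> T) : Prop :=
  forall f, J f -> spanned J (trans x f).

Lemma trans_alghom (T : alg K) (x : G -> T) : alghom x -> alghom (trans x).
Proof.
move=> hx; apply: gmul_alghom; last exact: gr_alghom.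
exact: pt_comp_alghom (gl_alghom T) _ _ hx.
Qed.

Lemma coT_trans (T T' : alg K) (u : T -> T') (x : G -> T) t f :
  alghom u -> alghom x -> coT C t (trans (u \o x) f) = u (coT C t (trans x f)).
Proof.
move=> hu hx; have [_ _ uc] := hu.
rewrite -(coT_tmap C (alghom_ringhom hu) uc).
have [rh rl rr] := tmap_idr G (alghom_ringhom hu) uc.
have ah : alghom (tmap u id : Gtens T -> Gtens T').
  have [hz hm] := rh; split=> // c; rewrite [LHS]rl uc; exact: erefl.
have := congr1 (fun h => h f)
  (gmul_comp ah (pt_comp_alghom (gl_alghom T) hx) (gr_alghom T)).
rewrite /= => e; congr (coT C t _); rewrite -[RHS]e /trans.
by congr (gmul _ _ f); apply/funext => z /=; rewrite ?rl ?rr.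
Qed.

Lemma stab_one (T : alg K) : stab (@gone K G T).
Proof.
move=> f Jf; rewrite /trans (gone_comp G (gl_alghom T)) gmul1x; last exact: gr_alghom.
exact: spanned_pure.
Qed.

(** Translation by the product is translation by [x] followed by the T-linear extension [h] of
    translation by [z], and both keep the span of J. *)
Lemma stab_mul (T : alg K) (x z : G -> T) : alghom x -> alghom z ->
  stab x -> stab z -> stab (gmul x z).
Proof.
move=> hx hz sx sz f Jf.
have hlx := pt_comp_alghom (gl_alghom T) hx; have hlz := pt_comp_alghom (gl_alghom T) hz.
rewrite /trans -gmul_comp //; last exact: gl_alghom.
rewrite -gmulgA //; last exact: gr_alghom.
have ht := trans_alghom hz.
pose h : Gtens T -> Gtens T := tlift (@gl T) (trans z).
have e c : gl (astr T c) = trans z (astr G c) by case: ht => _ _ ->.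
have rl := alghom_ringhom (gl_alghom T); have rt := alghom_ringhom ht.
have hh : ringhom h by exact: tlift_ringhom.
have hhl a : h (gl a) = gl a by exact: (tlift_tinl rl rt e).
have hhr a : h (gr T a) = trans z a by exact: (tlift_tinr rl rt e).
have ah : alghom h by have [z1 z2] := hh; split=> // c; rewrite [LHS]hhl.
have -> : gmul (@gl T \o x) (gmul (@gl T \o z) (@gr T)) f = h (trans x f).
  have := congr1 (fun h => h f) (gmul_comp ah hlx (gr_alghom T)).
  rewrite /= => e1; rewrite -[RHS]e1; congr (gmul _ _ f); apply/funext => w /=.
    by rewrite hhl.
  by rewrite hhr.
apply: (sx f Jf (fun v => spanned J (h v))) => [|a b ha hb|a v Jv].
- by rewrite (rhom0 hh); exact: spanned0.
- by rewrite (rhomD hh); exact: spannedD.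
- by rewrite -tinlr (rhomM hh) hhr; apply: spannedM => //; exact: sz.
Qed.

(** The vanishing ideal of the stabiliser of J, tested on points over all K-algebras. *)
Let a0 (f : G) : Prop := forall (T : alg K) (x : G -> T), alghom x ->
  stab x -> stab (ginv x) -> x f = 0.

Definition stab_ideal : ideal G.
Proof.
apply: (@Ideal _ a0) => [T x hx _ _|u v hu hv T x hx sx sx'|u v hv T x hx sx sx'].
- exact: (rhom0 (alghom_ringhom hx)).
- by rewrite (rhomD (alghom_ringhom hx)) hu // hv // addr0.
- by rewrite (rhomM (alghom_ringhom hx)) hv // mulr0.
Defined.

(* Every point that stabilizes J factors through K[G] modulo the coordinates  *)
(* of the universal translates of J, so these coordinates lie in stab_ideal.  *)
Lemma stab_ideal_trans f t : J f ->
  stab_ideal (coT C t (trans (@id G) f)) /\ stab_ideal (coT C t (trans (ginv (@id G)) f)).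
Proof.
move=> Jf; have hi := id_alghom G; split=> T x hx sx sx'.
  by rewrite -coT_trans //; exact: (coT_spanned C t (sx f Jf)).
rewrite -coT_trans //; last exact: ginv_alghom.
exact: (coT_spanned C t (sx' f Jf)).
Qed.

(** Closing up adds no points: the coordinates of the universal translates of J lie in [stab_ideal],
    and at a point that kills it they specialise to the coordinates of the translates by that
    point. *)
Lemma kills_stab (T : alg K) (x : G -> T) : alghom x ->
  kills stab_ideal x <-> stab x /\ stab (ginv x).
Proof.
move=> hx; have hi := id_alghom G; split=> [h|[sx sx'] f]; last exact.
split=> f Jf; apply/(spannedP C) => t; have [h1 h2] := stab_ideal_trans t Jf.
  by have := coT_trans t f hx hi; rewrite (h _ h1).
by have := coT_trans t f hx (ginv_alghom hi); rewrite (h _ h2).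
Qed.

Lemma stabilizer : exists H : closedSubgroup G, forall f, sgmap H f = 0 <-> stab_ideal f.
Proof.
apply: quotient_subgroup => [|T x z hx hz|T x hx].
- apply/kills_stab; first exact: gone_alghom.
  by rewrite ginv1; split; exact: stab_one.
- move=> /(kills_stab hx)[sx sx'] /(kills_stab hz)[sz sz'].
  apply/kills_stab; first exact: gmul_alghom.
  by rewrite ginvM //; split; apply: stab_mul => //; exact: ginv_alghom.
- move=> /(kills_stab hx)[sx sx']; apply/kills_stab; first exact: ginv_alghom.
  by rewrite ginvK.
Qed.

Variables (I : Type) (H : I -> closedSubgroup G).
Hypothesis H_gen : generated_by H.
Hypothesis H_stab : forall i, stab (T := Alg (astr (H i))) (@sgmap _ _ (H i))
  /\ stab (T := Alg (astr (H i))) (ginv (@sgmap _ _ (H i))).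

(** The stabiliser contains every H_i, so it is G and its ideal is zero. Hence the coordinates
    modulo J of the universal translate of [f], which is its co-multiplication, all vanish. *)
Lemma comul_spanned f : J f -> spanned J (comul G f).
Proof.
move=> Jf; have [H' hH'] := stabilizer.
have a_0 f' : stab_ideal f' -> f' = 0.
  move=> /hH'; apply: H_gen => i x /hH' hx.
  have [s1 s2] := H_stab i; exact: (hx _ _ (sgmap_alghom (H i)) s1 s2).
have e : comul G f = trans (@id G) f.
  exact: (tensor_hom_lift (h := id) (ringhom_id _) (comul G f)).
by rewrite e; apply/(spannedP C) => t; have [/a_0] := stab_ideal_trans t Jf.
Qed.

Hypothesis sJ : subspace J.

(** Transitivity of G on itself in Hopf terms. For f in J the co-multiplication is a sum of f_1 (x)
    f_2 with f_2 in J. The sum of antipode(f_1) f_2 is the scalar eps(f) and lies in J, so eps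
    vanishes on J when 1 is not in J; then f, the sum of f_1 eps(f_2), is zero. *)
Lemma stable_ideal_trivial : ~ J 1 -> forall f, J f -> f = 0.
Proof.
move=> nJ1; have [J0 JD JZ] := sJ; have hi := id_alghom G.
have e0 f : J f -> counit G f = 0.
  move=> Jf; apply/eqP; apply: contraT => ef; case: nJ1.
  have e c : ginv (@id G) (astr G c) = id (astr G c) by case: (ginv_alghom hi) => _ _ ->.
  have ri := ringhom_id G; have rv := alghom_ringhom (ginv_alghom hi).
  have := congr1 (fun h => h f) (gmulVx hi); rewrite /gmul /pmul /gone /= => e1.
  have : J (astr G (counit G f)).
    rewrite -e1; have hs := comul_spanned Jf; apply: (hs (fun v => J (tlift (ginv (@id G)) id v))).
    - by rewrite (rhom0 (tlift_ringhom rv ri e)).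
    - by move=> u v; rewrite (rhomD (tlift_ringhom rv ri e)); exact: JD.
    - by move=> u v Jv; rewrite (tlift_pure rv ri e); exact: J_M.
  by move=> /(JZ (counit G f)^-1); rewrite -rmorphM mulVf // rmorph1.
move=> f Jf; have h1 := gone_alghom G G.
have e c : id (astr G c) = @gone K G G (astr G c) by case: h1 => _ _ ->.
have ri := ringhom_id G; have r1 := alghom_ringhom h1.
rewrite -[LHS](congr1 (fun h => h f) (gmulx1 hi)) /gmul /pmul.
have hs := comul_spanned Jf; apply: (hs (fun v => tlift id (@gone K G G) v = 0)).
- by rewrite (rhom0 (tlift_ringhom ri r1 e)).
- by move=> u v; rewrite (rhomD (tlift_ringhom ri r1 e)) => -> ->; rewrite addr0.
- by move=> u v Jv; rewrite (tlift_pure ri r1 e) /gone /= e0 // rmorph0 mulr0.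
Qed.

End Stabilizer.

(** * Simplicity of the torsor *)

Section Descent.
Variables (F : diffField) (G : algGroup (const F)) (S : gAlg (kappaF F) G).
Hypothesis tS : diff_torsor S.
Variables (I : Type) (i0 : I) (Fi : I -> diffField) (phi : forall i, diffHom F (Fi i)).
Variable R : forall i, diffAlg (Fi i).
Hypothesis R_simple : forall i, diff_simple (R i).
Hypothesis R_const : forall i (x : R i), ader (R i) x = 0 ->
  exists c : const (Fi i), x = astr (R i) (const_inj (Fi i) c).
Definition overF i : alg F := Alg (astr (R i) \o phi i).
Variable y : forall i, S -> overF i.
Hypothesis y_alghom : forall i, alghom (y i).
Hypothesis y_der : forall i s, y i (ader S s) = ader (R i) (y i s).
(** What the inverse limit provides: the y_i have one common kernel, and ratios constant in every
    R_i come from one constant of F. *)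
Hypothesis y_connect : forall i j s, y i s = 0 -> y j s = 0.
Hypothesis y_glue : forall (c : forall i, const (Fi i)) (u w : S),
  (forall i, y i u <> 0) ->
  (forall i, y i w = astr (R i) (const_inj (Fi i) (c i)) * y i u) ->
  exists c0 : const F, forall i, y i w = y i (astr S (const_inj F c0)) * y i u.

Let yR i : ringhom (y i). Proof. exact: alghom_ringhom (y_alghom i). Qed.
Let y_str i c : y i (astr S c) = astr (overF i) c.
Proof. by case: (y_alghom i). Qed.

Variable H : I -> closedSubgroup G.
Hypothesis H_gen : generated_by H.

Definition dextF i (A : alg (const (Fi i))) : alg F := Alg (astr (dext (R i) A) \o phi i).
Definition dinl i (A : alg (const (Fi i))) : overF i -> dextF A :=
  tinl (astr (R i) \o const_inj (Fi i)) (astr A).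
Definition dinr i (A : alg (const (Fi i))) : A -> dextF A :=
  tinr (astr (R i) \o const_inj (Fi i)) (astr A).

(* The point y_i is H_i-equivariant, for the action of H_i on Spec R_i by the *)
(* automorphisms theta of R_i (x) A.                                          *)
Hypothesis y_equiv : forall i (A : alg (const (Fi i))) (h : H i -> A),
  @alghom (const F) (H i) (restr (const_map (phi i)) A) h ->
  exists2 theta : overF i -> dextF A, alghom theta
    & forall s, theta (y i s) = act (@dinl i A \o y i) (@dinr i A \o (h \o sgmap (H i))) s.

Notation SG := (stens (kappaF F) G S).
Notation RG i := (stens (kappaF F) G (overF i)).
Notation kS := (astr S \o kstr (kappaF F)).
Notation kR i := (astr (overF i) \o kstr (kappaF F)).

Definition yG i : SG -> RG i := tmap (y i) id.

Lemma yG_hom i : [/\ ringhom (@yG i),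
   forall a, yG i (tinl kS (astr G) a) = tinl (kR i) (astr G) (y i a)
  & forall b, yG i (tinr kS (astr G) b) = tinr (kR i) (astr G) b].
Proof. by apply: tmap_idr => // c; rewrite /= y_str. Qed.

Definition dSG : SG -> SG := tder (ader S) (fun=> 0).
Definition dRG i : RG i -> RG i := tder (ader (R i)) (fun=> 0).

Let kS_const c : ader S (kS c) = kS ((fun=> 0) c).
Proof. by rewrite /= ader_str (kstrP (kappaF F)) !rmorph0. Qed.
Let kR_const i c : ader (R i) (kR i c) = kR i ((fun=> 0) c).
Proof. by rewrite /= ader_str -dhomP (const_injP c) !rmorph0. Qed.
Let kG_const c : (fun _ : G => 0) (astr G c) = astr G ((fun=> 0) c).
Proof. by rewrite rmorph0. Qed.

Lemma dSG_der : derivation dSG.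
Proof. exact: tder_derivation (ader_derivation S) (derivation_cst0 G) kS_const kG_const. Qed.
Lemma dRG_der i : derivation (@dRG i).
Proof.
exact: tder_derivation (ader_derivation (R i)) (derivation_cst0 G) (@kR_const i) kG_const.
Qed.

Lemma dSG_tinl a : dSG (tinl kS (astr G) a) = tinl kS (astr G) (ader S a).
Proof. exact: (tder_tinl (ader_derivation S) (derivation_cst0 G) kS_const kG_const). Qed.
Lemma dSG_tinr f : dSG (tinr kS (astr G) f) = 0.
Proof.
rewrite -(rmorph0 (tinr kS (astr G))).
exact: (tder_tinr (ader_derivation S) (derivation_cst0 G) kS_const kG_const).
Qed.
Lemma dRG_tinl i a : dRG (tinl (kR i) (astr G) a) = tinl (kR i) (astr G) (ader (R i) a).
Proof. exact: (tder_tinl (ader_derivation (R i)) (derivation_cst0 G) (@kR_const i) kG_const). Qed.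
Lemma dRG_tinr i f : dRG (tinr (kR i) (astr G) f) = 0.
Proof.
rewrite -(rmorph0 (tinr (kR i) (astr G))).
exact: (tder_tinr (ader_derivation (R i)) (derivation_cst0 G) (@kR_const i) kG_const).
Qed.

Lemma yG_der i v : yG i (dSG v) = dRG (yG i v).
Proof.
have [rh rl rr] := yG_hom i.
apply: (tensor_der_ext rh); [exact: dSG_der|exact: dRG_der| |] => a.
  by rewrite dSG_tinl !rl dRG_tinl y_der.
by rewrite dSG_tinr rr dRG_tinr (rhom0 rh).
Qed.

Notation rh := (@rho (const F) F (kappaF F) G S).

Lemma rho_der s : rh (ader S s) = dSG (rh s).
Proof.
have [_ hd] := tS.
have h := act_der (sinr_gpoint (kappaF F) G S) (sinl_alghom (kappaF F) G S) hd dSG_der.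
apply: h => [c|a|f].
- by rewrite [LHS]dSG_tinl ader_str.
- by rewrite [RHS]dSG_tinl.
- by rewrite [LHS]dSG_tinr.
Qed.

Section DifferentialIdeal.
Variable Id : S -> Prop.
Hypothesis Id_ideal : is_dideal Id.

(* The ideal of R_i (x) K[G] that corresponds to R_i (x) Id under the torsor  *)
(* isomorphism R_i (x) S = R_i (x) K[G].                                      *)
Definition lift_ideal i (v : RG i) : Prop := forall P : RG i -> Prop,
  P 0 -> (forall a b, P a -> P b -> P (a + b)) -> (forall a b, P b -> P (a * b)) ->
  (forall s, Id s -> P (yG i (rh s))) -> P v.
Arguments lift_ideal : clear implicits.

Lemma lift_ideal0 i : lift_ideal i 0. Proof. by move=> P. Qed.
Lemma lift_idealD i a b : lift_ideal i a -> lift_ideal i b -> lift_ideal i (a + b).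
Proof. by move=> ha hb P P0 PD PM Pg; apply: (PD); [apply: ha | apply: hb]. Qed.
Lemma lift_idealM i a b : lift_ideal i b -> lift_ideal i (a * b).
Proof. by move=> hb P P0 PD PM Pg; apply: (PM); apply: hb. Qed.
Lemma lift_ideal_rho i s : Id s -> lift_ideal i (yG i (rh s)).
Proof. by move=> hs P _ _ _; apply. Qed.
Lemma lift_idealB i a b : lift_ideal i a -> lift_ideal i b -> lift_ideal i (a - b).
Proof. by move=> ha hb; rewrite -mulN1r; apply: lift_idealD => //; apply: lift_idealM. Qed.

Lemma lift_ideal_der i v : lift_ideal i v -> lift_ideal i (dRG v).
Proof.
have [dD dM] := dRG_der i; have d0 := derivation0 (dRG_der i).
move=> hv; suff [] : lift_ideal i v /\ lift_ideal i (dRG v) by [].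
apply: (hv (fun v => lift_ideal i v /\ lift_ideal i (dRG v))).
- by rewrite d0; split; exact: lift_ideal0.
- by move=> a b [ha ha'] [hb hb']; rewrite dD; split; exact: lift_idealD.
- by move=> a b [hb hb']; rewrite dM; split; [|apply: lift_idealD]; exact: lift_idealM.
- move=> s hs; rewrite -yG_der -rho_der; split; apply: lift_ideal_rho => //.
  by case: Id_ideal => _ _ _; apply.
Qed.

(** The ideal J over the constants: what the lifted ideals over all the R_i have in common inside
    K[G]. *)
Definition group_ideal (f : G) : Prop := forall i, lift_ideal i (tinr (kR i) (astr G) f).

Lemma group_idealM a f : group_ideal f -> group_ideal (a * f).
Proof. by move=> hf i; rewrite rmorphM; apply: lift_idealM. Qed.

Lemma group_ideal_subspace : subspace group_ideal.
Proof.
split=> [i|u v hu hv i|c v]; last exact: group_idealM.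
  by rewrite rmorph0; exact: lift_ideal0.
by rewrite rmorphD; apply: lift_idealD.
Qed.

Variable C : coordinates group_ideal.

Lemma spanned_lift_ideal i v : spanned group_ideal v -> lift_ideal i v.
Proof.
move=> h; apply: h => [|a b|a f hf]; [exact: lift_ideal0 | exact: lift_idealD |].
by rewrite -tinlr; apply: lift_idealM; apply: hf.
Qed.

Lemma yG_spanned i v : spanned group_ideal v -> spanned group_ideal (yG i v).
Proof.
have [rhm rl rr] := yG_hom i.
move=> h; apply: (h (fun v => spanned group_ideal (yG i v))) => [|a b ha hb|a f hf].
- by rewrite (rhom0 rhm); exact: spanned0.
- by rewrite (rhomD rhm); exact: spannedD.
- by rewrite -tinlr (rhomM rhm) rl rr tinlr; exact: spanned_pure.
Qed.

Lemma coT_yG i t v : coT C t (yG i v) = y i (coT C t v).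
Proof. by apply: coT_tmap => // c; rewrite /= y_str. Qed.

(** The [r] with r (x) f in the lifted ideal form a differential ideal of the simple ring R_i, so
    one nonzero [r] yields r = 1. *)
Lemma lift_ideal_const i r f : lift_ideal i (tpure (kR i) (astr G) r f) -> r <> 0 ->
  lift_ideal i (tinr (kR i) (astr G) f).
Proof.
move=> hr r0; have [_ /(_ (fun r => lift_ideal i (tpure (kR i) (astr G) r f)))] := R_simple i.
case=> [|/(_ r hr)//|]; last exact.
split=> [|a b|a b|a].
- by rewrite tpure0l; exact: lift_ideal0.
- by rewrite tpureDl; exact: lift_idealD.
- by rewrite -tinl_pure; exact: lift_idealM.
- have [dD dM] := dRG_der i.
  by move=> /lift_ideal_der; rewrite -tinlr dM dRG_tinl dRG_tinr mulr0 addr0 tinlr.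
Qed.

(* A vector that y maps into all the ideals lift_ideal, of minimal support    *)
(* for the coordinates modulo group_ideal, has constant ratios of             *)
(* coordinates: otherwise v_t0 dv - d(v_t0) v would have a smaller support.   *)
Lemma coT_descent v : (forall i, lift_ideal i (yG i v)) -> forall t i, y i (coT C t v) = 0.
Proof.
(* Induction on a bound for the length of a list outside which all coordinates die under the y_i. *)
suff main n : forall v s, (forall i, lift_ideal i (yG i v)) -> (size s <= n)%N ->
    (forall t, t \notin s -> forall i, y i (coT C t v) = 0) ->
    forall t i, y i (coT C t v) = 0.
  move=> hv; have [s [_ s0 _]] := coT_supp C v.
  by apply: (main (size s) v s) => // t /s0 -> i; rewrite (rhom0 (yR i)).
elim: n => [|n IH] {}v s hv; first by case: s => // _ h t; apply: h.
case: s => [|t0 s] sn h; first exact: (IH v [::]).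
have [z0|nz0] := pselect (y i0 (coT C t0 v) = 0).
  apply: (IH v s) => // t ts i.
  have [->|tt0] := eqVneq t t0; first exact: (@y_connect i0).
  by apply: h; rewrite inE negb_or tt0.
have nz i : y i (coT C t0 v) <> 0 by move=> /(@y_connect _ i0).
have [dD dM] := ader_derivation S.
pose v' : SG := tinl kS (astr G) (coT C t0 v) * dSG v
         - tinl kS (astr G) (ader S (coT C t0 v)) * v.
have v'E t : coT C t v' = coT C t0 v * ader S (coT C t v) - ader S (coT C t0 v) * coT C t v.
  rewrite coTB !coTZ (@coT_der _ _ _ C _ kS t _ v (ader_derivation S)) // => c.
  by rewrite kS_const rmorph0.
have v'0 t i : y i (coT C t v') = 0.
  apply: (IH v' s) => // [j|u us j].
    have [rhm rl rr] := yG_hom j.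
    rewrite (rhomB rhm) !(rhomM rhm) yG_der.
    by apply: lift_idealB; apply: lift_idealM => //; apply: lift_ideal_der.
  rewrite v'E (rhomB (yR j)) !(rhomM (yR j)).
  have [->|ut0] := eqVneq u t0; first by rewrite mulrC subrr.
  have z : y j (coT C u v) = 0 by apply: h; rewrite inE negb_or ut0.
  have dz : y j (ader S (coT C u v)) = 0.
    by rewrite y_der z; exact: derivation0 (ader_derivation (R j)).
  by rewrite z dz !mulr0 subrr.
have frac t : exists c : const F, forall i,
    y i (coT C t v) = y i (astr S (const_inj F c)) * y i (coT C t0 v).
  have ex i : exists c : const (Fi i), y i (coT C t v) =
      astr (R i) (const_inj (Fi i) c) * y i (coT C t0 v).
    apply: (const_fraction (R_simple i) (@R_const i) (nz i)).
    have := v'0 t i; rewrite v'E (rhomB (yR i)) !(rhomM (yR i)) !y_der.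
    by move/eqP; rewrite subr_eq0 => /eqP.
  exact: (y_glue nz (fun i => projT2 (cid (ex i)))).
have /choice[c hc] := frac.
have [s1 [us1 s10 sp1]] := coT_supp C v.
pose f := \sum_(t <- s1) astr G (c t) * t.
(* The coordinates being constant multiples of the one at [t0], the image of [v] is y(v_t0) (x) f up
   to the span of J; so [f] lies in every lifted ideal, that is, in J. *)
have spf i : spanned group_ideal (yG i v - tpure (kR i) (astr G) (y i (coT C t0 v)) f).
  have [rhm rl rr] := yG_hom i.
  have := @yG_spanned i _ sp1; rewrite (rhomB rhm) (rhom_sum rhm).
  congr (spanned group_ideal (_ - _)); rewrite tpure_sumr; apply: eq_bigr => t _.
  rewrite -tinlr (rhomM rhm) rl rr tinlr hc mulrC y_str.
  exact: (tpureZ (kR i) (astr G) (c t)).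
have Jf : group_ideal f.
  move=> i; apply: lift_ideal_const (nz i).
  have := lift_idealB (hv i) (@spanned_lift_ideal i _ (spf i)).
  by rewrite opprB addrC subrK.
move=> t i; rewrite -coT_yG; apply: coT_spanned.
have := spannedD (spf i) (@spanned_pure _ G group_ideal _ (kR i) (y i (coT C t0 v)) f Jf).
by rewrite subrK.
Qed.

(** Descent makes the generators of each lifted ideal combinations of J, so all these ideals come
    from J. *)
Lemma rho_spanned i s : Id s -> spanned group_ideal (yG i (rh s)).
Proof.
move=> hs; apply/(spannedP C) => t; rewrite coT_yG; apply: coT_descent => j.
exact: lift_ideal_rho.
Qed.

Lemma spair_yG i (T : alg F) (x : overF i -> T) (g : G -> T) v :
  alghom x -> gpoint (kappaF F) g -> spair x g (yG i v) = spair (x \o y i) g v.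
Proof.
move=> hx hg; have [rhm rl rr] := yG_hom i.
have hxy := alghom_comp (y_alghom i) hx.
have hp := spair_ringhom hx hg; have hp' := spair_ringhom hxy hg.
apply: (tensor_hom_ext (ringhom_comp rhm hp) hp') => [a|f] /=.
  by rewrite rl [LHS](spair_sinl hx hg) [RHS](spair_sinl hxy hg).
by rewrite rr [LHS](spair_sinr hx hg) [RHS](spair_sinr hxy hg).
Qed.

(* R_i (x)_F S, whose two tautological points differ by a point of G *)
Definition RS i : alg F := Alg (tinl (astr (overF i)) (astr S) \o astr (overF i)).

(** The torsor property yields the point of G that moves y_i to the tautological point of S; pairing
    with it gives the trivialisation R_i (x)_K K[G] -> R_i (x)_F S. *)
Lemma RS_point i : exists2 h : RG i -> RS i, ringhom h
  & forall s, h (yG i (rh s)) = tinr (astr (overF i)) (astr S) s.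
Proof.
have [[_ [_ _ tors]] _] := tS.
pose l : overF i -> RS i := tinl (astr (overF i)) (astr S).
pose r : S -> RS i := tinr (astr (overF i)) (astr S).
have hl : alghom l by have [hz hm] := tinl_ringhom (astr (overF i)) (astr S).
have hr : alghom r.
  have [hz hm] := tinr_ringhom (astr (overF i)) (astr S).
  by split=> // c; rewrite /r -tinl_tinr.
have [g [hg ag _]] := tors (RS i) (l \o y i) r (alghom_comp (y_alghom i) hl) hr.
exists (spair l g : RG i -> RS i); first exact: spair_ringhom.
move=> s; rewrite -[RHS]ag -(spair_rho s (alghom_comp (y_alghom i) hl) hg).
exact: spair_yG.
Qed.

(** The trivialisation carries the lifted ideal into R_i (x) Id. If that contains 1, all coordinates
    of 1 modulo [Id] vanish. *)
Lemma group_ideal_proper : ~ Id 1 -> ~ group_ideal 1.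
Proof.
move=> nId J1; apply: nId; have [Id0 IdD IdM _] := Id_ideal.
have sId : @subspace F S Id by split=> // c v; exact: IdM.
have [D] := coordinates_exist sId.
have [h hh hrho] := RS_point i0.
have h1 : @spanned F S Id _ (astr (overF i0)) (h 1).
  have := J1 i0; rewrite rmorph1 => j1.
  apply: (j1 (fun v => @spanned F S Id _ (astr (overF i0)) (h v))) => [|a b ha hb|a b hb|s hs].
  - by rewrite (rhom0 hh); exact: spanned0.
  - by rewrite (rhomD hh); exact: spannedD.
  - by rewrite (rhomM hh); apply: spannedM.
  - by rewrite hrho; apply: spanned_pure.
apply: (co_inj (C := D)) => t; have := coT_spanned D t h1.
rewrite (rhom1 hh) -(rmorph1 (tinr (astr (overF i0)) (astr S))) coT_tinr.
have [-> //|c0] := eqVneq (D t 1) 0.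
move=> fc0; have [[]] := R_simple i0.
rewrite -(rmorph1 (astr (overF i0))) -(mulVf c0) rmorphM fc0.
exact: mulr0.
Qed.

Lemma group_ideal_null_ideal : (forall f, group_ideal f -> f = 0) -> forall s, Id s -> s = 0.
Proof.
move=> J0 s hs; have [h hh hrho] := RS_point i0.
have e : yG i0 (rh s) = 0.
  have h0 := @rho_spanned i0 s hs.
  apply: (h0 (fun v => v = 0)) => // [u v -> ->|a v /J0 ->]; first by rewrite addr0.
  by rewrite tpure0r.
apply: (@tinr_inj F S _ (astr (overF i0))); first by have [] := R_simple i0.
by rewrite -hrho e (rhom0 hh).
Qed.

(** The points (theta, k^-1 g) and (iota, g) both give y_i.g, so [p] and [q] agree on the image of
    rho(Id), which [rho_spanned] puts in the span of J. Hence [p] sends the whole lifted ideal into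
    the span of J, and on elements of J it is translation by k^-1. *)
Lemma stab_step i (T : alg F) (iota theta : overF i -> T) (k : G -> T) :
  alghom iota -> alghom theta -> gpoint (kappaF F) k ->
  (forall s, theta (y i s) = act (iota \o y i) k s) ->
  stab group_ideal (T := restr (kstr (kappaF F)) T) (ginv k).
Proof.
move=> hi ht hk tk f Jf; have [[[_ _ actM] _] _] := tS.
pose l := @sinl (const F) F (kappaF F) G T.
pose r := @sinr (const F) F (kappaF F) G T.
have hl : alghom l := sinl_alghom (kappaF F) G T.
have hr : gpoint (kappaF F) r := sinr_gpoint (kappaF F) G T.
have hlk := gpoint_comp hk hl.
have hlV : gpoint (kappaF F) (l \o ginv k).
  exact: (gpoint_comp (ginv_alghom hk : gpoint (kappaF F) (ginv k)) hl).
pose w : G -> stens (kappaF F) G T := gmul (l \o ginv k) r.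
have hw : gpoint (kappaF F) w := gmul_alghom hlV hr.
have hlt := alghom_comp ht hl; have hli := alghom_comp hi hl.
have hliy := alghom_comp (y_alghom i) hli.
pose p : RG i -> stens (kappaF F) G T := spair (l \o theta) w.
pose q : RG i -> stens (kappaF F) G T := spair (l \o iota) r.
have hp : ringhom p by exact: spair_ringhom.
have pq s : p (yG i (rh s)) = q (yG i (rh s)).
  rewrite /p /q !spair_yG //.
  rewrite (spair_rho s (alghom_comp (y_alghom i) hlt) hw) (spair_rho s hliy hr).
  have -> : (l \o theta) \o y i = act ((l \o iota) \o y i) (l \o k).
    apply/funext => u /=; rewrite tk.
    exact/esym/(act_comp u (alghom_comp (y_alghom i) hi) hk hl).
  rewrite -actM //.
  have -> // : gmul (l \o k) w = r.
  rewrite /w (gmulgA hlk hlV hr) (gmulxV hlk).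
  exact: (gmul1x hr).
have hq v : spanned group_ideal v -> spanned group_ideal (q v).
  have hqr : ringhom q := spair_ringhom hli hr.
  move=> h; apply: (h (fun v => spanned group_ideal (q v))) => [|a b ha hb|a u Ju].
  - by rewrite (rhom0 hqr); exact: spanned0.
  - by rewrite (rhomD hqr); exact: spannedD.
  - rewrite -tinlr (rhomM hqr).
    have -> : q (tinl (kR i) (astr G) a) = l (iota a) := spair_sinl hli hr a.
    have -> : q (tinr (kR i) (astr G) u) = r u := spair_sinr hli hr u.
    rewrite [l _ * _]tinlr.
    exact: spanned_pure.
have -> : trans (T := restr (kstr (kappaF F)) T) (ginv k) f = p (tinr (kR i) (astr G) f).
  by rewrite [RHS](spair_sinr hlt hw).
apply: (Jf i (fun v => spanned group_ideal (p v))) => [|a b ha hb|a b hb|s hs].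
- by rewrite (rhom0 hp); exact: spanned0.
- by rewrite (rhomD hp); exact: spannedD.
- by rewrite (rhomM hp); apply: spannedM => //; exact: group_idealM.
- by rewrite pq; apply: hq; exact: rho_spanned.
Qed.

Lemma dinl_alghom i (A : alg (const (Fi i))) : alghom (@dinl i A).
Proof.
by have [hz hm] := tinl_ringhom (astr (R i) \o const_inj (Fi i)) (astr A).
Qed.

Lemma stab_inj (T T' : alg (const F)) (u : T -> T') (x : G -> T) : alghom u -> alghom x ->
  (forall a, u a = 0 -> a = 0) -> stab group_ideal (u \o x) -> stab group_ideal x.
Proof.
move=> hu hx u0 s f Jf; apply/(spannedP C) => t; apply: u0.
rewrite -coT_trans //; exact: (coT_spanned C t (s f Jf)).
Qed.

(** [stab_step] is applied to the universal point of H_i over A = K_i (x)_K K[H_i] and to its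
    inverse; the result descends along the injection of K[H_i] into R_i (x) A. *)
Lemma H_stab i : stab group_ideal (T := Alg (astr (H i))) (@sgmap _ _ (H i))
  /\ stab group_ideal (T := Alg (astr (H i))) (ginv (@sgmap _ _ (H i))).
Proof.
pose Hi : alg (const F) := Alg (astr (H i)).
pose m : G -> Hi := @sgmap _ _ (H i).
have hm : alghom m := sgmap_alghom (H i).
pose A : alg (const (Fi i)) := Alg (tinl (const_map (phi i)) (astr (H i))).
pose v : Hi -> A := tinr (const_map (phi i)) (astr (H i)).
have hv : @alghom (const F) Hi (restr (const_map (phi i)) A) v.
  have [z1 z2] := tinr_ringhom (const_map (phi i)) (astr (H i)).
  by split=> // c; rewrite /v -tinl_tinr.
pose u : Hi -> dextF A := @dinr i A \o v.
have hu : @alghom (const F) Hi (restr (kstr (kappaF F)) (dextF A)) u.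
  have hdr := tinr_ringhom (astr (R i) \o const_inj (Fi i)) (astr A).
  have [z1 z2] := ringhom_comp (alghom_ringhom hv) hdr.
  split=> // c; have [_ _ /= vc] := hv; rewrite /u /= vc.
  rewrite /dinr; have := tinl_tinr (astr (R i) \o const_inj (Fi i)) (astr A) (const_map (phi i) c).
  by move=> /= <-.
have u0 a : u a = 0 -> a = 0.
  move=> /(@tinr_inj _ A) h; apply: (@tinr_inj _ (H i) _ (const_map (phi i))).
    by move/eqP; rewrite oner_eq0.
  by apply: h; have [] := R_simple i.
have inv_m : ginv m = antipode (H i) \o m := ginv_sgmap (H i).
have hk (x : G -> Hi) : alghom x ->
    @gpoint (const F) F (kappaF F) G (dextF A) (u \o x) by move=> hx; exact: pt_comp_alghom.
have key (x : Hi -> Hi) : alghom x -> stab group_ideal (T := Hi) (ginv (x \o m)).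
  move=> hx.
  have [theta ht et] := @y_equiv i A (v \o x) (pt_comp_alghom hv hx).
  have := stab_step (dinl_alghom A) ht (hk _ (pt_comp_alghom hx hm)) et.
  apply: (stab_inj (T' := restr (kstr (kappaF F)) (dextF A)) hu) => //.
  exact: ginv_alghom (pt_comp_alghom hx hm).
split; last exact: (key id (id_alghom Hi)).
have := key (antipode (H i)) (antipodeP (H i)).
by rewrite -[X in ginv X]inv_m ginvK.
Qed.

Lemma dideal_trivial : ~ Id 1 -> forall s, Id s -> s = 0.
Proof.
move=> nId1; apply: group_ideal_null_ideal.
by apply: (stable_ideal_trivial C group_idealM H_gen H_stab group_ideal_subspace); exact: group_ideal_proper.
Qed.

End DifferentialIdeal.

Theorem torsor_simple : diff_simple S.
Proof.
have [[_ [S1 _ _]] _] := tS; split=> // Id hId; have [Id0 _ IdM _] := hId.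
have [Id1|nId1] := pselect (Id 1).
  by right=> x; rewrite -[x]mulr1; exact: IdM.
left; have [C] := coordinates_exist (group_ideal_subspace Id).
exact: (dideal_trivial hId C nId1).
Qed.

(** The constants y_i(s) glue to some c0 in C_F, and s - c0 lies in the common kernel of the y_i, a
    differential ideal of the simple ring S that does not contain 1. *)
Theorem torsor_const (s : S) : ader S s = 0 ->
  exists c : const F, s = astr S (const_inj F c).
Proof.
move=> ds; have [dD dM] := ader_derivation S; have [S1 simple] := torsor_simple.
have ex i : exists c, y i s = astr (R i) (const_inj (Fi i) c).
  by apply: R_const; rewrite -y_der ds; exact: (rhom0 (yR i)).
have [||c0 hc0] := @y_glue (fun i => projT1 (cid (ex i))) 1 s.
- by move=> i; rewrite (rhom1 (yR i)); have [] := R_simple i.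
- by move=> i; rewrite (rhom1 (yR i)) mulr1; exact: (projT2 (cid (ex i))).
exists c0; apply/eqP; rewrite -subr_eq0; apply/eqP.
have [|h|/(_ 1 i0)] := simple (fun s => forall i, y i s = 0).
- split=> [i|u v hu hv i|u v hv i|u hu i].
  + exact: (rhom0 (yR i)).
  + by rewrite (rhomD (yR i)) hu hv addr0.
  + by rewrite (rhomM (yR i)) hv mulr0.
  + by rewrite y_der hu; exact: derivation0 (ader_derivation (R i)).
- by apply: h => i; rewrite (rhomB (yR i)) hc0 (rhom1 (yR i)) mulr1 subrr.
- by rewrite (rhom1 (yR i0)) => h; have [] := R_simple i0.
Qed.

End Descent.

(** * Fundamental matrices *)

Section MatrixDerivation.
Variables (R : comPzRingType) (d : R -> R).
Hypothesis dd : derivation d.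

Lemma der_sum I (r : seq I) (E : I -> R) : d (\sum_(i <- r) E i) = \sum_(i <- r) d (E i).
Proof.
have [dD _] := dd; elim: r => [|i r IH]; first by rewrite !big_nil derivation0.
by rewrite !big_cons dD IH.
Qed.

Lemma der_mulmx m n p (A : 'M[R]_(m, n)) (B : 'M[R]_(n, p)) :
  map_mx d (A *m B) = map_mx d A *m B + A *m map_mx d B.
Proof.
have [_ dM] := dd; apply/matrixP => i j; rewrite !mxE der_sum -big_split.
by apply: eq_bigr => k _; rewrite dM !mxE.
Qed.

Lemma der_scalar_mx n (x : R) : map_mx d x%:M = (d x)%:M :> 'M_n.
Proof.
apply/matrixP => i j; rewrite !mxE; case: (i == j); rewrite ?mulr1n ?mulr0n //.
exact: derivation0.
Qed.

End MatrixDerivation.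

Section PicardVessiotStructure.
Variables (F : diffField) (G : algGroup (const F)) (S : gAlg (kappaF F) G).
Hypothesis tS : diff_torsor S.
Hypothesis S_simple : diff_simple S.
Hypothesis S_const : forall s : S, ader S s = 0 ->
  exists c : const F, s = astr S (const_inj F c).
Variable C : coordinates (@null G).

Notation d := (ader S).
Notation kS := (astr S \o kstr (kappaF F)).
Notation rh := (@rho (const F) F (kappaF F) G S).

Let S1 : (1 : S) <> 0. Proof. by have [] := S_simple. Qed.

Lemma rho_alghom : alghom rh.
Proof.
have [[[h _ _] _] _] := tS.
by have := act_alghom (sinr_gpoint (kappaF F) G S) (sinl_alghom (kappaF F) G S) h.
Qed.

Let rh_ring := alghom_ringhom rho_alghom.

(** The coefficient of rho(s) at [t] for a K-basis of K[G]: an F-linear operator on S that commutes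
    with the derivation. *)
Definition rho_coef (t : G) (s : S) : S := coT C t (rh s).

Lemma rho_coefZ t c x : rho_coef t (astr S c * x) = astr S c * rho_coef t x.
Proof.
rewrite /rho_coef (rhomM rh_ring); have [_ _ ->] := rho_alghom.
exact: coTZ.
Qed.

Lemma rho_coef_sum t I (r : seq I) (E : I -> S) :
  rho_coef t (\sum_(i <- r) E i) = \sum_(i <- r) rho_coef t (E i).
Proof. by rewrite /rho_coef (rhom_sum rh_ring) coT_sum. Qed.

Lemma rho_coef_der t x : rho_coef t (d x) = d (rho_coef t x).
Proof.
rewrite /rho_coef rho_der // (@coT_der _ _ _ C _ kS t _ (rh x) (ader_derivation S)) // => c.
by rewrite /= ader_str (kstrP (kappaF F)) rmorph0.
Qed.

Lemma self_tens_point : exists2 h : stens (kappaF F) G S -> tensor (astr S) (astr S), ringhom h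
  & (forall a, h (tinl kS (astr G) a) = tinl (astr S) (astr S) a) /\
    forall s, h (rh s) = tinr (astr S) (astr S) s.
Proof.
have [[_ [_ _ tors]] _] := tS.
pose T : alg F := Alg (tinl (astr S) (astr S) \o astr S).
pose l : S -> T := tinl (astr S) (astr S).
pose r : S -> T := tinr (astr S) (astr S).
have hl : alghom l by have [hz hm] := tinl_ringhom (astr S) (astr S).
have hr : alghom r.
  have [hz hm] := tinr_ringhom (astr S) (astr S).
  by split=> // c; rewrite /r -tinl_tinr.
have [g [hg ag _]] := tors T l r hl hr.
exists (spair l g : stens (kappaF F) G S -> T); first exact: (spair_ringhom hl hg).
split=> [a|s]; first exact: (spair_sinl hl hg).
by rewrite -[RHS]ag -(spair_rho s hl hg).
Qed.

(* The coefficients a_i move from S to F because sum a_i rho(u_i) corresponds *)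
(* to sum a_i (x) u_i in S (x)_F S.                                           *)
Lemma rho_dependence n (a u : 'I_n -> S) i0 :
  (forall t, \sum_i a i * rho_coef t (u i) = 0) -> a i0 <> 0 ->
  exists2 l : 'I_n -> F, l i0 <> 0 & \sum_i astr S (l i) * u i = 0.
Proof.
move=> h a0; have [hh hr [hl hrho]] := self_tens_point.
have e : \sum_i tinl kS (astr G) (a i) * rh (u i) = 0.
  apply: (@coT_inj (const F) G _ kS C) => t; rewrite coT_sum -[RHS](h t).
  by apply: eq_bigr => i _; rewrite coTZ.
have {}e : \sum_i tpure (astr S) (astr S) (a i) (u i) = 0.
  rewrite -[RHS](rhom0 hr) -e (rhom_sum hr); apply: eq_bigr => i _.
  by rewrite (rhomM hr) hl hrho tinlr.
have [B] := basis_exist S.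
have [t0 Bt] : exists t, B t (a i0) <> 0.
  apply: contrapT => nex; apply: a0; apply: (co_inj (C := B)) => t.
  by apply: contrapT => nt; apply: nex; exists t.
exists (fun i => B t0 (a i)) => //.
have bal : balanced (astr S) (astr S) (fun x y => astr S (B t0 x) * y).
  split=> [x x' y|x y y'|c x y].
  - by rewrite coD rmorphD mulrDl.
  - exact: mulrDr.
  - by rewrite mulrC [x * _]mulrC coZ rmorphM mulrCA mulrA [X in X = _]mulrC mulrA.
have tsum (I : Type) (r : seq I) (E : I -> tensor (astr S) (astr S)) :
    teval (fun x y => astr S (B t0 x) * y) (\sum_(i <- r) E i) =
    \sum_(i <- r) teval (fun x y => astr S (B t0 x) * y) (E i).
  elim: r => [|i r IH]; first by rewrite !big_nil; exact: teval_tzero.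
  by rewrite !big_cons (tevalD bal) IH.
rewrite -[RHS](teval_tzero bal) -[X in teval _ X]e tsum.
by apply: eq_bigr => i _; rewrite (tevalP bal).
Qed.

Variable supp : seq G.
(** An F-subspace of S, stable under the derivation and finite-dimensional by [span_maximal]. *)
Definition supported (s : S) : Prop := forall t, t \notin supp -> rho_coef t s = 0.

Definition coef_mx n (u : 'I_n -> S) (tt : 'I_n -> G) : 'M[S]_n :=
  \matrix_(j, k) rho_coef (tt k) (u j).

(** Rank is measured by nonvanishing minors, which avoids the fraction field of S. *)
Definition full_rank n : Prop := exists (u : 'I_n -> S) (tt : 'I_n -> G),
  (forall j, supported (u j)) /\ \det (coef_mx u tt) <> 0.

(** A nonzero minor has pairwise distinct columns, all indexed by [supp]. *)
Lemma full_rank_bound n : full_rank n -> (n <= size supp)%N.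
Proof.
move=> [u [tt [su dn0]]].
have tin k : tt k \in supp.
  apply/negP => nin; apply: dn0; rewrite (expand_det_col _ k) big1 // => j _.
  by rewrite mxE su ?mul0r //; apply/negP.
have tinj : injective tt.
  move=> j k e; apply: contrapT => jk; apply: dn0; rewrite -det_tr.
  apply: (determinant_alternate (i1 := j) (i2 := k)); first exact/eqP.
  by move=> l; rewrite !mxE e.
have uc : uniq (codom tt) by rewrite map_inj_uniq // enum_uniq.
have := uniq_leq_size uc (_ : {subset codom tt <= supp}).
by rewrite size_codom card_ord; apply=> _ /codomP[k ->].
Qed.

Lemma maximal_rank : exists n, full_rank n /\ forall m, full_rank m -> (m <= n)%N.
Proof.
have ex : exists n, `[< full_rank n >].
  (* The empty minor is 1, so rank 0 occurs. *)
  exists 0%N; apply/asboolP; exists (fun i => 0), (fun i => 0).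
  by split=> [[]//|]; rewrite det_mx00.
have bd n : `[< full_rank n >] -> (n <= size supp)%N by move=> /asboolP/full_rank_bound.
have [n /asboolP hn hm] := ex_maxnP ex bd.
by exists n; split=> // m hm'; apply: hm; apply/asboolP.
Qed.

(* The minors of size n+1 vanish. Expanding such a minor along the column of  *)
(* the coordinate t gives a relation between the coordinates at t whose       *)
(* coefficients do not depend on t.                                           *)
Lemma span_maximal n (u : 'I_n -> S) (tt : 'I_n -> G) :
  (forall j, supported (u j)) -> \det (coef_mx u tt) <> 0 ->
  (forall m, full_rank m -> (m <= n)%N) ->
  forall s, supported s -> exists l : 'I_n -> F, s = \sum_j astr S (l j) * u j.
Proof.
move=> su dn0 mx s ss.
pose u' (j : 'I_n.+1) : S := if unlift ord_max j is Some k then u k else s.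
pose tt' t (j : 'I_n.+1) : G := if unlift ord_max j is Some k then tt k else t.
have u'l j : u' (lift ord_max j) = u j by rewrite /u' liftK.
have u'm : u' ord_max = s by rewrite /u' unlift_none.
have det0 t : \det (coef_mx u' (tt' t)) = 0.
  apply: contrapT => dn; have : full_rank n.+1.
    exists u', (tt' t); split=> // j; rewrite /u'.
    by case: (unlift _ _) => [k|//]; exact: su.
  by move/mx; rewrite ltnn.
(* Cofactors along the last column ignore that column, so its index [0] is an arbitrary choice
   ([aE]). *)
pose a (j : 'I_n.+1) := cofactor (coef_mx u' (tt' 0)) j ord_max.
have aE t j : cofactor (coef_mx u' (tt' t)) j ord_max = a j.
  rewrite /a /cofactor; congr (_ * \det _); apply/matrixP => i k.
  by rewrite !mxE /tt' !liftK.
have am : a ord_max <> 0.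
  have -> : a ord_max = \det (coef_mx u tt); last by [].
  rewrite /a /cofactor /= addnn -mul2n exprM sqrrN !expr1n mul1r.
  by congr (\det _); apply/matrixP => i k; rewrite !mxE /tt' !liftK u'l.
have [t|l lm e] := @rho_dependence n.+1 a u' ord_max _ am.
  rewrite -[RHS](det0 t) (expand_det_col _ ord_max); apply: eq_bigr => j _.
  by rewrite aE mxE /tt' unlift_none mulrC.
exists (fun j => - (l ord_max)^-1 * l (lift ord_max j)).
have := congr1 (fun x => astr S (l ord_max)^-1 * x) e; rewrite mulr0.
rewrite (bigD1 ord_max) //= mulrDr mulrA -rmorphM mulVf ?rmorph1 ?mul1r; last exact/eqP.
rewrite u'm => /eqP; rewrite addr_eq0 => /eqP ->.
rewrite mulr_sumr -sumrN.
rewrite (reindex_omap (lift ord_max) (unlift ord_max)) /=; last first.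
  by move=> i; case: unliftP => [k -> _ //|->]; rewrite eqxx.
apply: eq_big => [j|j _]; first by rewrite liftK eqxx andbT eq_sym neq_lift.
by rewrite u'l mulNr rmorphN mulNr rmorphM mulrA.
Qed.

Hypothesis supp_gen : exists s : seq S,
  (forall x, x \in s -> supported x) /\ forall x, gen_by (fun a => a \in s) x.

(** Z holds the co-action coefficients of a family [u] spanning the supported elements. These are
    stable under [d], which commutes with [rho_coef], so dZ = A Z with A over F. The column U of the
    u_j satisfies the same equation, so Z^-1 U is constant, hence over F, and each u_j is an
    F-combination of entries of Z. *)
Lemma torsor_fundamental_matrix : exists (n : nat) (Z W : 'M[S]_n),
  [/\ Z *m W = 1%:M, W *m Z = 1%:M,
      exists A : 'M[F]_n, map_mx d Z *m W = map_mx (astr S) A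
    & forall x, gen_by (fun a => (exists i j, a = Z i j) \/ a = \det W) x].
Proof.
have [n [[u [tt [su dn0]]] mx]] := maximal_rank.
have sp := span_maximal su dn0 mx.
pose Z := coef_mx u tt.
have dsupp x : supported x -> supported (d x).
  by move=> sx t /sx h; rewrite rho_coef_der h; exact: derivation0 (ader_derivation S).
have /choice[A0 hA0] : forall j, exists l : 'I_n -> F, d (u j) = \sum_k astr S (l k) * u k.
  by move=> j; apply: sp; apply: dsupp.
pose A : 'M[F]_n := \matrix_(j, k) A0 j k.
pose AS := map_mx (astr S) A.
have dZ : map_mx d Z = AS *m Z.
  apply/matrixP => j k; rewrite !mxE -rho_coef_der hA0 rho_coef_sum.
  by apply: eq_bigr => l _; rewrite rho_coefZ !mxE.
have dS := ader_derivation S.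
(* The x such that x%:M is a left multiple of Z form a differential ideal,    *)
(* which contains det Z.                                                      *)
have [W WZ] : exists W : 'M[S]_n, W *m Z = 1%:M.
  have [_ /(_ (fun x => exists B : 'M[S]_n, B *m Z = x%:M))] := S_simple.
  case=> [|h|/(_ 1) //]; last first.
    by case: dn0; apply: h; exists (\adj Z); exact: mul_adj_mx.
  split.
  - by exists 0; rewrite mul0mx raddf0.
  - by move=> x y [B hB] [B' hB']; exists (B + B'); rewrite mulmxDl hB hB' raddfD.
  - move=> a x [B hB]; exists (a%:M *m B).
    by rewrite -mulmxA hB -scalar_mxM.
  - move=> x [B hB]; exists (map_mx d B + B *m AS).
    by rewrite mulmxDl -mulmxA -dZ -der_mulmx // hB der_scalar_mx.
have ZW := mulmx1C WZ.
exists n, Z, W; split=> //.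
  by exists A; rewrite dZ -mulmxA ZW mulmx1.
have dW : map_mx d W = - (W *m AS).
  have := der_mulmx dS W Z; rewrite WZ der_scalar_mx // derivation1 // raddf0 dZ.
  move/(congr1 (mulmx^~ W)); rewrite mul0mx mulmxDl -!mulmxA ZW !mulmx1 => /esym/eqP.
  by rewrite addr_eq0 => /eqP.
pose U : 'cV[S]_n := \col_j u j.
have dU : map_mx d U = AS *m U.
  by apply/matrixP => j k; rewrite !mxE hA0; apply: eq_bigr => l _; rewrite !mxE.
have dWU : map_mx d (W *m U) = 0.
  by rewrite der_mulmx // dW dU mulNmx mulmxA addNr.
have hk j : exists c : const F, (W *m U) j 0 = astr S (const_inj F c).
  by apply: S_const; have := congr1 (fun M : 'cV_n => M j 0) dWU; rewrite !mxE.
have Uk j : u j = \sum_k Z j k * (W *m U) k 0.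
  have : Z *m (W *m U) = U by rewrite mulmxA ZW mul1mx.
  by move=> /(congr1 (fun M : 'cV_n => M j 0)); rewrite [in LHS]mxE [in RHS]mxE => ->.
have [gs [gsu gsg]] := supp_gen.
move=> x P Pc PX PD PM; have P0 : P 0 by rewrite -(rmorph0 (astr S)); exact: Pc.
have := gsg x P Pc _ PD PM; apply=> a /gsu /sp[l ->].
apply: (big_ind P) => // j _; apply: (PM); first exact: Pc.
rewrite Uk; apply: (big_ind P) => // k _; apply: (PM).
  by apply: PX; left; exists j, k.
by have [c ->] := hk k; exact: Pc.
Qed.

End PicardVessiotStructure.

Theorem torsor_picard_vessiot (F : diffField) (G : algGroup (const F))
    (S : gAlg (kappaF F) G) : diff_torsor S -> diff_simple S ->
  (forall s : S, ader S s = 0 -> exists c : const F, s = astr S (const_inj F c)) ->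
  picard_vessiot S.
Proof.
move=> tS S_simple S_const; split=> //.
have [C] := basis_exist G.
have [[_ [_ [gs hgs] _]] _] := tS.
(* The co-action of each of the finitely many generators has finite support; [supp] collects these
   supports. *)
have [supp hsupp] : exists supp : seq G, forall x, x \in gs -> supported C supp x.
  elim: gs {hgs} => [|g gs [supp h]]; first by exists [::].
  have [s [_ s0 _]] := coT_supp C (rho g).
  exists (s ++ supp) => x; rewrite inE => /orP[/eqP ->|/h hx] t;
    rewrite mem_cat negb_or => /andP[ns nsupp]; first exact: s0.
  exact: hx.
by apply: (torsor_fundamental_matrix tS S_simple S_const (C := C) (supp := supp)); exists gs.
Qed.

(** * The Galois group *)

Section GaloisGroup.
Variables (F : diffField) (G : algGroup (const F)) (S : gAlg (kappaF F) G).
Hypothesis tS : diff_torsor S.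
Hypothesis S_const : forall s : S, ader S s = 0 ->
  exists c : const F, s = astr S (const_inj F c).

Notation kS := (astr S \o const_inj F).
Notation rh := (@rho (const F) F (kappaF F) G S).
Notation gpt := (gpoint (kappaF F)).
Notation apt A h := (@alghom (const F) G (restr (kappaF F) A) h).

Let S1 : (1 : S) <> 0. Proof. by have [_ []] := tS.1. Qed.

Let pt_unique (T : alg F) (x : S -> T) (g g' : G -> T) : alghom x -> gpt g -> gpt g' ->
  act x g =1 act x g' -> g = g'.
Proof.
move=> hx hg hg' e; have [[[ha _ _] [_ _ tors]] _] := tS.
have [k [_ _ uk]] := tors T x (act x g) hx (act_alghom hg hx ha).
by apply/funext => f; rewrite (uk g) // (uk g').
Qed.

Section SelfTensor.

Definition self_tens : diffAlg F := dtens S S.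
Let l : S -> self_tens := tinl (astr S) (astr S).
Let r : S -> self_tens := tinr (astr S) (astr S).
Let hl : alghom l. Proof. by have [hz hm] := tinl_ringhom (astr S) (astr S). Qed.
Let hr : alghom r.
Proof.
have [hz hm] := tinr_ringhom (astr S) (astr S).
by split=> // c; rewrite /r -tinl_tinr.
Qed.

(* Under S (x)_F S = S (x)_K K[G], the point that moves the first tautological *)
(* point to the second one is the inclusion of K[G], hence is constant.       *)
Lemma difference_point : exists gamma : G -> self_tens,
  [/\ gpt gamma, act l gamma =1 r & forall f, ader self_tens (gamma f) = 0].
Proof.
have [[_ [_ _ tors]] _] := tS.
have [g [hg ag _]] := tors self_tens l r hl hr; exists g; split=> // f.
pose SG := stens (kappaF F) G S.
have hsl : alghom (@sinl _ _ (kappaF F) G S) := sinl_alghom (kappaF F) G S.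
have hsr : gpt (@sinr _ _ (kappaF F) G S) := sinr_gpoint (kappaF F) G S.
have hrho := rho_alghom tS.
have e c : @sinl _ _ (kappaF F) G S (astr S c) = rh (astr S c).
  by have [_ _ ->] := hrho.
have rsl := alghom_ringhom hsl; have rrho := alghom_ringhom hrho.
pose beta : self_tens -> SG := tlift (@sinl _ _ (kappaF F) G S) rh.
have hb : ringhom beta by exact: tlift_ringhom.
have bl a : beta (l a) = sinl (kappaF F) G a := tlift_tinl rsl rrho e a.
have br a : beta (r a) = rh a := tlift_tinr rsl rrho e a.
have ab : alghom beta by have [hz hm] := hb; split=> // c; rewrite [LHS]bl.
pose b : SG -> self_tens := spair l g.
have rb : ringhom b := spair_ringhom hl hg.
have bK v : b (beta v) = v.
  apply: (tensor_hom_ext (ringhom_comp hb rb) (ringhom_id _)) => a /=.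
    by rewrite [beta _]bl [LHS](spair_sinl hl hg).
  by rewrite [beta _]br [LHS](spair_rho _ hl hg) ag.
have bg : beta \o g = @sinr _ _ (kappaF F) G S.
  apply: (pt_unique hsl _ hsr); first exact: gpoint_comp.
  move=> s; have -> : @sinl _ _ (kappaF F) G S = beta \o l.
    by apply/funext => a; rewrite /= bl.
  rewrite (act_comp s hl hg ab) ag br.
  by rewrite /rho; apply: eq_act => // a; rewrite /= bl.
have bd v : beta (ader self_tens v) = dSG (beta v).
  apply: (tensor_der_ext hb) => [||a|a].
  - exact: (ader_derivation self_tens).
  - exact: dSG_der.
  - rewrite [ader self_tens _](tder_tinl (ader_derivation S) (ader_derivation S) (ader_str S) (ader_str S)).
    by rewrite [LHS]bl [X in dSG X]bl [RHS]dSG_tinl.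
  - rewrite [ader self_tens _](tder_tinr (ader_derivation S) (ader_derivation S) (ader_str S) (ader_str S)).
    by rewrite [LHS]br [X in dSG X]br -rho_der.
rewrite -[LHS]bK bd.
have -> : beta (g f) = sinr (kappaF F) S f by rewrite -bg.
by rewrite [X in b X]dSG_tinr (rhom0 rb).
Qed.

(** The pair (x, z) is a differential map S (x)_F S -> T. It carries the constant [gamma] of
    [difference_point] to [g], by uniqueness of the point that moves [x] to [z]. *)
Lemma differential_points (T : diffAlg F) (x z : S -> T) (g : G -> T) :
  dalghom x -> dalghom z -> gpt g -> act x g =1 z -> forall f, ader T (g f) = 0.
Proof.
move=> [hx dx] [hz dz] hg ag f; have [gamma [hga aga dga]] := difference_point.
have e c : x (astr S c) = z (astr S c) by have [_ _ ->] := hx; have [_ _ ->] := hz.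
have rx := alghom_ringhom hx; have rz := alghom_ringhom hz.
pose m : self_tens -> T := tlift x z.
have hm : ringhom m by exact: tlift_ringhom.
have ml a : m (l a) = x a := tlift_tinl rx rz e a.
have mr a : m (r a) = z a := tlift_tinr rx rz e a.
have am : alghom m.
  by have [h1 h2] := hm; split=> // c; rewrite [LHS]ml; case: hx.
have md v : m (ader self_tens v) = ader T (m v).
  apply: (tensor_der_ext hm) => [||a|a].
  - exact: (ader_derivation self_tens).
  - exact: ader_derivation.
  - rewrite [ader self_tens _](tder_tinl (ader_derivation S) (ader_derivation S) (ader_str S) (ader_str S)).
    by rewrite [LHS]ml [X in ader T X]ml.
  - rewrite [ader self_tens _](tder_tinr (ader_derivation S) (ader_derivation S) (ader_str S) (ader_str S)).
    by rewrite [LHS]mr [X in ader T X]mr.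
have -> : g = m \o gamma.
  apply: (pt_unique hx hg); first exact: gpoint_comp.
  move=> s; rewrite ag; have -> : x = m \o l by apply/funext => a; rewrite /= ml.
  by rewrite (act_comp s hl hga am) aga mr.
by rewrite /= -md dga (rhom0 hm).
Qed.

End SelfTensor.

Section Extension.
Variable A : alg (const F).
Notation T := (dext S A).

Definition extl : S -> T := tinl kS (astr A).
Definition extr : A -> T := tinr kS (astr A).

Lemma extl_alghom : alghom extl.
Proof. by have [hz hm] := tinl_ringhom kS (astr A). Qed.

Lemma extr_ringhom : ringhom extr.
Proof. exact: tinr_ringhom. Qed.

Lemma extr_str c : extr (astr A c) = astr T (const_inj F c).
Proof. by rewrite /extr -tinl_tinr. Qed.

Lemma extr_alghom : @alghom (const F) (restr (kappaF F) A) (restr (kstr (kappaF F)) T) extr.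
Proof. by have [hz hm] := extr_ringhom; split=> // c; rewrite [LHS]extr_str. Qed.

Lemma extr_inj a b : extr a = extr b -> a = b.
Proof.
move=> e; apply/eqP; rewrite -subr_eq0; apply/eqP.
by apply: (tinr_inj (f := kS)) => //; rewrite [LHS](rhomB extr_ringhom) e subrr.
Qed.

Lemma extr_gpoint h : apt A h -> gpt (extr \o h).
Proof. by move=> hh; exact: (pt_comp_alghom extr_alghom hh). Qed.

Let dkS c : ader S (kS c) = kS ((fun=> 0) c).
Proof. by rewrite /= ader_str const_injP !rmorph0. Qed.
Let dA0 c : (fun _ : A => 0) (astr A c) = astr A ((fun=> 0) c).
Proof. by rewrite rmorph0. Qed.

Lemma ader_extl s : ader T (extl s) = extl (ader S s).
Proof. exact: (tder_tinl (ader_derivation S) (derivation_cst0 A) dkS dA0). Qed.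

Lemma ader_extr a : ader T (extr a) = 0.
Proof.
rewrite -(rhom0 extr_ringhom).
exact: (tder_tinr (ader_derivation S) (derivation_cst0 A) dkS dA0).
Qed.

(** In a basis of A over K the coordinates of a constant of S (x) A are constants of S, hence lie in
    K. *)
Lemma ext_const (v : T) : ader T v = 0 -> exists a, extr a = v.
Proof.
move=> dv; have [B] := basis_exist A.
have /choice[c hc] t : exists c : const F, coT B t v = kS c.
  apply: S_const; rewrite -(@coT_der _ _ _ B _ kS t _ v (ader_derivation S)).
    by rewrite [X in coT _ _ X]dv coT0.
  by move=> c; rewrite dkS rmorph0.
have [s [_ _ ->]] := coT_decomp B v.
exists (\sum_(t <- s) astr A (c t) * t).
rewrite (rhom_sum extr_ringhom); apply: eq_bigr => t _.
by rewrite hc -[kS _]mul1r tpureZ.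
Qed.

Definition galois_act (h : G -> A) : T -> T := tlift (act extl (extr \o h)) extr.

Section Point.
Variables (h : G -> A) (hh : apt A h).
Let hk := extr_gpoint hh.

Lemma act_ext_alghom : alghom (act extl (extr \o h)).
Proof.
have [[[ha _ _] _] _] := tS; exact: (act_alghom hk extl_alghom ha).
Qed.

Let e c : act extl (extr \o h) (kS c) = extr (astr A c).
Proof. by have [_ _ ac] := act_ext_alghom; rewrite extr_str /= ac. Qed.

Lemma galois_act_ringhom : ringhom (galois_act h).
Proof. exact: (tlift_ringhom (alghom_ringhom act_ext_alghom) extr_ringhom e). Qed.

Lemma galois_act_extl s : galois_act h (extl s) = act extl (extr \o h) s.
Proof. exact: (tlift_tinl (alghom_ringhom act_ext_alghom) extr_ringhom e). Qed.

Lemma galois_act_extr a : galois_act h (extr a) = extr a.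
Proof. exact: (tlift_tinr (alghom_ringhom act_ext_alghom) extr_ringhom e). Qed.

Lemma galois_act_alghom : alghom (galois_act h).
Proof.
have [hz hm] := galois_act_ringhom; split=> // c.
by rewrite [LHS]galois_act_extl; case: act_ext_alghom.
Qed.

Lemma galois_act_der v : galois_act h (ader T v) = ader T (galois_act h v).
Proof.
have [_ hd] := tS.
apply: (tensor_der_ext galois_act_ringhom) => [||s|a].
- exact: (ader_derivation T).
- exact: (ader_derivation T).
- rewrite [ader T _]ader_extl [LHS]galois_act_extl [X in ader T X]galois_act_extl.
  apply: (act_der hk extl_alghom hd (ader_derivation T)) => [c|u|f].
  + exact: ader_str.
  + by rewrite ader_extl.
  + exact: ader_extr.
- by rewrite [ader T _]ader_extr [X in ader T X]galois_act_extr ader_extr (rhom0 galois_act_ringhom).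
Qed.

Lemma galois_act_base (w : tensor (const_inj F) (astr A)) :
  galois_act h (tmap (astr S) idfun w) = tmap (astr S) idfun w.
Proof.
have [rm ml mr] : [/\ ringhom (tmap (f := const_inj F) (g := astr A) (f' := kS) (g' := astr A) (astr S) idfun),
   forall c, tmap (f := const_inj F) (g := astr A) (f' := kS) (g' := astr A) (astr S) idfun (tinl (const_inj F) (astr A) c) = extl (astr S c)
  & forall a, tmap (f := const_inj F) (g := astr A) (f' := kS) (g' := astr A) (astr S) idfun (tinr (const_inj F) (astr A) a) = extr a].
  apply: tmap_ringhom => [||c]; [exact: rmorph_ringhom|exact: (ringhom_id A)|].
  by rewrite -tinl_tinr.
apply: (tensor_hom_ext (ringhom_comp rm galois_act_ringhom) rm) => a /=.
  have [_ _ ac] := act_ext_alghom; rewrite ml galois_act_extl; exact: ac.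
by rewrite mr galois_act_extr.
Qed.

End Point.

Lemma galois_actM h h' : apt A h -> apt A h' ->
  galois_act (gmul h h') =1 galois_act h \o galois_act h'.
Proof.
move=> hh hh'; have hhh := gmul_alghom hh hh'.
have [[[_ _ actM] _] _] := tS.
apply: (tensor_hom_ext (galois_act_ringhom hhh)).
- exact: (ringhom_comp (galois_act_ringhom hh') (galois_act_ringhom hh)).
- move=> s /=; rewrite [LHS](galois_act_extl hhh) [X in galois_act h X](galois_act_extl hh').
  have <- := act_comp s extl_alghom (extr_gpoint hh') (galois_act_alghom hh).
  rewrite -(gmul_comp extr_alghom hh hh').
  have := actM _ _ _ _ extl_alghom (extr_gpoint hh) (extr_gpoint hh') s.
  have -> : galois_act h \o extl = act extl (extr \o h).
    by apply/funext => a; exact: galois_act_extl.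
  have -> // : galois_act h \o (extr \o h') = extr \o h'.
  by apply/funext => a; exact: galois_act_extr.
- move=> a /=; rewrite [LHS](galois_act_extr hhh) [X in galois_act h X](galois_act_extr hh').
  by rewrite (galois_act_extr hh).
Qed.

Lemma galois_act1 : galois_act (@gone _ G (restr (kappaF F) A)) =1 id.
Proof.
have h1 := gone_alghom G (restr (kappaF F) A).
have [[[_ act1 _] _] _] := tS.
apply: (tensor_hom_ext (galois_act_ringhom h1) (ringhom_id _)) => a.
  rewrite [LHS](galois_act_extl h1) (gone_comp G extr_alghom).
  exact: act1 extl_alghom a.
by rewrite [LHS](galois_act_extr h1).
Qed.

Lemma galois_act_ext_aut h : apt A h -> ext_aut (galois_act h).
Proof.
move=> hh; have hv := ginv_alghom hh; have [hz hm] := galois_act_ringhom hh.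
split=> //.
- exists (galois_act (ginv h)) => v.
    rewrite -[LHS](galois_actM hv hh) (gmulVx hh); exact: galois_act1.
  rewrite -[LHS](galois_actM hh hv) (gmulxV hh); exact: galois_act1.
- exact: galois_act_der.
- exact: galois_act_base.
Qed.

Lemma galois_act_inj h h' : apt A h -> apt A h' -> galois_act h =1 galois_act h' -> h =1 h'.
Proof.
move=> hh hh' e f; apply: extr_inj.
have : extr \o h = extr \o h'.
  apply: (pt_unique extl_alghom (extr_gpoint hh) (extr_gpoint hh')) => s.
  by rewrite -!galois_act_extl.
by move/(congr1 (fun k => k f)).
Qed.

(** [alpha] moves the tautological point of S to another differential point. The torsor property
    gives the [g] between them, [differential_points] makes it constant, and [ext_const] brings it
    down to A. *)
Lemma galois_act_surj alpha : ext_aut alpha -> exists2 h, apt A h & galois_act h =1 alpha.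
Proof.
move=> [az am _ ad ab]; have ra : ringhom alpha by [].
have [[_ [_ _ tors]] _] := tS.
have e0 c : tinl kS (astr A) (astr S (const_inj F c)) = tinr kS (astr A) (idfun (astr A c)).
  by rewrite -tinl_tinr.
have [rm ml mr] := tmap_ringhom (rmorph_ringhom (astr S)) (ringhom_id A) e0.
have al c : alpha (extl (astr S c)) = extl (astr S c).
  by have := ab (tinl (const_inj F) (astr A) c); rewrite ml.
have ar a : alpha (extr a) = extr a.
  by have := ab (tinr (const_inj F) (astr A) a); rewrite mr.
have hz : alghom (alpha \o extl).
  have [h1 h2] := ringhom_comp (alghom_ringhom extl_alghom) ra.
  by split=> // c; rewrite /= al.
have [g [hg ag _]] := tors T extl (alpha \o extl) extl_alghom hz.
have dg : forall f, ader T (g f) = 0.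
  apply: (differential_points (T := T) (x := extl) (z := alpha \o extl)) => //.
    by split; [exact: extl_alghom | move=> s; rewrite ader_extl].
  by split=> // s; have := ad (extl s); rewrite ader_extl.
have /choice[h hE] f := ext_const (dg f).
have gE : g = extr \o h by apply/funext => f; rewrite /= hE.
have hh : apt A h.
  have rg := gpoint_ringhom hg; have re := extr_ringhom.
  have [] : ringhom h.
    apply: ringhomP => [u v||u v]; apply: extr_inj; rewrite ?(rhomD re) ?(rhomM re) ?(rhom1 re) !hE.
    - exact: rhomD.
    - exact: rhom1.
    - exact: rhomM.
  move=> h1 h2; split=> // c; apply: extr_inj; rewrite hE [RHS]extr_str.
  by case: hg.
exists h => //; apply: (tensor_hom_ext (galois_act_ringhom hh) ra) => a.
  by rewrite [LHS](galois_act_extl hh) -gE ag.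
by rewrite [LHS](galois_act_extr hh) [RHS]ar.
Qed.

End Extension.

Lemma galois_act_natural (A B : alg (const F)) (u : A -> B) (h : G -> A) :
  alghom u -> apt A h -> forall x : dext S A,
  galois_act (u \o h) (tmap idfun u x) = tmap idfun u (galois_act h x).
Proof.
move=> hu hh; have [_ _ uc] := hu; have ru := alghom_ringhom hu.
have hu' : @alghom (const F) (restr (kappaF F) A) (restr (kappaF F) B) u.
  by have [h1 h2] := ru; split=> // c; rewrite /= uc.
have huh : apt B (u \o h) := pt_comp_alghom hu' hh.
have e c : tinl kS (astr B) (idfun (kS c)) = tinr kS (astr B) (u (astr A c)).
  by rewrite uc tinl_tinr.
have [rm ml mr] := tmap_ringhom (ringhom_id S) ru e.
have am : @alghom F (dext S A) (dext S B) (tmap idfun u).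
  by have [h1 h2] := rm; split=> // c; exact: ml.
apply: (tensor_hom_ext (ringhom_comp rm (galois_act_ringhom huh))
          (ringhom_comp (galois_act_ringhom hh) rm)) => a /=.
  rewrite [X in galois_act _ X]ml [LHS](galois_act_extl huh).
  rewrite [X in tmap idfun u X](galois_act_extl hh).
  have <- := act_comp a (extl_alghom A) (extr_gpoint hh) am.
  have -> : tmap idfun u \o @extl A = @extl B by apply/funext => b; exact: ml.
  have -> // : tmap idfun u \o (@extr A \o h) = @extr B \o (u \o h).
  by apply/funext => b; exact: mr.
rewrite [X in galois_act _ X]mr [LHS](galois_act_extr huh).
by rewrite [X in tmap idfun u X](galois_act_extr hh) [RHS]mr.
Qed.

Theorem torsor_galois : galois_torsor S.
Proof.
exists galois_act; last by move=> A h hh r; exact: galois_act_extl.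
split; last exact: galois_act_natural.
move=> A; split.
- exact: galois_act_ext_aut.
- exact: galois_actM.
- exact: galois_act_inj.
- exact: galois_act_surj.
Qed.

End GaloisGroup.

(** * Induced torsors and extension of scalars *)

Section Induced.
Variables (K : fieldType) (L : diffField) (kappa : {rmorphism K -> const L}).
Variables (G : algGroup K) (H : closedSubgroup G) (R : gAlg kappa H) (S : gAlg kappa G).
Variable sigma : S -> dtens R (coordL kappa G).
Hypothesis hsigma : is_induced sigma.

Lemma gone_gpoint (T : alg L) : gpoint kappa (@gone K G (restr (kstr kappa) T)).
Proof. exact: gone_alghom. Qed.

Section Pair.
Variables (T : alg L) (x : R -> T) (g : G -> T).
Hypotheses (hx : alghom x) (hg : gpoint kappa g).

Let e c : x (astr R c) = ptL (kappa := kappa) g (astr (coordL kappa G) c).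
Proof. by rewrite (ptL_tinl hg); case: hx. Qed.

Lemma pairpt_ringhom : ringhom (pairpt x g).
Proof. exact: (tlift_ringhom (alghom_ringhom hx) (ptL_ringhom hg) e). Qed.

Lemma pairpt_tinl r : pairpt x g (tinl (astr R) (astr (coordL kappa G)) r) = x r.
Proof. exact: (tlift_tinl (alghom_ringhom hx) (ptL_ringhom hg) e). Qed.

Lemma pairpt_tinr f : pairpt x g (tinr (astr R) (astr (coordL kappa G)) f) =
  ptL (kappa := kappa) g f.
Proof. exact: (tlift_tinr (alghom_ringhom hx) (ptL_ringhom hg) e). Qed.
End Pair.

Lemma pairpt_comp (T T' : alg L) (u : T -> T') (x : R -> T) (g : G -> T) :
  alghom x -> gpoint kappa g -> alghom u ->
  pairpt (u \o x) (u \o g) =1 u \o pairpt x g.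
Proof.
move=> hx hg hu; have hux := alghom_comp hx hu; have hug := gpoint_comp hg hu.
apply: (tensor_hom_ext (pairpt_ringhom hux hug)).
- exact: ringhom_comp (pairpt_ringhom hx hg) (alghom_ringhom hu).
- by move=> r /=; rewrite [LHS](pairpt_tinl hux hug) [X in u X](pairpt_tinl hx hg).
move=> f /=; rewrite [LHS](pairpt_tinr hux hug) [X in u X](pairpt_tinr hx hg).
apply: (tensor_hom_ext (ptL_ringhom hug) (ringhom_comp (ptL_ringhom hg) (alghom_ringhom hu))).
- by move=> a /=; rewrite [LHS](ptL_tinl hug) [X in u X](ptL_tinl hg); case: hu.
- by move=> a /=; rewrite [LHS](ptL_tinr hug) [X in u X](ptL_tinr hg).
Qed.

Definition unit_pt : dtens R (coordL kappa G) -> R :=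
  pairpt (T := R) id (@gone K G (restr (kstr kappa) R)).

Let idR : alghom (@id R). Proof. by have [hz hm] := ringhom_id R. Qed.
Let g1 := gone_gpoint R.

Lemma unit_pt_der v : unit_pt (ader (dtens R (coordL kappa G)) v) = ader R (unit_pt v).
Proof.
have dLc c : fder (kstr kappa c) = kstr kappa ((fun=> 0) c) by rewrite kstrP rmorph0.
have dGc c : (fun _ : G => 0) (astr G c) = astr G ((fun=> 0) c) by rewrite rmorph0.
apply: (tensor_der_ext (pairpt_ringhom idR g1)) => [||r|l].
- exact: (ader_derivation (dtens R (coordL kappa G))).
- exact: (ader_derivation R).
- rewrite [X in pairpt _ _ X](tder_tinl (ader_derivation R) (ader_derivation (coordL kappa G))
    (ader_str R) (ader_str (coordL kappa G))).
  by rewrite [LHS](pairpt_tinl idR g1) [X in _ = ader R X](pairpt_tinl idR g1).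
rewrite [X in pairpt _ _ X](tder_tinr (ader_derivation R) (ader_derivation (coordL kappa G))
    (ader_str R) (ader_str (coordL kappa G))).
rewrite [LHS](pairpt_tinr idR g1) [X in _ = ader R X](pairpt_tinr idR g1).
apply: (tensor_der_ext (ptL_ringhom g1)) => [||c|f].
- exact: coordL_derivation.
- exact: (ader_derivation R).
- rewrite [X in ptL _ X](tder_tinl (fder_derivation L) (derivation_cst0 G) dLc dGc).
  by rewrite [LHS](ptL_tinl g1) [X in _ = ader R X](ptL_tinl g1) ader_str.
- rewrite [X in ptL _ X](tder_tinr (fder_derivation L) (derivation_cst0 G) dLc dGc).
  rewrite [LHS](ptL_tinr g1) [X in _ = ader R X](ptL_tinr g1) (rhom0 (gpoint_ringhom g1)).
  by rewrite /gone /= ader_str kstrP rmorph0.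
Qed.

(* Spec R -> Spec S, y |-> (y, 1) *)
Definition ind_pt : S -> R := unit_pt \o sigma.

Lemma ind_pt_dalghom : dalghom ind_pt.
Proof.
have [[hs ds] _ _ _] := hsigma; split.
  have [z1 z2] := ringhom_comp (alghom_ringhom hs) (pairpt_ringhom idR g1).
  split=> // c; have [_ _ sc] := hs; rewrite /ind_pt /= sc.
  exact: (pairpt_tinl idR g1).
by move=> s; rewrite /ind_pt /= ds unit_pt_der.
Qed.

(** Write the unit as h^-1 h: by H-invariance (x.h, h^-1 h) and (x, h) give the same point of Spec
    S, and that of (x, h) is the point of (x, 1) moved by h. *)
Lemma ind_pt_equivariant (T : alg L) (x : R -> T) (h : H -> T) : alghom x ->
  gpoint kappa h -> alghom (act x h) ->
  act x h \o ind_pt =1 act (x \o ind_pt) (h \o sgmap H).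
Proof.
move=> hx hh hxh s; have [_ _ inv eqv] := hsigma.
have gT := gone_gpoint T.
have hhs : gpoint kappa (h \o sgmap H) := pt_comp_alghom hh (sgmap_alghom H).
have e1 : @gone K G (restr (kstr kappa) T) = gmul (ginv h \o sgmap H) (h \o sgmap H).
  rewrite (gmul_sgmap (T := restr (kstr kappa) T) (ginv_alghom hh) hh) (gmulVx hh).
  by rewrite gone_sgmap.
have unitE (x' : R -> T) : alghom x' ->
    pairpt x' (@gone K G (restr (kstr kappa) T)) =1 x' \o unit_pt.
  move=> hx' v; rewrite -[RHS](pairpt_comp idR g1 hx').
  congr (pairpt _ _ v); apply/funext => f; rewrite /gone /=.
  by case: hx'.
rewrite -[LHS](unitE _ hxh (sigma s)) e1.
have -> : pairpt (act x h) (gmul (ginv h \o sgmap H) (h \o sgmap H)) (sigma s)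
    = pairpt x (h \o sgmap H) (sigma s).
  by have [_ iv] := inv (sigma s); apply: iv; [exists s|..].
have := eqv T x _ _ hx gT hhs s; rewrite /= (gmul1x hhs) => <-.
congr (act _ _ s); apply/funext => s'; exact: unitE.
Qed.

End Induced.

Section ScalarExtension.
Variables (F M : diffField) (phi : diffHom F M) (G : algGroup (const F)).
Variables (S : gAlg (kappaF F) G) (SM : gAlg (const_map phi) G).
Variable Phi : bcG phi (const_map phi) S -> SM.
Hypotheses (hPhi : dalghom Phi) (ePhi : equivariant Phi).
Hypothesis coact_hom : alghom (@coact _ _ _ _ S).

Definition from_base (s : S) : SM := Phi (tinr phi (astr S) s).

Lemma from_base_alghom : @alghom F S (Alg (astr SM \o phi)) from_base.
Proof.
have [hp _] := hPhi; have [_ _ pc] := hp.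
have [z1 z2] := ringhom_comp (tinr_ringhom phi (astr S)) (alghom_ringhom hp).
split=> // c; rewrite /from_base -tinl_tinr.
exact: pc.
Qed.

Lemma from_base_der s : from_base (ader S s) = ader SM (from_base s).
Proof.
have [_ dp] := hPhi; rewrite /from_base -dp.
have dphi c : fder (phi c) = phi (fder c) by rewrite dhomP.
by rewrite [X in _ = Phi X](tder_tinr (fder_derivation M) (ader_derivation S) dphi (ader_str S)).
Qed.

(** Equivariance reduces the claim to the base-changed co-action, which on 1 (x) s comes from the
    co-action of S. *)
Lemma act_from_base (T : alg M) (x : SM -> T) (g : G -> T) s :
  alghom x -> gpoint (const_map phi) g ->
  act x g (from_base s) = act (T := restr phi T) (x \o from_base) g s.
Proof.
move=> hx hg; rewrite -[LHS](ePhi hx hg (tinr phi (astr S) s)).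
have hg' : gpoint (kappaF F) (T := restr phi T) g.
  by have [z1 z2 z3] := hg; split=> // c; rewrite z3.
have [hp _] := hPhi.
have hxp : alghom (x \o Phi).
  have [z1 z2] := ringhom_comp (alghom_ringhom hp) (alghom_ringhom hx).
  by split=> // c; have [_ _ /= ->] := hp; case: hx.
have hxf : @alghom F S (restr phi T) (x \o from_base).
  have [z1 z2] := ringhom_comp (alghom_ringhom from_base_alghom) (alghom_ringhom hx).
  by split=> // c; have [_ _ /= ->] := from_base_alghom; case: hx.
pose cm := @coordL_map _ _ _ phi (kappaF F) (const_map phi) G.
have ecm c : tinl (kstr (const_map phi)) (astr G) (phi (kstr (kappaF F) c))
   = tinr (kstr (const_map phi)) (astr G) (id (astr G c)).
  by rewrite -tinl_tinr.
have [rcm cml cmr] := tmap_ringhom (rmorph_ringhom phi) (ringhom_id G) ecm.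
have rt := tinr_ringhom phi (astr S).
have em c : tinl (astr (dbc phi S)) (astr (coordL (const_map phi) G)) (tinr phi (astr S) (astr S c)) =
   tinr (astr (dbc phi S)) (astr (coordL (const_map phi) G)) (cm (astr (coordL (kappaF F) G) c)).
  by rewrite -tinl_tinr [X in tinr _ _ X]cml -tinl_tinr.
have [rm ml mr] := tmap_ringhom rt rcm em.
have rc := alghom_ringhom coact_hom.
have rb := ringhom_comp rc rm.
have ra := ringhom_comp (tinl_ringhom phi (astr S)) (tinl_ringhom (astr (dbc phi S)) (astr (coordL (const_map phi) G))).
have ec c : (tinl (astr (dbc phi S)) (astr (coordL (const_map phi) G)) \o tinl phi (astr S)) (phi c)
    = (tmap (tinr phi (astr S)) cm \o @coact _ _ _ _ S) (astr S c).
  have [_ _ /= ->] := coact_hom; rewrite ml /=.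
  by rewrite -tinl_tinr.
rewrite /act [X in tlift _ _ X](tlift_tinr ra rb ec) /=.
apply: (tensor_hom_ext (ringhom_comp rm (pt_ringhom hg hxp)) (pt_ringhom hg' hxf)) => a /=.
  by rewrite ml [LHS](pt_tinl hg hxp) [RHS](pt_tinl hg' hxf).
rewrite mr [LHS](pt_tinr hg hxp) [RHS](pt_tinr hg' hxf).
apply: (tensor_hom_ext (ringhom_comp rcm (ptL_ringhom hg)) (ptL_ringhom hg')) => b /=.
  by rewrite [X in ptL _ X]cml [LHS](ptL_tinl hg) [RHS](ptL_tinl hg').
by rewrite [X in ptL _ X]cmr [LHS](ptL_tinr hg) [RHS](ptL_tinr hg').
Qed.

End ScalarExtension.

(** * Factorization systems *)

Section Embedding.
Variables (X : diffFactSystem) (F : diffField) (lim : limitCone X F).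
Variables (G : algGroup (const F)) (k : Ie X) (b : bool).
Let i := @inc X k b.
Variable Sv : forall i, gAlg (kappaV lim i) G.
Variables (H : closedSubgroup G) (R : gAlg (kappaV lim i) H).
Variables (e : R -> Fe k) (sigma : Sv i -> dtens R (coordL (kappaV lim i) G)).
Hypotheses (he : @dalghom _ R (field_dalg (res k b)) e) (hs : alghom sigma).

Notation reg := (regular_torsor (kappaE lim k) G).

Definition unit_E : reg -> Fe k :=
  @ptL (const F) (Fe k) (kappaE lim k) G (Alg (@idfun (Fe k)))
    (@gone (const F) G (restr (kstr (kappaE lim k)) (Alg (@idfun (Fe k))))).

(** Evaluating r (x) f |-> e(r) f at the unit of G gives e(r f(1)), which is [e] after the point (y,
    1). Through it the prescribed form of Theta becomes agreement of the points of S inside F_k. *)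
Lemma embedding_unit s :
  unit_E (embedding_map e sigma (tinr (res k b) (astr (Sv i)) s)) = e (ind_pt sigma s).
Proof.
have [ha _] := he; have re := alghom_ringhom ha; have [_ _ ec] := ha.
have hg := gone_gpoint (kappaE lim k) G (Alg (@idfun (Fe k))).
have ru : ringhom unit_E := ptL_ringhom hg.
have ul c : unit_E (tinl (kstr (kappaE lim k)) (astr G) c) = c := ptL_tinl hg c.
have ur f : unit_E (tinr (kstr (kappaE lim k)) (astr G) f) = toE lim k (const_inj F (counit G f))
  := ptL_tinr hg f.
have g1 := gone_gpoint (kappaV lim i) G R.
have idR : alghom (@id R) by have [hz hm] := ringhom_id R.
have e1 c : tinl (kstr (kappaE lim k)) (astr G) (res k b (kstr (kappaV lim i) c)) =
    tinr (kstr (kappaE lim k)) (astr G) (id (astr G c)).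
  by rewrite -tinl_tinr /= coneP.
have [rm ml mr] := tmap_ringhom (rmorph_ringhom (res k b)) (ringhom_id G) e1.
have rae := ringhom_comp re (tinl_ringhom (kstr (kappaE lim k)) (astr G)).
pose cm : coordL (kappaV lim i) G -> coordL (kappaE lim k) G := tmap (res k b) id.
have e2 c : (tinl (kstr (kappaE lim k)) (astr G) \o e) (astr R c)
    = cm (astr (coordL (kappaV lim i) G) c).
  by rewrite [RHS]ml /= ec.
pose q : dtens R (coordL (kappaV lim i) G) -> reg :=
  tlift (tinl (kstr (kappaE lim k)) (astr G) \o e) cm.
have rq : ringhom q := tlift_ringhom rae rm e2.
have ql r : q (tinl (astr R) (astr (coordL (kappaV lim i) G)) r) =
  tinl (kstr (kappaE lim k)) (astr G) (e r) := tlift_tinl rae rm e2 r.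
have qr l : q (tinr (astr R) (astr (coordL (kappaV lim i) G)) l) = cm l := tlift_tinr rae rm e2 l.
have e3 c : tinl (kstr (kappaE lim k)) (astr G) (res k b c) = (q \o sigma) (astr (Sv i) c).
  have [_ _ /= ->] := hs; rewrite [RHS]ql ec //.
have -> : embedding_map e sigma (tinr (res k b) (astr (Sv i)) s) = q (sigma s).
  exact: (tlift_tinr (tinl_ringhom (kstr (kappaE lim k)) (astr G))
    (ringhom_comp (alghom_ringhom hs) rq) e3 s).
rewrite /ind_pt /=; move: (sigma s).
apply: (tensor_hom_ext (ringhom_comp rq ru) (ringhom_comp (pairpt_ringhom idR g1) re)) => a /=.
  by rewrite [X in unit_E X]ql ul [X in _ = e X](pairpt_tinl idR g1).
rewrite [X in unit_E X]qr [X in _ = e X](pairpt_tinr idR g1).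
apply: (tensor_hom_ext (ringhom_comp rm ru) (ringhom_comp (ptL_ringhom g1) re)) => c /=.
  by rewrite [X in unit_E X]ml ul [X in _ = e X](ptL_tinl g1) ec.
rewrite [X in unit_E X]mr ur [X in _ = e X](ptL_tinr g1) /gone /=.
by rewrite (ec (toV lim i _)) /= coneP.
Qed.

End Embedding.

(** The action of [h] on the tautological point is the restriction of the automorphism theta(h),
    hence an L-algebra morphism. *)
Lemma galois_act_exists (K : fieldType) (L : diffField) (kappa : {rmorphism K -> const L})
    (H : algGroup K) (R : gAlg kappa H) : galois_torsor R ->
  forall (A : alg (const L)) (h : H -> A), @alghom K H (restr kappa A) h ->
  alghom (@act _ _ _ H R (dext R A) (tinl (astr R \o const_inj L) (astr A))
    (tinr (astr R \o const_inj L) (astr A) \o h)).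
Proof.
move=> [theta [hth _] ht] A h hh; have [aut _ _ _] := hth A.
have [tz tm _ _ tb] := aut h hh; set x := tinl _ _.
have rt : ringhom (theta A h) by [].
have rx : ringhom x := tinl_ringhom (astr R \o const_inj L) (astr A).
have [z1 z2] := eq_ringhom (ht A h hh) (ringhom_comp rx rt).
split=> // c; rewrite -[LHS](ht A h hh).
have e0 a : tinl (astr R \o const_inj L) (astr A) (astr R (const_inj L a)) =
   tinr (astr R \o const_inj L) (astr A) (idfun (astr A a)) by rewrite -tinl_tinr.
have [rm ml mr] := tmap_ringhom (rmorph_ringhom (astr R)) (ringhom_id A) e0.
by have := tb (tinl (const_inj L) (astr A) c); rewrite ml.
Qed.

(** * Gluing along the inverse limit *)

Section Limit.
Variables (X : diffFactSystem) (F : diffField) (lim : limitCone X F).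

(** Without vertices there are no edges, and every element of F solves the empty gluing problem;
    uniqueness would give 0 = 1. *)
Lemma vertex_exists : exists i : Iv X, True.
Proof.
apply: contrapT => nv.
have nve (k : Ie X) : False by apply: nv; exists (inc k true).
have nvi (i : Iv X) : False by apply: nv; exists i.
have [x [_ ux]] := limitP lim (xv := fun=> 0) (xe := fun=> 0)
  (fun k b => match nve k with end).
have e0 : x = 0 by apply: ux; split=> [i|k]; [case: (nvi i) | case: (nve k)].
have e1 : x = 1 by apply: ux; split=> [i|k]; [case: (nvi i) | case: (nve k)].
by have := oner_neq0 F; rewrite -e1 e0 eqxx.
Qed.

Lemma diffHom_inj (L M : diffField) (phi : diffHom L M) x : phi x = 0 -> x = 0.
Proof. by move/eqP; rewrite fmorph_eq0 => /eqP. Qed.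

Variables (G : algGroup (const F)) (S : gAlg (kappaF F) G).
Variable R : forall i : Iv X, diffAlg (Fv i).
Variable y : forall i, S -> overF (toV lim) R i.
Hypothesis y_alghom : forall i, alghom (y i).
Variable e : forall (k : Ie X) (b : bool), R (inc k b) -> Fe k.
Hypothesis e_alghom : forall k b, @alghom (Fv (inc k b)) (R (inc k b)) (Alg (res k b)) (@e k b).
Hypothesis e_inj : forall k b, injective (@e k b).
Hypothesis ey : forall k s, e (b := true) (y (inc k true) s) = e (b := false) (y (inc k false) s).

Let re k b : ringhom (@e k b). Proof. exact: alghom_ringhom (e_alghom k b). Qed.

Let e_eq0 k b r : @e k b r = 0 -> r = 0.
Proof. by move=> h; apply: (@e_inj k b); rewrite h (rhom0 (re k b)). Qed.

Let eyb k b s : e (b := b) (y (inc k b) s) = e (b := true) (y (inc k true) s).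
Proof. by case: b; rewrite ?ey. Qed.

(* The indicator functions of the vertices i with y_i(s) <> 0 define an       *)
(* element of the limit F, which is a field.                                  *)
Lemma limit_connect i j s : y i s = 0 -> y j s = 0.
Proof.
pose xv i' : Fv i' := if pselect (y i' s = 0) then 0 else 1.
pose xe (k : Ie X) : Fe k := if pselect (y (inc k true) s = 0) then 0 else 1.
have hx k b : res k b (xv (inc k b)) = xe k.
  have iff0 : y (inc k b) s = 0 <-> y (inc k true) s = 0.
    split=> h; [apply: (@e_eq0 k true)|apply: (@e_eq0 k b)].
      by rewrite -(eyb k b) h; exact: (rhom0 (re k b)).
    by rewrite (eyb k b) h; exact: (rhom0 (re k true)).
  rewrite /xv /xe; case: pselect => [h|h]; case: pselect => [h'|h'].
  - exact: rmorph0.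
  - by case: h'; apply/iff0.
  - by case: h; apply/iff0.
  - exact: rmorph1.
have [x [[hv _] _]] := limitP lim hx => yi.
have x0 : x = 0.
  by apply: (@diffHom_inj _ _ (toV lim i)); rewrite hv /xv; case: pselect.
have := hv j; rewrite x0 rmorph0 /xv; case: pselect => // _ /esym/eqP.
by rewrite oner_eq0.
Qed.

(** Inside F_k both constants above an edge equal the ratio of the images of [w] and [u], so they
    glue to an element of F. It is constant because its image in some F_i is and F embeds in F_i. *)
Lemma limit_glue (c : forall i, const (Fv i)) (u w : S) :
  (forall i, y i u <> 0) ->
  (forall i, y i w = astr (R i) (const_inj (Fv i) (c i)) * y i u) ->
  exists c0 : const F, forall i, y i w = y i (astr S (const_inj F c0)) * y i u.
Proof.
move=> hu hw.
pose xe (k : Ie X) : Fe k := res k true (const_inj _ (c (inc k true))).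
have ew k b : e (b := b) (y (inc k b) w) =
    res k b (const_inj _ (c (inc k b))) * e (b := b) (y (inc k b) u).
  rewrite hw [LHS](rhomM (re k b)); congr (_ * _).
  by have [_ _ ec] := e_alghom k b; exact: ec.
have hx k b : res k b (const_inj _ (c (inc k b))) = xe k.
  have := ew k b; rewrite !eyb ew => /esym h; apply: (mulIf _ h).
  by apply/eqP => /e_eq0; exact: hu.
have [x [[hv _] _]] := limitP lim (xv := fun i => const_inj _ (c i)) hx.
have [i0 _] := vertex_exists.
have dx : x \in is_const F.
  apply/eqP/(@diffHom_inj _ _ (toV lim i0)).
  by rewrite dhomP hv; exact: const_injP.
exists (Const dx) => i; rewrite hw; congr (_ * _).
by have [_ _ ->] := y_alghom i; rewrite /= hv.
Qed.

End Limit.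

Theorem theorem2p5
  (X : diffFactSystem) (F : diffField) (lim : limitCone X F)
  (sfp : simultaneous_factorization X)
  (G : algGroup (const F))
  (Sv : forall i : Iv X, gAlg (kappaV lim i) G)
  (Se : forall k : Ie X, gAlg (kappaE lim k) G)
  (Theta : forall (k : Ie X) (b : bool),
     bcG (res k b) (kappaE lim k) (Sv (inc k b)) -> Se k)
  (patching : patching_problem Theta)
  (S : gAlg (kappaF F) G)
  (Phi : forall i : Iv X, bcG (toV lim i) (kappaV lim i) S -> Sv i)
  (solution : patching_solution Theta Phi)
  (S_limit : solution_is_limit Theta Phi)
  (H : Iv X -> closedSubgroup G)
  (G_generated : generated_by H)
  (R : forall i : Iv X, gAlg (kappaV lim i) (H i))
  (R_pv : forall i : Iv X, picard_vessiot (R i))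
  (R_galois : forall i : Iv X, galois_torsor (R i))
  (sigma : forall i : Iv X, Sv i -> dtens (R i) (coordL (kappaV lim i) G))
  (S_induced : forall i : Iv X, is_induced (sigma i))
  (tau : forall k : Ie X, Se k -> regular_torsor (kappaE lim k) G)
  (S_regular : forall k : Ie X, torsor_iso (tau k))
  (e : forall (k : Ie X) (b : bool), R (inc k b) -> Fe k)
  (e_embedding : forall (k : Ie X) (b : bool),
     @dalghom _ (R (inc k b)) (field_dalg (res k b)) (@e k b) /\
     injective (@e k b))
  (Theta_e : forall (k : Ie X) (b : bool)
     (x : bcG (res k b) (kappaE lim k) (Sv (inc k b))),
     tau k (Theta k b x) = embedding_map (@e k b) (@sigma (inc k b)) x) :
  picard_vessiot S /\ galois_torsor S.
Proof.
have [tS iso_Phi glue_Phi] := solution.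
have [[[coact_hom _ _] _] _] := tS.
have hPhi i : dalghom (Phi i) by have [] := iso_Phi i.
have ePhi i : equivariant (Phi i) by have [] := iso_Phi i.
have hsv i := from_base_alghom (hPhi i).
have hind i := ind_pt_dalghom (S_induced i).
(* The point (y, 1) of the induced torsor, restricted from S_i to S along Phi_i. *)
pose y i : S -> overF (toV lim) (fun i => R i) i := ind_pt (sigma i) \o from_base (Phi i).
have y_alghom i : alghom (y i).
  have [hi _] := hind i; have [_ _ ic] := hi; have [_ _ sc] := hsv i.
  have [z1 z2] := ringhom_comp (alghom_ringhom (hsv i)) (alghom_ringhom hi).
  by split=> // c; rewrite /y /= sc; exact: ic.
have y_der i s : y i (ader S s) = ader (R i) (y i s).
  have [_ dind] := hind i.
  by rewrite /y /= (from_base_der (hPhi i)); exact: dind.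
have e_alghom k b : @alghom (Fv (inc k b)) (R (inc k b)) (Alg (res k b)) (@e k b).
  by have [[]] := e_embedding k b.
(* Both sides are the value at the unit of G of the common image of [s] in S_k = F_k[G]. *)
have ey k s : e k true (y (inc k true) s) = e k false (y (inc k false) s).
  have step b : e k b (y (inc k b) s) =
      unit_E (tau k (Theta k b (tinr (res k b) (astr (Sv (inc k b))) (toSv Phi (inc k b) s)))).
    have [he _] := e_embedding k b; have [[hs _] _ _ _] := S_induced (inc k b).
    by rewrite Theta_e; exact/esym/embedding_unit.
  have ge b : id_tensor_Phi Phi b (tinr (toE lim k) (astr S) s) =
      tinr (res k b) (astr (Sv (inc k b))) (toSv Phi (inc k b) s).
    have rl := tinl_ringhom (res k b) (astr (Sv (inc k b))).
    have rr := ringhom_comp (alghom_ringhom (hsv (inc k b)))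
      (tinr_ringhom (res k b) (astr (Sv (inc k b)))).
    apply: (tlift_tinr rl rr) => c.
    have [_ _ sc] := hsv (inc k b).
    by rewrite /= sc /= -tinl_tinr coneP.
  rewrite !step -!ge; congr (unit_E (tau k _)).
  exact: (glue_Phi k (tinr (toE lim k) (astr S) s)).
have e_inj k b : injective (@e k b) by have [] := e_embedding k b.
have connect i j s := @limit_connect X F lim G S (fun i => R i) y e e_alghom e_inj ey i j s.
have glue := limit_glue y_alghom e_alghom e_inj ey.
(* H_i acts on Spec R_i by Galois automorphisms; through [ind_pt] and Phi_i this becomes the action
   on S of its points in G. *)
have equiv i (A : alg (const (Fv i))) (h : H i -> A) :
    @alghom (const F) (H i) (restr (const_map (toV lim i)) A) h ->
    exists2 theta : overF (toV lim) (fun i => R i) i -> dextF (toV lim) (fun i => R i) A, alghom theta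
    & forall s, theta (y i s) =
        act (@dinl F _ _ (toV lim) (fun i => R i) i A \o y i)
            (@dinr F _ _ (toV lim) (fun i => R i) i A \o (h \o sgmap (H i))) s.
  move=> hh.
  pose x : R i -> dext (R i) A := tinl (astr (R i) \o const_inj (Fv i)) (astr A).
  pose r : A -> dext (R i) A := tinr (astr (R i) \o const_inj (Fv i)) (astr A).
  have hact : alghom (act x (r \o h)) := galois_act_exists (R_galois i) hh.
  have hx : @alghom (Fv i) (R i) (dext (R i) A) x.
    by have [z1 z2] := tinl_ringhom (astr (R i) \o const_inj (Fv i)) (astr A).
  have hr : @gpoint _ _ (kappaV lim i) (H i) (dext (R i) A) (r \o h).
    have [z1 z2] := ringhom_comp (alghom_ringhom hh) (tinr_ringhom (astr (R i) \o const_inj (Fv i)) (astr A)).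
    by split=> // c; have [_ _ /= ->] := hh; rewrite /r -tinl_tinr.
  exists (act x (r \o h)).
    by have [z1 z2 z3] := hact; split=> // c; exact: z3.
  move=> s; have := ind_pt_equivariant (S_induced i) hx hr hact (from_base (Phi i) s).
  move=> /= ->.
  have [hi _] := hind i.
  have hg : gpoint (kappaV lim i) ((r \o h) \o sgmap (H i)) :=
    pt_comp_alghom hr (sgmap_alghom (H i)).
  exact: (act_from_base (hPhi i) (ePhi i) coact_hom s (alghom_comp hi hx) hg).
have R_simple i : diff_simple (R i) by have [] := R_pv i.
have R_const i (x : R i) : ader (R i) x = 0 ->
    exists c : const (Fv i), x = astr (R i) (const_inj (Fv i) c).
  by have [_ _] := R_pv i; apply.
have [i0 _] := vertex_exists lim.
have simple : diff_simple S.
  exact: (torsor_simple tS i0 R_simple R_const y_alghom y_der connect glue G_generated equiv).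
have consts (s : S) : ader S s = 0 -> exists c : const F, s = astr S (const_inj F c).
  exact: (torsor_const tS i0 R_simple R_const y_alghom y_der connect glue G_generated equiv).
split; first exact: torsor_picard_vessiot.
exact: torsor_galois.
Qed.
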